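(* Let $\beta$ be an s-tensor norm of order $n$. Then, with equality of classes and of norms, $$\mathcal{Q}_{/\beta\backslash}\overset{1}{=}\mathcal{Q}_{\beta}\circ\mathcal{L}_\infty\qquad\text{and}\qquad \mathcal{Q}_{\backslash\beta/}\overset{1}{=}\mathcal{Q}_{\beta}\circ(\mathcal{L}_1)^{-1}.$$
   Context: **s-tensor norms.** $\otimes^{n,s}E$ is the $n$-fold symmetric tensor product of a Banach space $E$ over $\mathbb K$; $\varepsilon_{n,s}$ and $\pi_{n,s}$ are the injective and projective symmetric tensor norms. An s-tensor norm $\beta$ of order $n$ assigns to each Banach space $E$ a norm $\beta(\cdot;\otimes^{n,s}E)$ on $\otimes^{n,s}E$ (the normed space is written $\otimes^{n,s}_\beta E$, its completion $\widetilde\otimes^{n,s}_\beta E$) such that $\varepsilon_{n,s}\le\beta\le\pi_{n,s}$ and $\|\otimes^{n,s}T:\otimes^{n,s}_\beta E\to\otimes^{n,s}_\beta F\|\le\|T\|^n$ for every $T\in\mathcal L(E,F)$ (bounded linear operators). All s-tensor norms are assumed finitely generated: $\beta(z,\otimes^{n,s}E)=\inf\{\beta(z,\otimes^{n,s}M): M\subset E \text{ finite dimensional},\ z\in\otimes^{n,s}M\}$. **Hulls.** $\beta$ is injective if $\otimes^{n,s}I$ is an isometric embedding $\otimes^{n,s}_\beta E\to\otimes^{n,s}_\beta F$ for every isometric embedding $I:E\to F$; it is projective if $\otimes^{n,s}Q$ is a metric surjection (quotient map inducing the quotient norm) for every metric surjection $Q:E\to F$. The injective hull $/\beta\backslash$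 is the greatest injective s-tensor norm $\le\beta$; it is characterized by $\otimes^{n,s}I_E:\otimes^{n,s}_{/\beta\backslash}E\to\otimes^{n,s}_\beta\ell_\infty(B_{E'})$ being an isometric embedding, where $I_E:E\to\ell_\infty(B_{E'})$, $I_E(x)=(x'(x))_{x'\in B_{E'}}$. The projective hull $\backslash\beta/$ is the smallest projective s-tensor norm $\ge\beta$; it is characterized by $\otimes^{n,s}Q_E:\otimes^{n,s}_\beta\ell_1(B_E)\to\otimes^{n,s}_{\backslash\beta/}E$ being a metric surjection, where $Q_E:\ell_1(B_E)\to E$, $Q_E((a_x)_x)=\sum_{x\in B_E}a_xx$. **Polynomial ideals.** $\mathcal P^n(E)$ is the space of continuous scalar-valued $n$-homogeneous polynomials on $E$. For an s-tensor norm $\beta$, $\mathcal Q_\beta(E):=(\widetilde\otimes^{n,s}_\beta E)'$ with the dual norm, a functional $\varphi$ being identified with the polynomial $x\mapsto\varphi(\otimes^nx)$. For a Banach ideal $\mathcal Q$ of $n$-homogeneous polynomials and a Banach operator ideal $\mathfrak A$: - $\mathcal Q\circ\mathfrak A$ is the class of polynomials $p$ on Banach spaces $E$ that factor as $p=q\circ T$ with $T\in\mathfrak A(E,F)$, $q\in\mathcal Q(F)$ for some Banach space $F$, with $\|p\|_{\mathcal Q\circ\mathfrak A}=\inf\|q\|_{\mathcal Q}\|T\|_{\mathfrak A}^n$ over all such factorizations. - $\mathcal Q\circ\mathfrak A^{-1}$ is the class of $p\in\mathcal P^n(E)$ with $\|p\|_{\mathcal Q\circ\mathfrak A^{-1}}:=\sup\{\|p\circ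 T\|_{\mathcal Q}: T\in\mathfrak A(G,E),\ G \text{ Banach},\ \|T\|_{\mathfrak A}\le1\}<\infty$. **Operator ideals.** For $r\in\{1,\infty\}$, $\mathcal L_r$ is the Banach ideal of $r$-factorable operators: $T\in\mathcal L_r(E,F)$ iff $J_F\circ T=S\circ R$ with $R\in\mathcal L(E,L_r(\mu))$, $S\in\mathcal L(L_r(\mu),F'')$ for some measure $\mu$, where $J_F:F\to F''$ is the canonical embedding; $\|T\|_{\mathcal L_r}=\inf\|R\|\|S\|$. *)

(* Defs.v *)
From HB Require Import structures.
From mathcomp Require Import all_boot all_order all_algebra.
From mathcomp Require Import complex.
From mathcomp Require Import all_classical all_reals all_analysis measurable_realfun ess_sup_inf.

Set Implicit Arguments.
Unset Strict Implicit.
Unset Printing Implicit Defensive.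

Import Order.TTheory GRing.Theory Num.Theory.
Import numFieldNormedType.Exports.

Local Open Scope classical_set_scope.
Local Open Scope ring_scope.

Variant scalar_kind := RealScalars | ComplexScalars.

Section scalars.
Variable R : realType.

Definition scalar_field (k : scalar_kind) : numFieldType :=
  match k with
  | RealScalars => R
  | ComplexScalars => R[i]%C
  end.

Definition sRe k : scalar_field k -> R :=
  match k with RealScalars => id | ComplexScalars => @complex.Re R end.

Definition sIm k : scalar_field k -> R :=
  match k with RealScalars => fun=> 0 | ComplexScalars => @complex.Im R end.

Definition sofR k : R -> scalar_field k :=
  match k with
  | RealScalars => id
  | ComplexScalars => fun x => x%:C%C
  end.

Variable k : scalar_kind.
Local Notation K := (scalar_field k).
Implicit Types (x y : R) (z w : K).

Lemma sofRK : cancel (@sofR k) (@sRe k).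
Proof. by case: k. Qed.

Lemma sofR0 : sofR k 0 = 0.
Proof. by case: k. Qed.

Lemma sofR1 : sofR k 1 = 1.
Proof. by case: k. Qed.

Lemma sofRD : {morph @sofR k : x y / x + y}.
Proof. by case: k => x y //=; apply/eqP; rewrite complex.eq_complex/= addr0 !eqxx. Qed.

Lemma sofRM : {morph @sofR k : x y / x * y}.
Proof.
case: k => x y //=; apply/eqP; rewrite complex.eq_complex/=.
by rewrite !(mul0r,mulr0,subr0,addr0) !eqxx.
Qed.

Lemma ler_sofR : {mono @sofR k : x y / x <= y}.
Proof. by case: k => x y //=; rewrite complex.lecR. Qed.

Lemma sofR_inj : injective (@sofR k).
Proof. exact: can_inj sofRK. Qed.

Lemma sofR_ge0 z : 0 <= z -> sofR k (sRe z) = z.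
Proof.
case: k z => //= -[a b]; rewrite complex.lecE/= => /andP[/eqP b0 _].
by apply/eqP; rewrite complex.eq_complex/= b0 !eqxx.
Qed.

Lemma sReD : {morph @sRe k : z w / z + w}.
Proof. by case: k => // -[a b] [c d]. Qed.

Lemma sImD : {morph @sIm k : z w / z + w}.
Proof. by case: k => //= [_ _|[a b] [c d]//]; rewrite addr0. Qed.

Lemma sReM z w : sRe (z * w) = sRe z * sRe w - sIm z * sIm w.
Proof. by case: k z w => /= [z w|[a b] [c d]//]; rewrite mul0r subr0. Qed.

Lemma sImM z w : sIm (z * w) = sRe z * sIm w + sIm z * sRe w.
Proof. by case: k z w => /= [z w|[a b] [c d]//]; rewrite mulr0 mul0r addr0. Qed.

Lemma sRe_norm z : sRe `|z| = Num.sqrt (sRe z ^+ 2 + sIm z ^+ 2).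
Proof. by case: k z => /= [z|[a b]//]; rewrite expr0n/= addr0 sqrtr_sqr. Qed.

End scalars.

(* Norms of a normed space over [K] take their values in [K]; [rnorm] reads them
   in [R]. *)
Definition rnorm (R : realType) k (V : normedZmodType (scalar_field R k))
  (v : V) : R := sRe `|v|.

Definition opnorm (R : realType) k (U V : normedZmodType (scalar_field R k))
  (T : U -> V) : R := sup [set rnorm (T x) | x in [set x | rnorm x <= 1]].

Section rnorm_theory.
Variables (R : realType) (k : scalar_kind).
Local Notation K := (scalar_field R k).

Lemma rnormE (V : normedZmodType K) (v : V) : sofR k (rnorm v) = `|v|.
Proof. by rewrite /rnorm sofR_ge0. Qed.

Lemma rnorm_ge0 (V : normedZmodType K) (v : V) : 0 <= rnorm v.
Proof. by rewrite -(ler_sofR k) rnormE sofR0. Qed.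

Lemma rnorm0 (V : normedZmodType K) : rnorm (0 : V) = 0.
Proof. by apply: (@sofR_inj R k); rewrite rnormE normr0 sofR0. Qed.

Lemma rnorm0_eq0 (V : normedZmodType K) (v : V) : rnorm v = 0 -> v = 0.
Proof. by move=> v0; apply: normr0_eq0; rewrite -rnormE v0 sofR0. Qed.

Lemma ler_rnormD (V : normedZmodType K) (v w : V) :
  rnorm (v + w) <= rnorm v + rnorm w.
Proof. by rewrite -(ler_sofR k) sofRD !rnormE ler_normD. Qed.

Lemma rnormZ (V : normedModType K) (a : K) (v : V) :
  rnorm (a *: v) = rnorm a * rnorm v.
Proof. by apply: (@sofR_inj R k); rewrite sofRM !rnormE normrZ. Qed.

Lemma rnorm_sofR (a : R) : 0 <= a -> rnorm (sofR k a) = a.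
Proof.
move=> a0; apply: (@sofR_inj R k).
have a0K : 0 <= sofR k a by rewrite -(sofR0 R k) ler_sofR.
by rewrite rnormE ger0_norm.
Qed.

Variables U V : normedModType K.

Lemma bounded_rnorm (T : {linear U -> V}) : continuous T ->
  exists2 M, 0 <= M & forall x, rnorm (T x) <= M * rnorm x.
Proof.
move=> /linear_bounded_continuous/linear_boundedP/pinfty_ex_gt0[M M0 TM].
exists (sRe M) => [|x]; first by rewrite -(ler_sofR k) sofR0 sofR_ge0 ltW.
by rewrite -(ler_sofR k) sofRM !rnormE sofR_ge0; [exact: TM|exact: ltW].
Qed.

Lemma rnorm_bounded (T : {linear U -> V}) (M : R) :
  (forall x, rnorm (T x) <= M * rnorm x) -> continuous T.
Proof.
move=> TM; apply/linear_bounded_continuous/linear_boundedP.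
near=> r => x; rewrite (@le_trans _ _ (sofR k M * `|x|))//.
  by rewrite -!rnormE -sofRM ler_sofR.
apply: ler_wpM2r => //; near: r; apply: nbhs_pinfty_ge.
rewrite realE -(sofR0 R k) !ler_sofR; exact: le_total.
Unshelve. all: by end_near. Qed.

Lemma opnorm_has_sup (T : {linear U -> V}) : continuous T ->
  has_sup [set rnorm (T x) | x in [set x | rnorm x <= 1]].
Proof.
move=> /bounded_rnorm[M M0 TM]; split.
  by exists (rnorm (T 0)), 0; rewrite //= rnorm0.
exists M => _ [x x1 <-]; rewrite (le_trans (TM x))//.
by rewrite -[leRHS]mulr1 ler_wpM2l.
Qed.

Lemma opnorm_ge0 (T : {linear U -> V}) : 0 <= opnorm T.
Proof.
rewrite /opnorm; set A := [set _ | _ in _].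
have [|supA] := pselect (has_sup A); last by rewrite sup_out.
by move=> supA; apply: sup_upper_bound => //; exists 0; rewrite /= ?linear0 rnorm0.
Qed.

Lemma opnormP (T : {linear U -> V}) x : continuous T ->
  rnorm (T x) <= opnorm T * rnorm x.
Proof.
move=> cT; have [x0|xn0] := eqVneq (rnorm x) 0.
  by rewrite x0 (rnorm0_eq0 x0) linear0 rnorm0 mulr0.
have x_gt0 : 0 < rnorm x by rewrite lt_def xn0 rnorm_ge0.
have ax : rnorm (sofR k (rnorm x)^-1) = (rnorm x)^-1.
  by rewrite rnorm_sofR// invr_ge0 ltW.
rewrite -ler_pdivrMr// mulrC -ax -rnormZ -linearZ.
apply: sup_upper_bound; first exact: opnorm_has_sup.
by exists (sofR k (rnorm x)^-1 *: x) => //=; rewrite rnormZ ax mulVf.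
Qed.

Lemma opnorm_le (T : {linear U -> V}) (M : R) :
  (forall x, rnorm x <= 1 -> rnorm (T x) <= M) -> opnorm T <= M.
Proof.
move=> TM; apply: ge_sup; first by exists (rnorm (T 0)), 0; rewrite //= rnorm0.
by move=> _ [x x1 <-]; exact: TM.
Qed.

End rnorm_theory.

Section dual_space.
Variables (R : realType) (k : scalar_kind).
Local Notation K := (scalar_field R k).
Variable E : normedModType K.

Definition dual_pred : {pred E -> K} := mem [set f : E -> K | scalar f /\ continuous f].

Lemma dual_submod_closed : submod_closed dual_pred.
Proof.
split=> [|a f g]; rewrite !inE.
  split=> [b x y|]; first by rewrite mulr0 addr0.
  by move=> x; exact: cvg_cst.
move=> [lf cf] [lg cg]; split=> [b x y|x].
  by rewrite !fctE lf lg /= !scalerDr/= mulrDr addrACA; congr (_ + _ + _);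
    rewrite /GRing.scale/= mulrCA.
by apply: cvgD; [apply: cvgZr; exact: cf|exact: cg].
Qed.

HB.instance Definition _ := GRing.isSubmodClosed.Build _ _ dual_pred
  dual_submod_closed.

Record dual_space : Type := Dual { dual_fun :> E -> K ; _ : dual_fun \in dual_pred }.

HB.instance Definition _ := [isSub for dual_fun].
HB.instance Definition _ := [Choice of dual_space by <:].
HB.instance Definition _ := [SubChoice_isSubLmodule of dual_space by <:].

Lemma dual_linear (f : dual_space) : linear (f : E -> K).
Proof. by case: f => f /=; rewrite inE => -[]. Qed.

Lemma dual_continuous (f : dual_space) : continuous (f : E -> K).
Proof. by case: f => f /=; rewrite inE => -[]. Qed.

HB.instance Definition _ (f : dual_space) :=
  GRing.isLinear.Build K E K *:%R (dual_fun f) (dual_linear f).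

Lemma dualP (f g : dual_space) : f =1 g -> f = g.
Proof. by move=> fg; apply: val_inj; apply/funext. Qed.

Let dual_norm (f : dual_space) : K := sofR k (opnorm f).

Let ler_dual_normD f g : dual_norm (f + g) <= dual_norm f + dual_norm g.
Proof.
rewrite -sofRD ler_sofR; apply: opnorm_le => x x1.
rewrite (le_trans (ler_rnormD _ _))// lerD//.
  by rewrite (le_trans (opnormP _ (@dual_continuous f)))// ler_piMr// opnorm_ge0.
by rewrite (le_trans (opnormP _ (@dual_continuous g)))// ler_piMr// opnorm_ge0.
Qed.

Let dual_normZ a f : dual_norm (a *: f) = `|a| * dual_norm f.
Proof.
have le b g : opnorm (b *: g : dual_space) <= rnorm b * opnorm g.
  apply: opnorm_le => x x1; rewrite [leLHS](_ : _ = rnorm b * rnorm (g x)).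
    rewrite ler_wpM2l ?rnorm_ge0//.
    rewrite (le_trans (opnormP _ (@dual_continuous g)))//.
    by rewrite ler_piMr// opnorm_ge0.
  by rewrite -(rnormZ b (g x : K)).
rewrite /dual_norm -rnormE -sofRM; congr sofR.
apply/eqP; rewrite eq_le le/=.
have [->|a0] := eqVneq a 0; first by rewrite rnorm0 mul0r opnorm_ge0.
have ra0 : 0 < rnorm a.
  by rewrite lt_def rnorm_ge0 andbT; apply: contra_neq a0; exact: rnorm0_eq0.
rewrite -ler_pdivlMl//.
have := le a^-1 (a *: f); rewrite scalerA mulVf// scale1r => /le_trans; apply.
rewrite ler_wpM2r ?opnorm_ge0// -(ler_sofR k) rnormE normfV.
have -> : sofR k (rnorm a)^-1 = `|a|^-1; last by [].
apply: (mulfI (x := `|a|)); first by rewrite normr_eq0.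
rewrite -{1}rnormE -sofRM mulfV ?gt_eqF// mulfV ?normr_eq0//; exact: (sofR1 R k).
Qed.

Let dual_norm0_eq0 f : dual_norm f = 0 -> f = 0.
Proof.
rewrite -(sofR0 R k) => /sofR_inj f0; apply: dualP => x.
apply: rnorm0_eq0; apply/eqP; rewrite eq_le rnorm_ge0 andbT.
by rewrite (le_trans (opnormP _ (@dual_continuous f)))// f0 mul0r.
Qed.

HB.instance Definition _ := @Lmodule_isNormed.Build K dual_space dual_norm
  ler_dual_normD dual_normZ dual_norm0_eq0.

Lemma rnorm_dual (f : dual_space) : rnorm f = opnorm f.
Proof. by apply: (@sofR_inj R k); rewrite rnormE. Qed.

End dual_space.

Section bidual.
Variables (R : realType) (k : scalar_kind).
Local Notation K := (scalar_field R k).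
Variable E : normedModType K.

Lemma bidual_subproof (x : E) : (fun f : dual_space E => f x) \in @dual_pred R k (dual_space E).
Proof.
rewrite inE; have lin : linear (fun f : dual_space E => f x) by [].
split=> //; pose h := GRing.isLinear.Build K (dual_space E) K *:%R _ lin.
pose H : {linear dual_space E -> K} := HB.pack (fun f : dual_space E => f x) h.
apply: (@rnorm_bounded _ _ _ _ H (rnorm x)) => f /=.
by rewrite mulrC rnorm_dual; exact/opnormP/dual_continuous.
Qed.

Definition bidual_map (x : E) : dual_space (dual_space E) := Dual (bidual_subproof x).

End bidual.

Section Lp.
Context d (T : measurableType d) (R : realType) (k : scalar_kind).
Local Notation K := (scalar_field R k).
Variables (mu : {measure set T -> \bar R}) (p : \bar R) (p1 : (1 <= p)%E).

(* Borel measurability of [K]-valued functions, in coordinates. *)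
Definition smeasurable (f : T -> K) : Prop :=
  measurable_fun setT (@sRe R k \o f) /\ measurable_fun setT (@sIm R k \o f).

Definition sLnorm (f : T -> K) : \bar R := ('N[mu]_p[EFin \o (fun x => rnorm (f x))])%E.

Lemma smeasurable_rnorm (f : T -> K) :
  smeasurable f -> measurable_fun setT (fun x => rnorm (f x)).
Proof.
move=> [mre mim]; rewrite /rnorm; under eq_fun do rewrite sRe_norm.
apply: (measurableT_comp (f := @Num.sqrt R)).
  by apply: continuous_measurable_fun; exact: sqrt_continuous.
by apply: measurable_funD; apply: measurable_funX.
Qed.

Lemma le_Lnorm_ae (f g : T -> R) : (1 <= p)%E ->
  measurable_fun setT f -> measurable_fun setT g ->
  {ae mu, forall x, `|f x| <= `|g x|} ->
  ('N[mu]_p[EFin \o f] <= 'N[mu]_p[EFin \o g])%E.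
Proof.
move=> + mf mg fg; rewrite unlock /Lnorm; case: p => [r|_|//].
  rewrite lee_fin => r1; have r0 : 0 <= r by rewrite (le_trans ler01).
  have mpow (h : T -> R) : measurable_fun setT h ->
      measurable_fun setT (fun x => (`|(EFin \o h) x| `^ r)%E).
    move=> mh; apply: (measurableT_comp (measurable_poweR r)).
    by apply: measurableT_comp => //; exact/measurable_EFinP.
  have int_ge0 (h : T -> \bar R) :
      (\int[mu]_x (h x `^ r) \in `[0, +oo])%E.
    by rewrite in_itv/= leey andbT integral_ge0// => x _; exact: poweR_ge0.
  apply: gt0_ler_poweR; rewrite ?invr_ge0//.
  apply: ae_ge0_le_integral => //; [by move=> *; exact: poweR_ge0|exact: mpow|
    by move=> *; exact: poweR_ge0|exact: mpow|].
  apply: filterS fg => x fgx _ /=; rewrite lee_fin.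
  by apply: ge0_ler_powR; rewrite ?nnegrE.
case: ifPn => // mu0; apply: le_ess_sup.
by apply: filterS fg => x fgx /=; rewrite lee_fin.
Qed.

Lemma smeasurableD (f g : T -> K) :
  smeasurable f -> smeasurable g -> smeasurable (f + g).
Proof.
move=> [rf jf] [rg jg]; split.
  rewrite (_ : _ \o _ = (@sRe R k \o f) \+ (@sRe R k \o g)).
    exact: measurable_funD.
  by apply/funext => x; exact: sReD.
rewrite (_ : _ \o _ = (@sIm R k \o f) \+ (@sIm R k \o g)).
  exact: measurable_funD.
by apply/funext => x; exact: sImD.
Qed.

Lemma smeasurableZ (a : K) (f : T -> K) : smeasurable f -> smeasurable (a *: f).
Proof.
move=> [rf jf]; split.
  rewrite (_ : _ \o _ = (fun x => sRe a * sRe (f x) - sIm a * sIm (f x))).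
    by apply: measurable_funB; exact: measurable_funM.
  by apply/funext => x; exact: sReM.
rewrite (_ : _ \o _ = (fun x => sRe a * sIm (f x) + sIm a * sRe (f x))).
  by apply: measurable_funD; exact: measurable_funM.
by apply/funext => x; exact: sImM.
Qed.

Lemma sLnormD (f g : T -> K) : (1 <= p)%E -> smeasurable f -> smeasurable g ->
  (sLnorm (f + g)%R <= sLnorm f + sLnorm g)%E.
Proof.
move=> p1' mf mg; have mfn := smeasurable_rnorm mf; have mgn := smeasurable_rnorm mg.
rewrite /sLnorm (le_trans _ (@eminkowski _ _ _ mu _ _ p mfn mgn p1'))//.
apply: le_Lnorm_ae => //.
- exact/smeasurable_rnorm/smeasurableD.
- exact: measurable_funD.
apply/nearW => x; rewrite !ger0_norm ?addr_ge0 ?rnorm_ge0//; exact: ler_rnormD.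
Qed.

Lemma sLnormZ (a : K) (f : T -> K) : (1 <= p)%E -> smeasurable f ->
  (sLnorm f < +oo)%E -> sLnorm (a *: f) = ((rnorm a)%:E * sLnorm f)%E.
Proof.
move=> p1' mf finf; have mfn := smeasurable_rnorm mf.
have Lf : (fun x => rnorm (f x)) \in Lfun mu p by rewrite inE; apply/andP; split;
  rewrite inE.
pose F : LfunType mu p1' := Lfun_Sub p1' Lf.
have FE : (F : T -> R) = (fun x => rnorm (f x)) by exact: Lfun_valP.
have := LnormZ F (rnorm a).
rewrite FE ger0_norm ?rnorm_ge0// => <-; congr Lnorm.
by apply/funext => x; congr EFin; exact: (rnormZ a (f x : K)).
Qed.

Lemma sLnorm_ae0 (f : T -> K) : (1 <= p)%E -> smeasurable f ->
  sLnorm f = 0%E <-> {ae mu, forall x, f x = 0}.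
Proof.
move=> p1' mf; have mfn := smeasurable_rnorm mf.
split=> [|f0].
  have /measurable_EFinP mfn' := mfn.
  move=> /(Lnorm_eq0_eq0 mfn' (lt_le_trans lte01 p1')).
  by apply: filterS => x /(_ I) [] /rnorm0_eq0.
apply/eqP; rewrite eq_le Lnorm_ge0 andbT.
have -> : 0%E = 'N[mu]_p[EFin \o (cst 0%R : T -> R)]%E.
  by rewrite Lnorm0// gt_eqF// (lt_le_trans lte01).
apply: le_Lnorm_ae => //.
by apply: filterS f0 => x /= ->; rewrite rnorm0.
Qed.

Definition Lfct_pred (_ : (1 <= p)%E) : {pred T -> K} :=
  mem [set f | smeasurable f /\ (sLnorm f < +oo)%E].

Lemma Lfct_submod_closed : submod_closed (Lfct_pred p1).
Proof.
have m0 : smeasurable (0 : T -> K).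
  split; [rewrite (_ : _ \o _ = cst (sRe (0 : K)))|
          rewrite (_ : _ \o _ = cst (sIm (0 : K)))] => //; exact: measurable_cst.
split=> [|a f g]; rewrite !inE.
  split=> //; have /(sLnorm_ae0 p1) -> : {ae mu, forall x, (0 : T -> K) x = 0}.
    exact: nearW.
  by [].
  by [].
move=> [mf finf] [mg fing]; have maf := smeasurableZ a mf.
split; first exact: smeasurableD.
rewrite (le_lt_trans (sLnormD p1 maf mg))// lte_add_pinfty//.
by rewrite sLnormZ// lte_mul_pinfty// lee_fin rnorm_ge0.
Qed.

HB.instance Definition _ := GRing.isSubmodClosed.Build _ _ (Lfct_pred p1)
  Lfct_submod_closed.

Record Lfct : Type := MkLfct { Lfct_fun :> T -> K ; _ : Lfct_fun \in Lfct_pred p1 }.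

HB.instance Definition _ := [isSub for Lfct_fun].
HB.instance Definition _ := [Choice of Lfct by <:].
HB.instance Definition _ := [SubChoice_isSubLmodule of Lfct by <:].

Lemma LfctP (f : Lfct) : smeasurable f /\ (sLnorm f < +oo)%E.
Proof. by case: f => f /=; rewrite inE. Qed.

Definition Lfct_ae0 : {pred Lfct} := mem [set f : Lfct | {ae mu, forall x, f x = 0}].

Lemma Lfct_ae0_zmod_closed : zmod_closed Lfct_ae0.
Proof.
split=> [|f g]; rewrite !inE; first exact: nearW.
move=> f0 g0; near=> x.
have fx : f x = 0 by near: x.
have gx : g x = 0 by near: x.
by rewrite /= !fctE fx gx subrr.
Unshelve. all: by end_near. Qed.

HB.instance Definition _ := GRing.isZmodClosed.Build _ Lfct_ae0
  Lfct_ae0_zmod_closed.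

Definition Lpspace : Type := {ideal_quot Lfct_ae0}.

HB.instance Definition _ := GRing.Zmodule.on Lpspace.

Definition Lclass (f : Lfct) : Lpspace := \pi_({ideal_quot Lfct_ae0})%qT f.

Definition Lrepr (u : Lpspace) : Lfct := repr (u : {ideal_quot Lfct_ae0}).

Lemma LreprK (u : Lpspace) : Lclass (Lrepr u) = u.
Proof. exact: reprK. Qed.

Lemma LclassP (f g : Lfct) :
  Lclass f = Lclass g <-> {ae mu, forall x, f x = g x}.
Proof.
have -> : (Lclass f = Lclass g) <-> (f - g \in Lfct_ae0).
  by rewrite Quotient.idealrBE; split => [fg|/eqP//]; exact/eqP.
rewrite inE; split; apply: filterS => x /=; rewrite !fctE.
  by move/eqP; rewrite subr_eq0 => /eqP.
by move=> ->; rewrite subrr.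
Qed.

Lemma LclassD : {morph Lclass : f g / f + g}.
Proof. by move=> f g; exact: Quotient.pi_add. Qed.

Lemma Lrepr_ae f : {ae mu, forall x, Lrepr (Lclass f) x = f x}.
Proof. by apply/LclassP; rewrite LreprK. Qed.

Definition Lscale (a : K) (u : Lpspace) : Lpspace := Lclass (a *: Lrepr u).

Lemma LclassZ a f : Lclass (a *: f) = Lscale a (Lclass f).
Proof.
apply/esym/LclassP; apply: filterS (Lrepr_ae f) => x fx.
by rewrite /= !fctE /= fx.
Qed.

Let LscaleA a b u : Lscale a (Lscale b u) = Lscale (a * b) u.
Proof. by rewrite -[u]LreprK -!LclassZ scalerA. Qed.

Let Lscale1 : left_id 1 Lscale.
Proof. by move=> u; rewrite -[u]LreprK -!LclassZ scale1r. Qed.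

Let LscaleDr : right_distributive Lscale +%R.
Proof.
move=> a u v; rewrite -[u]LreprK -[v]LreprK -LclassD -!LclassZ -LclassD.
by rewrite scalerDr.
Qed.

Let LscaleDl u : {morph Lscale^~ u : a b / a + b}.
Proof.
by move=> a b; rewrite -[u]LreprK -!LclassZ -LclassD scalerDl.
Qed.

HB.instance Definition _ := GRing.Zmodule_isLmodule.Build K Lpspace
  LscaleA Lscale1 LscaleDr LscaleDl.

Let Lspace_norm (u : Lpspace) : K := sofR k (fine (sLnorm (Lrepr u))).

Lemma sLnorm_Lrepr f : sLnorm (Lrepr (Lclass f)) = sLnorm f.
Proof.
have [mf _] := LfctP f; have [mg _] := LfctP (Lrepr (Lclass f)).
have fg := Lrepr_ae f.
apply/eqP; rewrite eq_le; apply/andP; split; apply: le_Lnorm_ae => //;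
  try exact: smeasurable_rnorm;
  by apply: filterS fg => x /= ->.
Qed.

Lemma sLnorm_fin (f : Lfct) : ((fine (sLnorm f))%:E = sLnorm f)%E.
Proof.
by have [_ finf] := LfctP f; rewrite fineK// ge0_fin_numE// Lnorm_ge0.
Qed.

Let ler_LspaceD u v : Lspace_norm (u + v) <= Lspace_norm u + Lspace_norm v.
Proof.
rewrite -sofRD ler_sofR -lee_fin EFinD -[in leLHS](LreprK u) -[in leLHS](LreprK v).
rewrite -LclassD sLnorm_Lrepr !sLnorm_fin.
by apply: sLnormD => //; [case: (LfctP (Lrepr u))|case: (LfctP (Lrepr v))].
Qed.

Let LspaceZ a u : Lspace_norm (a *: u) = `|a| * Lspace_norm u.
Proof.
rewrite -[`|a|](@rnormE R k K) -sofRM; congr sofR; apply: EFin_inj.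
rewrite EFinM !sLnorm_fin -[in LHS](LreprK u) -[_ *: _]LclassZ sLnorm_Lrepr.
by have [mu_ finu] := LfctP (Lrepr u); exact: sLnormZ.
Qed.

Let Lspace_norm0 u : Lspace_norm u = 0 -> u = 0.
Proof.
rewrite -(sofR0 R k) => /sofR_inj u0; rewrite -[u]LreprK.
have [mu_ _] := LfctP (Lrepr u).
have : sLnorm (Lrepr u) = 0%E by rewrite -sLnorm_fin u0.
move=> /(sLnorm_ae0 p1 mu_) ae0.
have -> : 0 = Lclass 0 by apply: (@addrI _ (Lclass 0)); rewrite addr0 -LclassD addr0.
exact/LclassP.
Qed.

HB.instance Definition _ := @Lmodule_isNormed.Build K Lpspace Lspace_norm
  ler_LspaceD LspaceZ Lspace_norm0.

Lemma rnorm_Lspace f : rnorm (Lclass f) = fine (sLnorm f).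
Proof. by apply: (@sofR_inj R k); rewrite rnormE -sLnorm_Lrepr. Qed.

End Lp.

Section symmetric_tensors.
Variables (K : numFieldType) (n : nat).

Definition update (E : Type) (x : 'I_n -> E) (i : 'I_n) (u : E) : 'I_n -> E :=
  fun j => if j == i then u else x j.

Definition multilinear (E : lmodType K) (A : ('I_n -> E) -> K) : Prop :=
  forall i x, scalar (fun u => A (update x i u)).

Record mform (E : lmodType K) : Type := MForm {
  mform_fun :> ('I_n -> E) -> K;
  mform_multilinear : multilinear mform_fun }.

Section symtensor.
Variable E : lmodType K.

(* The full tensor power of [E] embeds into the algebraic dual of the space of
   [n]-linear forms by letting an elementary tensor [x_1 (x) .. (x) x_n] act as
   the evaluation [A |-> A x_1 .. x_n].  The symmetric tensor power is the
   subspace spanned by the powers [x (x) .. (x) x]. *)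
Definition power_eval (x : E) : mform E -> K := fun A => A (fun=> x).

Definition symtensor_pred : {pred mform E -> K} :=
  mem [set z | exists s : seq (K * E), z = \sum_(c <- s) c.1 *: power_eval c.2].

Lemma symtensor_submod_closed : submod_closed symtensor_pred.
Proof.
split=> [|a z w]; rewrite !inE; first by exists [::]; rewrite big_nil.
move=> [s ->] [t ->]; exists ([seq (a * c.1, c.2) | c <- s] ++ t).
rewrite big_cat big_map scaler_sumr/=; congr (_ + _).
by apply: eq_bigr => c _; rewrite scalerA.
Qed.

HB.instance Definition _ := GRing.isSubmodClosed.Build _ _ symtensor_pred
  symtensor_submod_closed.

Record symtensor : Type := SymTensor {
  symtensor_fun :> mform E -> K; _ : symtensor_fun \in symtensor_pred }.

HB.instance Definition _ := [isSub for symtensor_fun].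
HB.instance Definition _ := [Choice of symtensor by <:].
HB.instance Definition _ := [SubChoice_isSubLmodule of symtensor by <:].

Lemma power_subproof (x : E) : power_eval x \in symtensor_pred.
Proof. by rewrite inE; exists [:: (1, x)]; rewrite big_seq1 scale1r. Qed.

Definition tpower (x : E) : symtensor := SymTensor (power_subproof x).

Lemma symtensorP (z : symtensor) :
  exists s : seq (K * E), z = \sum_(c <- s) c.1 *: tpower c.2.
Proof.
have := valP z; rewrite inE => -[s zs]; exists s; apply: val_inj.
rewrite zs raddf_sum/=; exact: eq_bigr.
Qed.

End symtensor.

Section symtensor_map.
Variables (E F : lmodType K) (T : {linear E -> F}).

Lemma pullback_subproof (A : mform F) : multilinear (fun x => A (T \o x)).
Proof.
move=> i x a u v.
have upd w : T \o update x i w = update (T \o x) i (T w).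
  by apply/funext => j; rewrite /update /=; case: eqP.
by rewrite !upd linearP mform_multilinear.
Qed.

Definition pullback (A : mform F) : mform E := MForm (pullback_subproof A).

Lemma symtensor_map_subproof (z : symtensor E) :
  (fun A : mform F => z (pullback A)) \in @symtensor_pred F.
Proof.
have := valP z; rewrite !inE => -[s zs]; exists [seq (c.1, T c.2) | c <- s].
apply/funext => A; rewrite [symtensor_fun z]zs big_map !fct_sumE.
by apply: eq_bigr.
Qed.

Definition symtensor_map (z : symtensor E) : symtensor F :=
  SymTensor (symtensor_map_subproof z).

Lemma symtensor_map_is_linear : linear symtensor_map.
Proof. by move=> a z w; apply: val_inj; apply/funext. Qed.

HB.instance Definition _ := GRing.isLinear.Build K _ _ *:%R symtensor_map
  symtensor_map_is_linear.

Lemma symtensor_map_power x : symtensor_map (tpower x) = tpower (T x).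
Proof. by apply: val_inj; apply/funext. Qed.

End symtensor_map.
End symmetric_tensors.

Notation banachType R k := (completeNormedModType (scalar_field R k)).

Section norms.
Variables (R : realType) (k : scalar_kind).
Local Notation K := (scalar_field R k).

Definition is_norm (V : lmodType K) (N : V -> R) : Prop :=
  [/\ forall u v, N (u + v) <= N u + N v,
      forall (a : K) u, N (a *: u) = rnorm a * N u &
      forall u, N u = 0 -> u = 0].

Definition isometric (U V : Type) (NU : U -> R) (NV : V -> R) (f : U -> V) : Prop :=
  forall u, NV (f u) = NU u.

Definition quotient_map (U V : Type) (NU : U -> R) (NV : V -> R) (f : U -> V) : Prop :=
  (forall v, exists u, f u = v) /\
  (forall v, NV v = inf [set NU u | u in [set u | f u = v]]).

Definition finite_dim (M : lmodType K) : Prop :=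
  exists (m : nat) (b : 'I_m -> M), forall x, exists c : 'I_m -> K,
    x = \sum_(i < m) c i *: b i.

End norms.

Section s_tensor_norms.
Variables (R : realType) (k : scalar_kind) (n : nat).
Local Notation K := (scalar_field R k).
Local Notation Banach := (banachType R k).

Lemma dual_power_subproof (E : normedModType K) (f : dual_space E) :
  multilinear (fun x : 'I_n -> E => \prod_(i < n) f (x i)).
Proof.
move=> i x a u v; have prodE w :
    \prod_(j < n) f (update x i w j) = f w * \prod_(j < n | j != i) f (x j).
  rewrite (bigD1 i)//= /update eqxx; congr (_ * _).
  by apply: eq_bigr => j /negPf ->.
by rewrite !prodE linearP /= mulrDl -mulrA.
Qed.

Definition dual_power (E : normedModType K) (f : dual_space E) : mform n E :=
  MForm (dual_power_subproof f).

Definition injective_norm (E : normedModType K) (z : symtensor n E) : R :=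
  sup [set rnorm (z (dual_power f)) | f in [set f : dual_space E | rnorm f <= 1]].

Definition projective_norm (E : normedModType K) (z : symtensor n E) : R :=
  inf [set \sum_(c <- s) rnorm c.1 * rnorm c.2 ^+ n | s in
    [set s : seq (K * E) | z = \sum_(c <- s) c.1 *: tpower n c.2]].

Definition tensor_norm : Type := forall E : Banach, symtensor n E -> R.

Implicit Types (beta gamma delta : tensor_norm).

Definition tensor_norm_le beta gamma : Prop :=
  forall (E : Banach) z, beta E z <= gamma E z.

Definition mapping_property beta : Prop :=
  forall (E F : Banach) (T : {linear E -> F}), continuous T ->
  forall z, beta F (symtensor_map T z) <= opnorm T ^+ n * beta E z.

(* The finite-dimensional subspaces of [E] are presented as the ranges of the
   linear isometries [I] from finite-dimensional Banach spaces [M] to [E]. *)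
Definition finitely_generated beta : Prop :=
  forall (E : Banach) z, beta E z =
    inf [set r | exists (M : Banach) (I : {linear M -> E}) (w : symtensor n M),
      [/\ finite_dim M, isometric (@rnorm R k M) (@rnorm R k E) I,
          symtensor_map I w = z & r = beta M w]].

Record s_tensor_norm beta : Prop := STensorNorm {
  stn_norm : forall E : Banach, is_norm (beta E);
  stn_ge_inj : tensor_norm_le (fun E => @injective_norm E) beta;
  stn_le_proj : tensor_norm_le beta (fun E => @projective_norm E);
  stn_map : mapping_property beta;
  stn_fg : finitely_generated beta }.

Definition injective_tensor_norm beta : Prop :=
  forall (E F : Banach) (I : {linear E -> F}),
    isometric (@rnorm R k E) (@rnorm R k F) I ->
    isometric (beta E) (beta F) (symtensor_map I).

Definition projective_tensor_norm beta : Prop :=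
  forall (E F : Banach) (Q : {linear E -> F}),
    quotient_map (@rnorm R k E) (@rnorm R k F) Q ->
    quotient_map (beta E) (beta F) (symtensor_map Q).

Definition is_injective_hull beta gamma : Prop :=
  [/\ s_tensor_norm gamma, injective_tensor_norm gamma,
      tensor_norm_le gamma beta &
      forall delta, s_tensor_norm delta -> injective_tensor_norm delta ->
        tensor_norm_le delta beta -> tensor_norm_le delta gamma].

Definition is_projective_hull beta gamma : Prop :=
  [/\ s_tensor_norm gamma, projective_tensor_norm gamma,
      tensor_norm_le beta gamma &
      forall delta, s_tensor_norm delta -> projective_tensor_norm delta ->
        tensor_norm_le beta delta -> tensor_norm_le gamma delta].

End s_tensor_norms.

Section ideals.
Variables (R : realType) (k : scalar_kind) (n : nat).
Local Notation K := (scalar_field R k).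
Local Notation Banach := (banachType R k).

Definition continuous_polynomial (E : Banach) (p : E -> K) : Prop :=
  continuous p /\ exists A : mform n E, forall x, p x = A (fun=> x).

(* [pc_norm] is meaningful on the members of the class only; likewise for
   [oc_norm]. *)
Record poly_class : Type := PolyClass {
  pc_mem : forall E : Banach, set (E -> K);
  pc_norm : forall E : Banach, (E -> K) -> R }.

Definition poly_class_eq (P Q : poly_class) : Prop :=
  forall (E : Banach) (p : E -> K),
    (pc_mem P p <-> pc_mem Q p) /\ (pc_mem P p -> pc_norm P p = pc_norm Q p).

Record op_class : Type := OpClass {
  oc_mem : forall E F : Banach, {linear E -> F} -> Prop;
  oc_norm : forall E F : Banach, {linear E -> F} -> R }.

Definition linearizes (E : Banach) (phi : {linear symtensor n E -> K})
  (p : E -> K) : Prop := forall x, p x = phi (tpower n x).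

(* Restriction identifies the dual of the completion of a normed space with the
   dual of the space itself, isometrically. *)
Definition Qideal (beta : tensor_norm R k n) : poly_class := {|
  pc_mem := fun E => [set p | exists phi : {linear symtensor n E -> K},
    linearizes phi p /\ exists C, forall z, rnorm (phi z) <= C * beta E z];
  pc_norm := fun E p => sup [set r |
    exists (phi : {linear symtensor n E -> K}) (z : symtensor n E),
      [/\ linearizes phi p, beta E z <= 1 & r = rnorm (phi z)]] |}.

(* The ideal [Q o A]. *)
Definition pc_comp (Q : poly_class) (A : op_class) : poly_class := {|
  pc_mem := fun E => [set p |
    exists (F : Banach) (T : {linear E -> F}) (q : F -> K),
      [/\ oc_mem A T, pc_mem Q q & p = q \o T]];
  pc_norm := fun E p => inf [set r |
    exists (F : Banach) (T : {linear E -> F}) (q : F -> K),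
      [/\ oc_mem A T, pc_mem Q q, p = q \o T &
          r = pc_norm Q q * oc_norm A T ^+ n]] |}.

(* The ideal [Q o A^-1] is [pc_quot Q A]; [pc_quot_set] collects the norms
   [||p o T||_Q] whose supremum defines its norm. *)
Definition pc_quot_set (Q : poly_class) (A : op_class) (E : Banach)
    (p : E -> K) : set R :=
  [set r | exists (G : Banach) (T : {linear G -> E}),
    [/\ oc_mem A T, oc_norm A T <= 1 & r = pc_norm Q (p \o T)]].

Definition pc_quot (Q : poly_class) (A : op_class) : poly_class := {|
  pc_mem := fun E => [set p | [/\ continuous_polynomial p,
    forall (G : Banach) (T : {linear G -> E}), oc_mem A T -> pc_mem Q (p \o T) &
    has_ubound (pc_quot_set Q A p)]];
  pc_norm := fun E p => sup (pc_quot_set Q A p) |}.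

Definition factors_through (E F : Banach) (V : normedModType K)
    (T : {linear E -> F}) (U : {linear E -> V})
    (S : {linear V -> dual_space (dual_space F)}) : Prop :=
  [/\ continuous U, continuous S & forall x, bidual_map (T x) = S (U x)].

Definition factorable (r : \bar R) (r1 : (1 <= r)%E) : op_class := {|
  oc_mem := fun E F T => continuous T /\
    exists (d : measure_display) (X : measurableType d)
           (mu : {measure set X -> \bar R})
           (U : {linear E -> Lpspace k mu r1})
           (S : {linear Lpspace k mu r1 -> dual_space (dual_space F)}), factors_through T U S;
  oc_norm := fun E F T => inf [set c |
    exists (d : measure_display) (X : measurableType d)
           (mu : {measure set X -> \bar R})
           (U : {linear E -> Lpspace k mu r1})
           (S : {linear Lpspace k mu r1 -> dual_space (dual_space F)}),
      factors_through T U S /\ c = opnorm U * opnorm S] |}.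

Definition factorable_infty : op_class := factorable (leey 1).
Definition factorable_one : op_class := factorable (lexx 1%E).

End ideals.

(* Main.v *)
(* Both hulls have explicit models. The injective hull is the pullback of [beta] along the
   isometry of [E] into [l_infty (B_E')]; the projective hull of [z] is the infimum of
   [beta w] over the [w] in the symmetric power of some [l_1^m] which a contraction
   [l_1^m -> E] maps to [z]. By Hahn-Banach, a functional bounded by the injective hull
   extends to [l_infty (B_E')]; a functional which [beta] bounds after composition with the
   quotient map [l_1 (B_E) -> E] is bounded by the projective hull. Conversely, if [T]
   factors through [L_p] ([p = 1] or [oo]) into the bidual of its target, then on finitely
   many vectors [T] is close to [V W] with [W] into [l_p^m], [V] out of [l_p^m] and
   [|V| |W|] close to the factorization norm: average over the cells of a finite partition,
   then move the values from the bidual to the space by local reflexivity. As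
   [x |-> phi (x (x) .. (x) x)] is continuous, the bound for [V W] passes to [T]. *)

Require Import Defs.
From HB Require Import structures.
From mathcomp Require Import all_boot all_order all_algebra.
From mathcomp Require Import complex.
From mathcomp Require Import all_classical all_reals all_analysis measurable_realfun ess_sup_inf.
From mathcomp Require Import ring lra.

Set Implicit Arguments.
Unset Strict Implicit.
Unset Printing Implicit Defensive.

Import Order.TTheory GRing.Theory Num.Theory.
Import numFieldNormedType.Exports.

Local Open Scope classical_set_scope.
Local Open Scope ring_scope.

(** * Sublinear functionals *)

(** Each hull is given only by its extremal property, which is used for a single inequality:
    [inj_hull beta <= beta_inj] and [beta_proj <= proj_hull beta]. These control functionals along
    factorable operators. The converse estimates use only that [beta_inj] is injective and below
    [beta], and that [beta_proj] is projective and above [beta]. The two factors of V W play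
    different roles. For [l_infty^m] the map W into it is absorbed by the injective hull, because it
    extends to l_infty (B_E'), and V only needs the mapping property of [beta]. For [l_1^m] the map
    V is absorbed by the projective hull, which on [l_1^m] is at most [beta], and then W only needs
    the mapping property of [beta]. The measure in a factorization is arbitrary, and a mean over a
    cell of infinite measure is undefined. The average over a cell is therefore taken with a norming
    functional of a normalized class living on that cell, which treats [L_1] and [L_infty] alike. V
    W is close to T on finitely many vectors only, not in operator norm, so the estimate is made for
    one functional and one tensor at a time; the limit is taken in the values of the functional and
    never in the tensor norm. *)

Section infimum.
Variable R : realType.
Implicit Types A : set R.

Lemma inf_le A (m x : R) : (forall y, A y -> m <= y) -> A x -> inf A <= x.
Proof. by move=> lb Ax; apply: ge_inf => //; exists m. Qed.

Lemma inf_approx A (e : R) : A !=set0 -> 0 < e -> exists2 x, A x & x < inf A + e.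
Proof.
move=> A0 e0; apply: contrapT => nex.
have : inf A + e <= inf A.
  by apply: lb_le_inf => // x Ax; rewrite leNgt; apply/negP => xe; apply: nex; exists x.
by rewrite gerDl leNgt e0.
Qed.

Lemma sup_ge A (m x : R) : (forall y, A y -> y <= m) -> A x -> x <= sup A.
Proof. by move=> ub Ax; apply: ub_le_sup => //; exists m. Qed.

End infimum.

Section sublinear.
Variables (R : realType) (k : scalar_kind) (V : lmodType (scalar_field R k)).
Implicit Types (p : V -> R) (u v : V).

(** Homogeneity is asked as an inequality only: applied to [c^-1] it yields equality, and
    functionals defined by infima then have one inequality to check. *)
Definition sublinear p : Prop := (forall u v, p (u + v) <= p u + p v) /\
  forall (c : R) v, 0 < c -> p (sofR k c *: v) <= c * p v.

Lemma sofRV (c : R) : sofR k c^-1 = (sofR k c)^-1.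
Proof.
have [->|c0] := eqVneq c 0; first by rewrite invr0 sofR0 invr0.
have sc0 : sofR k c != 0 by rewrite -(sofR0 R k) (inj_eq (@sofR_inj R k)).
by apply: (mulfI sc0); rewrite -sofRM !mulfV// sofR1.
Qed.

Lemma sofRN (c : R) : sofR k (- c) = - sofR k c.
Proof. by apply: (addrI (sofR k c)); rewrite -sofRD !subrr sofR0. Qed.

Lemma sublinearZ p c v : sublinear p -> 0 < c -> p (sofR k c *: v) = c * p v.
Proof.
move=> [_ pZ] c0; apply/eqP; rewrite eq_le pZ//=.
have := pZ c^-1 (sofR k c *: v); rewrite invr_gt0 => /(_ c0).
rewrite scalerA -sofRM mulVf ?gt_eqF// sofR1 scale1r => h.
by rewrite -ler_pdivlMl.
Qed.

Lemma sublinear0 p : sublinear p -> p 0 = 0.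
Proof.
move=> sp; have := @sublinearZ p 2 0 sp (ltr0Sn R 1).
by rewrite scaler0 => h; lra.
Qed.

Lemma sublinear_opp p v : sublinear p -> - p (- v) <= p v.
Proof.
move=> sp; have := sp.1 v (- v); rewrite subrr sublinear0// => h; lra.
Qed.

(** Zorn's lemma for the reversed pointwise order. The infimum of a chain is finite because every
    member [s] satisfies [s v >= - s (- v) >= - p (- v)]; it is subadditive because of two nearly
    minimizing members the smaller one serves for both vectors. *)
Lemma sublinear_minimal p : sublinear p -> exists q, [/\ sublinear q,
  forall v, q v <= p v & forall r, sublinear r -> (forall v, r v <= q v) -> r = q].
Proof.
move=> sp; pose T := {q : V -> R | sublinear q /\ forall v, q v <= p v}.
pose le (q r : T) := `[< forall v, sval r v <= sval q v >].
have [||||[q [sq qp]] qmin] := @Zorn T le.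
- by move=> t; apply/asboolP.
- by move=> r s t /asboolP rs /asboolP st; apply/asboolP => v; exact: le_trans (st v) (rs v).
- move=> [s hs] [t ht] /asboolP /= st /asboolP /= ts; apply: eq_exist.
  by apply/funext => v; apply/eqP; rewrite eq_le st ts.
- move=> A tA; have [[s0 As0]|A0] := pselect (A !=set0); last first.
    by exists (exist _ p (conj sp (fun v => lexx (p v)))) => s As; exfalso; apply: A0; exists s.
  pose val v := [set sval s v | s in A].
  pose q v := inf (val v).
  have lbA v : forall y, val v y -> - p (- v) <= y.
    move=> _ [s _ <-]; case: s => s [ss sle] /=.
    by apply: le_trans (sublinear_opp v ss); rewrite lerN2.
  have A0 v : val v !=set0 by exists (sval s0 v), s0.
  have q_le s v : A s -> q v <= sval s v.
    by move=> As; apply: (inf_le (lbA v)); exists s.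
  have sq : sublinear q.
    split=> [u v|c v c0].
      apply/ler_addgt0Pr => e e0.
      have e20 : 0 < e / 2 by rewrite divr_gt0.
      have [_ [s As <-] su] := inf_approx (A0 u) e20.
      have [_ [t At <-] tv] := inf_approx (A0 v) e20.
      have [/asboolP st|/asboolP ts] := tA _ _ As At.
        have := (svalP t).1.1 u v; have := q_le _ (u + v) At; have := st u.
        rewrite -/(q u) -/(q v) in su tv; lra.
      have := (svalP s).1.1 u v; have := q_le _ (u + v) As; have := ts v.
      rewrite -/(q u) -/(q v) in su tv; lra.
    rewrite -ler_pdivrMl//; apply: lb_le_inf => // _ [s As <-].
    rewrite ler_pdivrMl//; apply: le_trans (q_le _ _ As) _.
    exact: (svalP s).1.2.
  have qp v : q v <= p v by exact: le_trans (q_le _ v As0) ((svalP s0).2 v).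
  by exists (exist _ q (conj sq qp)) => s As; apply/asboolP => v; exact: q_le.
exists q; split=> // r sr rq.
have rp v : r v <= p v by exact: le_trans (rq v) (qp v).
have /(congr1 sval)//= : exist _ r (conj sr rp) = exist _ q (conj sq qp) :> T.
by apply: qmin; apply/asboolP.
Qed.

(* A minimal sublinear functional [q] is linear: it coincides with the smaller
   sublinear functional [v |-> inf_t (q (v + t y) - t q y)]. *)
Lemma sublinear_additive p : sublinear p -> exists q : V -> R,
  [/\ forall v, q v <= p v, forall u v, q (u + v) = q u + q v &
      forall c v, q (sofR k c *: v) = c * q v].
Proof.
move=> sp; have [q [sq qp qmin]] := sublinear_minimal sp.
have qD u v : q (u + v) = q u + q v.
  apply/eqP; rewrite eq_le sq.1/=.
  pose val w := [set q (w + sofR k t *: v) - t * q v | t in [set t | 0 <= t]].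
  pose r w := inf (val w).
  have sZ t : 0 <= t -> q (sofR k t *: v) = t * q v.
    rewrite le_eqVlt => /predU1P[<-|t0]; last exact: sublinearZ.
    by rewrite sofR0 scale0r sublinear0// mul0r.
  have lbv w : forall y, val w y -> - q (- w) <= y.
    move=> _ [t /= t0 <-]; have := sq.1 (w + sofR k t *: v) (- w).
    by rewrite addrC addKr sZ// => h; lra.
  have val0 w : val w !=set0.
    by exists (q (w + sofR k 0 *: v) - 0 * q v), 0 => /=.
  have r_le t w : 0 <= t -> r w <= q (w + sofR k t *: v) - t * q v.
    by move=> t0; apply: (inf_le (lbv w)); exists t.
  have sr : sublinear r.
    split=> [w1 w2|c w c0].
      apply/ler_addgt0Pr => e e0.
      have e20 : 0 < e / 2 by rewrite divr_gt0.
      have [_ [s /= s0 <-] sw] := inf_approx (val0 w1) e20.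
      have [_ [t /= t0 <-] tw] := inf_approx (val0 w2) e20.
      rewrite -/(r w1) -/(r w2) in sw tw.
      have := @r_le (s + t) (w1 + w2) (addr_ge0 s0 t0).
      have := sq.1 (w1 + sofR k s *: v) (w2 + sofR k t *: v).
      rewrite addrACA sofRD scalerDl => h1 h2; lra.
    rewrite -ler_pdivrMl//; apply: lb_le_inf => // _ [t /= t0 <-].
    rewrite ler_pdivrMl//.
    have ct0 : 0 <= c * t by rewrite mulr_ge0// ltW.
    apply: le_trans (@r_le (c * t) _ ct0) _.
    by rewrite sofRM -scalerA -scalerDr sublinearZ// mulrBr mulrA.
  have rq w : r w <= q w.
    by have := @r_le 0 w (lexx 0); rewrite sofR0 scale0r addr0 mul0r subr0.
  have rE := qmin r sr rq.
  (* With [r = q], the choice [t = 1] is the missing superadditivity [q u + q v <= q (u + v)]. *)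
  by have := @r_le 1 u ler01; rewrite rE sofR1 scale1r mul1r => h; lra.
have q0 := sublinear0 sq.
have qN v : q (- v) = - q v.
  by apply: (addrI (q v)); rewrite -qD !subrr.
exists q; split=> // c v.
have [c0|c0|->] := ltgtP c 0; last by rewrite sofR0 scale0r q0 mul0r.
  have nc0 : 0 < - c by rewrite oppr_gt0.
  by have := sublinearZ v sq nc0; rewrite sofRN scaleNr qN mulNr => /oppr_inj.
exact: sublinearZ.
Qed.

End sublinear.

(** * Hahn-Banach theorem over the scalars *)

Section scalar_theory.
Variables (R : realType) (k : scalar_kind).
Local Notation K := (scalar_field R k).
Implicit Types (z w : K).

Definition smk (a b : R) : K :=
  match k return scalar_field R k with
  | RealScalars => a
  | ComplexScalars => (a +i* b)%C
  end.

Lemma sRe_mk a b : sRe (smk a b) = a.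
Proof. by rewrite /smk; case: k. Qed.

Lemma smkK z : smk (sRe z) (sIm z) = z.
Proof. by rewrite /smk; case: k z => // -[]. Qed.

(** Over the reals [smk] drops its second argument and [sIm] is 0, so the claim reads [0 = f 0]
    there. *)
Lemma sIm_mk z (f : R -> R) : f 0 = 0 ->
  sIm (smk (f (sRe z)) (f (sIm z))) = f (sIm z).
Proof. by rewrite /smk; case: k z => // -[]. Qed.

Lemma sReN z : sRe (- z) = - sRe z.
Proof. by apply: (addrI (sRe z)); rewrite -sReD !subrr -(sofR0 R k) sofRK. Qed.

Lemma sImN z : sIm (- z) = - sIm z.
Proof. by case: k z => /= [z|[]//]; rewrite oppr0. Qed.

Lemma sReZ (a : R) z : sRe (sofR k a * z) = a * sRe z.
Proof. by case: k z => //= -[x y] /=; rewrite mul0r subr0. Qed.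

Lemma rnormM z w : rnorm (z * w) = rnorm z * rnorm w.
Proof. by apply: (@sofR_inj R k); rewrite sofRM !rnormE normrM. Qed.

Lemma rnormN (V : normedZmodType K) (v : V) : rnorm (- v) = rnorm v.
Proof. by rewrite /rnorm normrN. Qed.

Lemma rnormB (V : normedZmodType K) (v w : V) : rnorm (v - w) = rnorm (w - v).
Proof. by rewrite /rnorm distrC. Qed.

Lemma rnorm1 : rnorm (1 : K) = 1.
Proof. by rewrite -(sofR1 R k) rnorm_sofR. Qed.

Lemma rnormV z : rnorm z^-1 = (rnorm z)^-1.
Proof. by apply: (@sofR_inj R k); rewrite sofRV !rnormE normfV. Qed.

Lemma rnormX z n : rnorm (z ^+ n) = rnorm z ^+ n.
Proof. by elim: n => [|n IH]; rewrite ?expr0 ?rnorm1// !exprS rnormM IH. Qed.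

Lemma rnorm_gt0 (V : normedZmodType K) (v : V) : (0 < rnorm v) = (v != 0).
Proof.
rewrite lt_def rnorm_ge0 andbT; congr negb; apply/eqP/eqP => [|->].
  exact: rnorm0_eq0.
exact: rnorm0.
Qed.

Lemma ler_rnorm_sum (V : normedZmodType K) (I : Type) (s : seq I) (P : pred I)
  (F : I -> V) :
  rnorm (\sum_(i <- s | P i) F i) <= \sum_(i <- s | P i) rnorm (F i).
Proof.
elim/big_rec2: _ => [|i y x _ yx]; first by rewrite rnorm0.
by rewrite (le_trans (ler_rnormD _ _))// lerD2l.
Qed.

Lemma sRe_le_rnorm z : `|sRe z| <= rnorm z.
Proof. by rewrite /rnorm sRe_norm -sqrtr_sqr ler_wsqrtr// lerDl sqr_ge0. Qed.

Lemma sIm_le_rnorm z : `|sIm z| <= rnorm z.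
Proof. by rewrite /rnorm sRe_norm -sqrtr_sqr ler_wsqrtr// lerDr sqr_ge0. Qed.

Lemma rnorm_leD z : rnorm z <= `|sRe z| + `|sIm z|.
Proof.
rewrite /rnorm sRe_norm -(ger0_norm (addr_ge0 (normr_ge0 (sRe z)) (normr_ge0 (sIm z)))).
rewrite -sqrtr_sqr ler_wsqrtr// -(real_normK (num_real (sRe z))).
rewrite -(real_normK (num_real (sIm z))) sqrrD.
have := mulr_ge0 (normr_ge0 (sRe z)) (normr_ge0 (sIm z)); lra.
Qed.

Lemma phase z : exists2 u : K, rnorm u <= 1 & u * z = sofR k (rnorm z).
Proof.
have [->|z0] := eqVneq z 0.
  by exists 0; rewrite ?rnorm0 ?sofR0 ?mulr0.
exists (sofR k (rnorm z) / z); last by rewrite mulfVK.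
by rewrite rnormM rnormV rnorm_sofR ?rnorm_ge0// mulfV// gt_eqF// rnorm_gt0.
Qed.

End scalar_theory.

Section hahn_banach.
Variables (R : realType) (k : scalar_kind).
Local Notation K := (scalar_field R k).

Definition seminorm (V : lmodType K) (N : V -> R) : Prop :=
  (forall u v, N (u + v) <= N u + N v) /\
  forall (a : K) u, N (a *: u) = rnorm a * N u.

Section seminorm_theory.
Variables (V : lmodType K) (N : V -> R).
Hypothesis sN : seminorm N.

Lemma seminorm0 : N 0 = 0.
Proof. by rewrite -(scale0r 0) sN.2 rnorm0 mul0r. Qed.

Lemma seminormN u : N (- u) = N u.
Proof. by rewrite -scaleN1r sN.2 rnormN rnorm1 mul1r. Qed.

Lemma seminorm_ge0 u : 0 <= N u.
Proof. have := sN.1 u (- u); rewrite subrr seminorm0 seminormN; lra. Qed.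

End seminorm_theory.

Lemma seminorm_exact (V : lmodType K) (N : V -> R) : (forall u, 0 <= N u) ->
  (forall (a : K) u, N (a *: u) <= rnorm a * N u) ->
  forall (a : K) u, N (a *: u) = rnorm a * N u.
Proof.
move=> N0 NZ a u; apply/eqP; rewrite eq_le NZ/=.
have [->|a0] := eqVneq a 0; first by rewrite rnorm0 mul0r.
have := NZ a^-1 (a *: u); rewrite scalerA mulVf// scale1r rnormV.
by rewrite -ler_pdivrMl ?invr_gt0 ?rnorm_gt0// invrK.
Qed.

Lemma seminorm_rnorm (V : normedModType K) : seminorm (@rnorm R k V).
Proof. by split; [exact: ler_rnormD|exact: rnormZ]. Qed.

(** [smk k 0 1] is the imaginary unit in the complex case, where [psi v = f v - i f (i v)] is the
    only linear functional with real part [f]; over the reals it is 0 and [psi = f]. *)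
Lemma linear_of_real_part (V : lmodType K) (f : V -> R) :
  (forall u v, f (u + v) = f u + f v) ->
  (forall c v, f (sofR k c *: v) = c * f v) ->
  exists psi : {linear V -> K}, (forall v, sRe (psi v) = f v) /\
    forall v, psi v = smk k (f v) (- f (smk k 0 1 *: v)).
Proof.
move=> fD fZ; pose psi v := smk k (f v) (- f (smk k 0 1 *: v)).
have lpsi : scalar psi.
  rewrite /psi /smk; case: k V f fD fZ {psi} => /= V f fD fZ a u v.
    by rewrite fD fZ.
  have aE : a = (sofR ComplexScalars (complex.Re a) +
      sofR ComplexScalars (complex.Im a) * (0 +i* 1)%C :> R[i]%C).
    by case: a => x y; apply/eqP; rewrite complex.eq_complex/=; apply/andP; split;
      apply/eqP; ring.
  have iE : (0 +i* 1)%C * (0 +i* 1)%C = sofR ComplexScalars (-1) :> R[i]%C.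
    by apply/eqP; rewrite complex.eq_complex/=; apply/andP; split; apply/eqP; ring.
  have E1 : f (a *: u) = complex.Re a * f u + complex.Im a * f ((0 +i* 1)%C *: u).
    by rewrite [in LHS]aE scalerDl fD fZ -scalerA fZ.
  have E2 : f ((0 +i* 1)%C *: (a *: u)) =
      complex.Re a * f ((0 +i* 1)%C *: u) - complex.Im a * f u.
    rewrite [in LHS]aE scalerDl scalerDr fD scalerA mulrC -scalerA fZ; congr (_ + _).
    by rewrite scalerA mulrCA iE -scalerA fZ fZ mulN1r mulrN.
  rewrite fD scalerDr fD E1 E2; case: a {aE E1 E2} => x y.
  by apply/eqP; rewrite complex.eq_complex/=; apply/andP; split; apply/eqP; ring.
pose h := GRing.isLinear.Build K V K *:%R psi lpsi.
pose P : {linear V -> K} := HB.pack psi h.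
by exists P; split=> // v; rewrite /= /psi sRe_mk.
Qed.

(** The sublinear [p] encodes domination and extension at once. A real-linear [f <= p] satisfies
    [f <= N] by taking [u = 0]; evaluated at [- L u] it satisfies [f (L u) >= Re (phi u)], and the
    same at [- u] gives equality. Turning [psi v] by a phase then bounds its modulus by its real
    part. *)
Theorem hahn_banach (U V : lmodType K) (L : {linear U -> V}) (phi : {linear U -> K})
    (N : V -> R) : seminorm N -> (forall u, rnorm (phi u) <= N (L u)) ->
  exists psi : {linear V -> K}, (forall u, psi (L u) = phi u) /\
    forall v, rnorm (psi v) <= N v.
Proof.
move=> sN phiN.
pose val v := [set N (v + L u) - sRe (phi u) | u in setT].
pose p v := inf (val v).
have phiL u : sRe (phi u) <= N (L u).
  exact: le_trans (ler_norm _) (le_trans (sRe_le_rnorm _) (phiN u)).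
have lbv v : forall y, val v y -> - N v <= y.
  move=> _ [u _ <-]; have := sN.1 (v + L u) (- v); rewrite addrC addKr seminormN//.
  have := phiL u; lra.
have val0 v : val v !=set0 by exists (N (v + L 0) - sRe (phi 0)), 0.
have p_le v u : p v <= N (v + L u) - sRe (phi u).
  by apply: (inf_le (lbv v)); exists u.
have sp : sublinear p.
  split=> [v w|c v c0].
    apply/ler_addgt0Pr => e e0.
    have e20 : 0 < e / 2 by rewrite divr_gt0.
    have [_ [s _ <-] sv] := inf_approx (val0 v) e20.
    have [_ [t _ <-] tw] := inf_approx (val0 w) e20.
    have := p_le (v + w) (s + t); have := sN.1 (v + L s) (w + L t).
    rewrite addrACA !linearD/= sReD -/(p v) -/(p w) in sv tw *; lra.
  rewrite -ler_pdivrMl//; apply: lb_le_inf => // _ [u _ <-].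
  rewrite ler_pdivrMl//; apply: le_trans (p_le _ (sofR k c *: u)) _.
  rewrite !linearZ/= -scalerDr sN.2 rnorm_sofR; last exact: ltW.
  by rewrite sReZ mulrBr.
have [f [fp fD fZ]] := sublinear_additive sp.
have fN v : f v <= N v.
  by rewrite (le_trans (fp v))// (le_trans (p_le v 0))// !linear0 addr0 -(sofR0 R k)
    sofRK subr0.
have f0 : f 0 = 0 by have := fZ 0 0; rewrite scaler0 mul0r.
have fopp v : f (- v) = - f v by apply: (addrI (f v)); rewrite -fD !subrr.
have fL_ge u : sRe (phi u) <= f (L u).
  have := fp (- L u); have := p_le (- L u) u.
  rewrite addNr seminorm0// fopp; lra.
have fL u : f (L u) = sRe (phi u).
  apply/eqP; rewrite eq_le fL_ge andbT.
  by have := fL_ge (- u); rewrite !linearN/= fopp sReN lerN2.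
have [psi [psiRe psiE]] := linear_of_real_part fD fZ.
exists psi; split=> [u|v].
  rewrite psiE -linearZ/= !fL linearZ/= -[RHS]smkK /smk.
  by case: k (phi u) => //= -[x y] /=; rewrite mul0r mul1r sub0r opprK.
have [c c1 cv] := phase (psi v).
have : sRe (c * psi v) <= N v.
  have -> : c * psi v = psi (c *: v) by rewrite linearZ.
  rewrite psiRe (le_trans (fN _))// sN.2 ler_piMl//; exact: seminorm_ge0.
by rewrite cv sofRK.
Qed.

Lemma linear_scale_right (V : lmodType K) (y : V) : linear (fun a : K => a *: y).
Proof. by move=> a u v; rewrite scalerDl scalerA. Qed.

Lemma norming_functional (V : lmodType K) (N : V -> R) (y : V) : seminorm N ->
  exists psi : {linear V -> K}, psi y = sofR k (N y) /\
    forall v, rnorm (psi v) <= N v.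
Proof.
move=> sN; pose L : {linear K -> V} :=
  HB.pack (fun a : K => a *: y) (GRing.isLinear.Build K K V *:%R _ (linear_scale_right y)).
have lphi : scalar (fun a : K => a * sofR k (N y)).
  by move=> a u v; rewrite mulrDl mulrA.
pose phi : {linear K -> K} :=
  HB.pack (fun a : K => a * sofR k (N y)) (GRing.isLinear.Build K K K *:%R _ lphi).
have [u|psi [psiL psiN]] := @hahn_banach _ _ L phi N sN.
  by rewrite /= sN.2 rnormM rnorm_sofR// seminorm_ge0.
by exists psi; split=> //; have := psiL 1; rewrite /= scale1r mul1r.
Qed.

Lemma dual_of (E : normedModType K) (psi : {linear E -> K}) (c : R) : 0 <= c ->
  (forall x, rnorm (psi x) <= c * rnorm x) ->
  exists2 f : dual_space E, f =1 psi & rnorm f <= c.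
Proof.
move=> c0 psic; have cpsi := rnorm_bounded psic.
have psiP : (psi : E -> K) \in @dual_pred R k E.
  by rewrite inE; split=> // a u v; exact: linearP.
exists (Dual psiP) => //; rewrite rnorm_dual.
by apply: opnorm_le => x x1; apply: le_trans (psic x) _; rewrite ler_piMr.
Qed.

Lemma dual_le (E : normedModType K) (f : dual_space E) x :
  rnorm (f x) <= rnorm f * rnorm x.
Proof. by rewrite rnorm_dual; exact/opnormP/dual_continuous. Qed.

Lemma dual_extend (E F : normedModType K) (J : {linear E -> F}) (f : dual_space E) :
  (forall x, rnorm (J x) = rnorm x) ->
  exists2 g : dual_space F, forall x, g (J x) = f x & rnorm g <= rnorm f.
Proof.
move=> Jiso; pose N (y : F) := rnorm f * rnorm y.
have sN : seminorm N.
  split=> [u v|a u]; first by rewrite -mulrDr ler_wpM2l ?rnorm_ge0 ?ler_rnormD.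
  by rewrite /N rnormZ mulrCA.
have [u|psi [psiL psiN]] := @hahn_banach _ _ J (dual_fun f) N sN.
  by rewrite /N Jiso; exact: dual_le.
have [g gE gf] := dual_of (rnorm_ge0 f) psiN.
by exists g => // x; rewrite gE psiL.
Qed.

Lemma dual_norming (E : normedModType K) (x : E) :
  exists2 f : dual_space E, f x = sofR k (rnorm x) & rnorm f <= 1.
Proof.
have [psi [psix psiN]] := norming_functional x (seminorm_rnorm E).
have [|g gE gf] := @dual_of _ psi 1 ler01; first by move=> y; rewrite mul1r.
by exists g; rewrite ?gE.
Qed.

End hahn_banach.

(** * The Banach spaces l_1 and l_infty *)

Section rnorm_topology.
Variables (R : realType) (k : scalar_kind).
Local Notation K := (scalar_field R k).

Lemma sofR_gt0 (e : R) : (0 < sofR k e) = (0 < e).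
Proof. by rewrite !lt_def -{2}(sofR0 R k) ler_sofR -[in RHS](inj_eq (@sofR_inj R k)) sofR0. Qed.

Lemma ltr_sofR (a b : R) : (sofR k a < sofR k b) = (a < b).
Proof. by rewrite -subr_gt0 -sofRN -sofRD sofR_gt0 subr_gt0. Qed.

Lemma sRe_gt0 (e : K) : 0 < e -> 0 < sRe e.
Proof. by move=> e0; rewrite -(sofR_gt0) sofR_ge0// ltW. Qed.

Lemma cvg_rnormP (V : normedModType K) (F : set_system V) (FF : Filter F) (l : V) :
  (forall e : R, 0 < e -> F [set x | rnorm (x - l) < e]) <-> F --> l.
Proof.
split=> [Fl|/cvgrPdist_lt Fl e e0].
  apply/cvgrPdist_lt => e e0; have := Fl _ (sRe_gt0 e0); apply: filterS => x /= xe.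
  by rewrite distrC -rnormE -(sofR_ge0 (ltW e0)) ltr_sofR.
have := Fl (sofR k e); rewrite sofR_gt0 => /(_ e0); apply: filterS => x /=.
by rewrite distrC -rnormE ltr_sofR.
Qed.

Lemma cauchy_rnormP (V : normedModType K) (F : set_system V) (FF : ProperFilter F) :
  cauchy F <-> (forall e : R, 0 < e -> exists x, F [set y | rnorm (y - x) < e]).
Proof.
split=> [/cauchyP Fc e e0|Fc].
  have := Fc (sofR k e); rewrite sofR_gt0 => /(_ e0)[x Fx]; exists x.
  apply: filterS Fx => y; rewrite -ball_normE/= distrC -rnormE ltr_sofR//.
apply/cauchyP => e e0; have [x Fx] := Fc _ (sRe_gt0 e0); exists x.
apply: filterS Fx => y; rewrite -ball_normE/= distrC -[`|y - x|]rnormE.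
by rewrite -(sofR_ge0 (ltW e0)) ltr_sofR sofRK.
Qed.

Lemma scalar_cauchy_cvg (F : set_system K) (FF : ProperFilter F) : cauchy F -> cvg F.
Proof.
move=> /cauchy_rnormP Fc.
have part (h : K -> R) : (forall z, - rnorm z <= h z <= rnorm z) ->
    (forall z w, h (z - w) = h z - h w) -> exists a : R, forall e, 0 < e ->
    F [set z | `|h z - a| < e].
  move=> hle hB; have : cauchy (h @ F).
    apply/cauchyP => e e0; have [x Fx] := Fc e e0; exists (h x).
    apply: (@filterS _ F _ _ _ _ Fx) => y /= ye; rewrite -ball_normE/=.
    suff : `|h y - h x| < e by rewrite distrC.
    by have /andP[] := hle (y - x); rewrite hB ltr_norml /= in ye *; lra.
  move=> /cauchy_cvg/cvg_ex[a ha]; exists a => e e0.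
  move/cvgrPdist_lt : ha => /(_ e e0); apply: filterS => z /=.
  by rewrite distrC.
have [a aF] := part (@sRe R k) (fun z => etrans (esym (ler_norml _ _)) (sRe_le_rnorm z))
  (fun z w => etrans (sReD _ _) (congr1 _ (sReN _))).
have [b bF] := part (@sIm R k) (fun z => etrans (esym (ler_norml _ _)) (sIm_le_rnorm z))
  (fun z w => etrans (sImD _ _) (congr1 _ (sImN _))).
apply/cvg_ex; exists (smk k a b); apply/cvg_rnormP => e e0.
have e20 : 0 < e / 2 by rewrite divr_gt0.
apply: filterS2 (aF _ e20) (bF _ e20) => z /= za zb.
apply: le_lt_trans (rnorm_leD _) _.
have -> : sRe (z - smk k a b) = sRe z - a by rewrite sReD sReN sRe_mk.
suff : `|sIm (z - smk k a b)| < e / 2 by lra.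
apply: le_lt_trans zb; rewrite sImD sImN /smk {za}.
by case: k z => //= z; rewrite subrr normr0.
Qed.

Lemma continuous_rnormP (U V : normedModType K) (f : U -> V) :
  (forall x (e : R), 0 < e -> exists2 d, 0 < d &
     forall y, rnorm (y - x) < d -> rnorm (f y - f x) < e) -> continuous f.
Proof.
move=> fP x; apply/cvgrPdist_lt => e e0; have [d d0 xd] := fP x _ (sRe_gt0 e0).
have := @cvgrPdist_lt _ U U (nbhs x) _ id x; move=> [/(_ (@cvg_id _ _))/(_ (sofR k d)) h _].
have := h; rewrite sofR_gt0 => /(_ d0); apply: filterS => y.
rewrite distrC -rnormE ltr_sofR => /xd; rewrite -ltr_sofR rnormE sofR_ge0 ?ltW//.
by rewrite distrC.
Qed.

End rnorm_topology.

Variant ell_kind := EllOne | EllInfty.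

(* The norm of [ell b G] is the supremum of the sums of the moduli over the
   repetition-free finite families in [G] when [b = EllOne], and over the
   families with at most one element when [b = EllInfty]. *)
Definition ell_test (b : ell_kind) (G : choiceType) (s : seq G) : bool :=
  if b is EllOne then uniq s else (size s <= 1)%N.

Lemma ell_test_uniq (b : ell_kind) (G : choiceType) (s : seq G) :
  ell_test b s -> uniq s.
Proof. by case: b => //; case: s => [|? []]. Qed.

Section ell.
Variables (R : realType) (k : scalar_kind) (b : ell_kind) (G : choiceType).
Local Notation K := (scalar_field R k).
Implicit Types (f h : G -> K) (s : seq G).

Definition ell_sum s f : R := \sum_(g <- s) rnorm (f g).

Lemma ell_sum_seminorm s : seminorm (ell_sum s : (G -> K) -> R).
Proof.
split=> [f h|a f]; rewrite /ell_sum.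
  rewrite -big_split/=; apply: ler_sum => g _; exact: ler_rnormD.
by rewrite mulr_sumr; apply: eq_bigr => g _; rewrite -rnormM.
Qed.

Definition ell_pred : {pred G -> K} :=
  mem [set f | exists M, forall s, ell_test b s -> ell_sum s f <= M].

Lemma ell_submod_closed : submod_closed ell_pred.
Proof.
split=> [|a f h]; rewrite !inE.
  by exists 0 => s _; rewrite (seminorm0 (ell_sum_seminorm s)).
move=> [M fM] [N hN]; exists (rnorm a * M + N) => s st.
apply: le_trans ((ell_sum_seminorm s).1 _ _) _; apply: lerD; last exact: hN.
by rewrite (ell_sum_seminorm s).2 ler_wpM2l ?rnorm_ge0// fM.
Qed.

HB.instance Definition _ := GRing.isSubmodClosed.Build _ _ ell_pred ell_submod_closed.

Record ell : Type := Ell { ell_fun :> G -> K ; _ : ell_fun \in ell_pred }.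

HB.instance Definition _ := [isSub for ell_fun].
HB.instance Definition _ := [Choice of ell by <:].
HB.instance Definition _ := [SubChoice_isSubLmodule of ell by <:].

Lemma ellP (x y : ell) : x =1 y -> x = y.
Proof. by move=> xy; apply: val_inj; apply/funext. Qed.

Let N (x : ell) : R := sup [set ell_sum s x | s in [set s | ell_test b s]].

Let ell_sum_le s (x : ell) : ell_test b s -> ell_sum s x <= N x.
Proof.
move=> st; have := valP x; rewrite inE => -[M xM].
by apply: (@sup_ge _ _ M) => [_ [t tt <-]|]; [exact: xM|exists s].
Qed.

Let N_le (x : ell) M : (forall s, ell_test b s -> ell_sum s x <= M) -> N x <= M.
Proof.
move=> xM; apply: ge_sup => [|_ [s st <-]]; last exact: xM.
by exists (ell_sum [::] x), [::] => //=; rewrite /ell_test; case: b.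
Qed.

Lemma ell_test1 (g : G) : ell_test b [:: g].
Proof. by case: b. Qed.

Let N_ge0 x : 0 <= N x.
Proof.
have nil : ell_test b ([::] : seq G) by case: b.
by apply: le_trans (ell_sum_le x nil); rewrite /ell_sum big_nil.
Qed.

Let NZ a x : N (a *: x) = rnorm a * N x.
Proof.
apply: seminorm_exact => [y|c y]; first exact: N_ge0.
apply: N_le => s st; rewrite (ell_sum_seminorm s).2.
by rewrite ler_wpM2l ?rnorm_ge0// ell_sum_le.
Qed.

Let ell_norm (x : ell) : K := sofR k (N x).

Let ell_normD x y : ell_norm (x + y) <= ell_norm x + ell_norm y.
Proof.
rewrite -sofRD ler_sofR; apply: N_le => s st.
by apply: le_trans ((ell_sum_seminorm s).1 _ _) _; apply: lerD; exact: ell_sum_le.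
Qed.

Let ell_normZ a x : ell_norm (a *: x) = `|a| * ell_norm x.
Proof. by rewrite /ell_norm NZ sofRM -(@rnormE R k K). Qed.

Let ell_norm0 x : ell_norm x = 0 -> x = 0.
Proof.
rewrite -(sofR0 R k) => /sofR_inj x0; apply: ellP => g; apply: rnorm0_eq0.
apply/eqP; rewrite eq_le rnorm_ge0 andbT -x0.
by have := ell_sum_le x (ell_test1 g); rewrite /ell_sum big_seq1.
Qed.

HB.instance Definition _ := @Lmodule_isNormed.Build K ell ell_norm
  ell_normD ell_normZ ell_norm0.

Lemma rnorm_ell_ge s (x : ell) : ell_test b s -> ell_sum s x <= rnorm x.
Proof. by move=> st; rewrite [leRHS](@sofRK R k); exact: ell_sum_le. Qed.

Lemma rnorm_ell_le (x : ell) M :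
  (forall s, ell_test b s -> ell_sum s x <= M) -> rnorm x <= M.
Proof. by move=> xM; rewrite [leLHS](@sofRK R k); exact: N_le. Qed.

Lemma ell_coord_le (x : ell) g : rnorm (x g) <= rnorm x.
Proof. by have := rnorm_ell_ge x (ell_test1 g); rewrite /ell_sum big_seq1. Qed.

Lemma ell_cauchy_cvg (F : set_system ell) (FF : ProperFilter F) : cauchy F -> cvg F.
Proof.
move=> /cauchy_rnormP Fc.
have pt g : exists l : K, forall e, 0 < e -> F [set x | rnorm (x g - l) < e].
  have : cauchy ((fun x : ell => x g) @ F).
    apply/cauchy_rnormP => e e0; have [x Fx] := Fc e e0; exists (x g).
    apply: (@filterS _ F _ _ _ _ Fx) => y /=; apply: le_lt_trans.
    exact: (ell_coord_le (y - x) g).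
  move=> /scalar_cauchy_cvg/cvg_ex[l /cvg_rnormP lF]; exists l => e e0.
  exact: lF.
have [l lP] := choice pt.
have near_l s e : 0 < e -> F [set x | ell_sum s (fun g => x g - l g) <= e].
  elim: s e => [|g s IH] e e0.
    by apply: filterE => x; rewrite /= /ell_sum big_nil ltW.
  have e20 : 0 < e / 2 by rewrite divr_gt0.
  apply: filterS2 (IH _ e20) (lP g _ e20) => x /=.
  by rewrite /ell_sum big_cons => h1 h2; lra.
(* The filter contains points close to [x] in norm and to [l] on the finite family [s]; splitting
   through such a point bounds [x - l] on [s]. *)
have dist_l (x : ell) e : 0 < e -> F [set y | rnorm (y - x) < e] ->
    forall s, ell_test b s -> ell_sum s ((x : G -> K) - l) <= e.
  move=> e0 Fx s st; apply/ler_addgt0Pr => d d0.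
  have [y [yx yl]] := filter_ex (filterI Fx (near_l s d d0)).
  have -> : (x : G -> K) - l = ell_fun (x - y) + ((y : G -> K) - l).
    by apply/funext => g; rewrite /= !fctE addrA subrK.
  apply: le_trans ((ell_sum_seminorm s).1 _ _) _; apply: lerD => //.
  by apply: le_trans (rnorm_ell_ge _ st) _; rewrite rnormB ltW.
have lin : l \in ell_pred.
  have [x Fx] := Fc 1 ltr01; have xl := dist_l x 1 ltr01 Fx.
  have -> : l = (x : G -> K) - ((x : G -> K) - l) by rewrite opprB addrC subrK.
  apply: rpredB; first exact: valP.
  by rewrite inE; exists 1.
apply/cvg_ex; exists (Ell lin); apply/cvg_rnormP => e e0.
have e20 : 0 < e / 4 by rewrite divr_gt0.
have [x Fx] := Fc _ e20; apply: filterS (Fx) => y /= yx.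
have xl : rnorm (x - Ell lin) <= e / 4.
  by apply: rnorm_ell_le => s st; exact: dist_l Fx s st.
have -> : y - Ell lin = (y - x) + (x - Ell lin) by rewrite addrA subrK.
apply: le_lt_trans (ler_rnormD _ _) _; lra.
Qed.

HB.instance Definition _ := Uniform_isComplete.Build ell ell_cauchy_cvg.

End ell.

(** * Polynomials and symmetric tensors *)

Section mform_theory.
Variables (K : numFieldType) (n : nat) (E : lmodType K).

(** Linearity in slot [m] splits the value into one with [x] there and [t] times one with [h] there,
    so each slot raises the degree by one. The later slots hold an arbitrary [y] because the
    induction inserts [x] and [h] into it. *)
Lemma mform_line_step (A : mform n E) (x h : E) (m : nat) : (m <= n)%N ->
  forall y : 'I_n -> E, exists2 P : {poly K}, (size P <= m.+1)%N &
  forall t, A (fun j => if (j < m)%N then x + t *: h else y j) = P.[t].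
Proof.
elim: m => [_ y|m IH mn y].
  exists (A y)%:P; first exact: size_polyC_leq1.
  by move=> t; rewrite hornerC.
pose i := Ordinal mn.
have [P sP PE] := IH (ltnW mn) (update y i x).
have [Q sQ QE] := IH (ltnW mn) (update y i h).
have upd t u : (fun j : 'I_n => if (j < m)%N then x + t *: h else update y i u j) =
    update (fun j : 'I_n => if (j < m)%N then x + t *: h else y j) i u.
  apply/funext => j; rewrite /update; case: eqP => [->|//].
  by rewrite ltnn.
exists (P + Q * 'X) => [|t].
  rewrite (leq_trans (size_polyD _ _))// geq_max (leq_trans sP)//=.
  by rewrite (leq_trans (size_polyMleq _ _))// size_polyX addn2.
rewrite hornerD hornerMX -PE -QE !upd [_ * t]mulrC [RHS]addrC.
have := @mform_multilinear _ _ _ A i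
  (fun j : 'I_n => if (j < m)%N then x + t *: h else y j) t h x.
rewrite /= => <-; congr (A _).
apply/funext => j; rewrite /update ltnS leq_eqVlt -val_eqE/=.
by case: eqP => //= _; rewrite addrC.
Qed.

Lemma mform_line (A : mform n E) (x h : E) : exists2 P : {poly K},
  (size P <= n.+1)%N & forall t, A (fun=> x + t *: h) = P.[t].
Proof.
have [P sP PE] := mform_line_step A x h (leqnn n) (fun=> 0).
by exists P => // t; rewrite -PE; congr (A _); apply/funext => j; rewrite ltn_ord.
Qed.

(** On each form the left side is a polynomial in [t] of degree at most [n], hence its own Lagrange
    interpolant at the nodes 0, ..., n. The coefficients do not depend on the form, so the identity
    holds between tensors. Along a line, powers thus depend on [t] only through scalar
    polynomials. *)
Lemma tpower_interpolation (x h : E) (t : K) : tpower n (x + t *: h) =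
  \sum_(l < n.+1) ((tnth (lagrange n.+1 (fun j => j%:R : K)) l) : {poly K}).[t]
    *: tpower n (x + l%:R *: h).
Proof.
have natI : injective (fun j => j%:R : K).
  by move=> i j /eqP; rewrite eqr_nat => /eqP.
apply: val_inj; rewrite raddf_sum; apply/funext => A; rewrite fct_sumE/=.
have [P sP PE] := mform_line A x h; rewrite /power_eval PE.
rewrite {1}(lagrange_gen (ltn0Sn n) natI sP) horner_sum; apply: eq_bigr => l _.
by rewrite hornerM hornerC mulrC -PE.
Qed.

Lemma mformZ_step (A : mform n E) (x : E) (a : K) (m : nat) : (m <= n)%N ->
  A (fun j => if (j < m)%N then a *: x else x) = a ^+ m * A (fun=> x).
Proof.
elim: m => [_|m IH mn]; first by rewrite expr0 mul1r.
rewrite exprS -mulrA -IH ?(ltnW mn)//; pose i := Ordinal mn.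
have := @mform_multilinear _ _ _ A i
  (fun j : 'I_n => if (j < m)%N then a *: x else x) a x 0.
set y := (fun j : 'I_n => if (j < m)%N then a *: x else x).
have A0 : A (update y i 0) = 0.
  have := @mform_multilinear _ _ _ A i y (-1) 0 0.
  by rewrite scaler0 addr0 mulN1r addNr.
have yx : update y i x = y.
  by apply/funext => j; rewrite /update; case: eqP => // ->; rewrite /y ltnn.
rewrite A0 !addr0 yx => <-; congr (A _).
apply/funext => j; rewrite /update ltnS leq_eqVlt -val_eqE/=.
by case: eqP.
Qed.

Lemma tpowerZ (a : K) (x : E) : tpower n (a *: x) = a ^+ n *: tpower n x.
Proof.
apply: val_inj; apply/funext => A; transitivity (a ^+ n * A (fun=> x)); last by [].
have := mformZ_step A x a (leqnn n); rewrite /= => <-; congr (A _).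
by apply/funext => j; rewrite ltn_ord.
Qed.

Lemma tpower0 : (0 < n)%N -> tpower n (0 : E) = 0.
Proof. by move=> n0; rewrite -[X in tpower n X](scale0r 0) tpowerZ expr0n gtn_eqF// scale0r. Qed.

End mform_theory.

Section symtensor_map_theory.
Variables (K : numFieldType) (n : nat).

Lemma symtensor_map_sum (E F : lmodType K) (T : {linear E -> F}) (s : seq (K * E)) :
  symtensor_map T (\sum_(c <- s) c.1 *: tpower n c.2) =
  \sum_(c <- s) c.1 *: tpower n (T c.2).
Proof.
rewrite linear_sum; apply: eq_bigr => c _.
by rewrite linearZ /= symtensor_map_power.
Qed.

Lemma symtensor_map_comp (E F G : lmodType K) (S : {linear F -> G})
    (T : {linear E -> F}) (U : {linear E -> G}) (z : symtensor n E) :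
  (forall x, S (T x) = U x) -> symtensor_map S (symtensor_map T z) = symtensor_map U z.
Proof.
move=> STU; have [s ->] := symtensorP z; rewrite !symtensor_map_sum.
have := symtensor_map_sum S [seq (c.1, T c.2) | c <- s].
by rewrite !big_map /= => ->; apply: eq_bigr => c _; rewrite STU.
Qed.

Lemma symtensor_map_id (E : lmodType K) (T : {linear E -> E}) (z : symtensor n E) :
  T =1 id -> symtensor_map T z = z.
Proof.
move=> Tid; have [s ->] := symtensorP z; rewrite symtensor_map_sum.
by apply: eq_bigr => c _; rewrite Tid.
Qed.

Lemma eq_symtensor_linear (E : lmodType K) (phi psi : {linear symtensor n E -> K}) :
  (forall x, phi (tpower n x) = psi (tpower n x)) -> phi =1 psi.
Proof.
move=> pp z; have [s ->] := symtensorP z; rewrite !linear_sum.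
by apply: eq_bigr => c _; rewrite !linearZ /= pp.
Qed.

End symtensor_map_theory.

(** * Continuity of the polynomial attached to a functional *)

Section power_continuity.
Variables (R : realType) (k : scalar_kind).
Local Notation K := (scalar_field R k).

Lemma horner_bounded (P : {poly K}) : exists2 B : R, 0 <= B &
  forall t : K, rnorm t <= 1 -> rnorm P.[t] <= B.
Proof.
elim/poly_ind: P => [|P c [B B0 PB]].
  by exists 0 => // t _; rewrite horner0 rnorm0.
exists (B + rnorm c); first by rewrite addr_ge0 ?rnorm_ge0.
move=> t t1; rewrite hornerMXaddC (le_trans (ler_rnormD _ _))// lerD2r rnormM.
by apply: le_trans (PB t t1); rewrite ler_piMr ?rnorm_ge0.
Qed.

Lemma horner_lipschitz0 (P : {poly K}) : exists2 B : R, 0 <= B &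
  forall t : K, rnorm t <= 1 -> rnorm (P.[t] - P.[0]) <= rnorm t * B.
Proof.
elim/poly_ind: P => [|P c _].
  by exists 0 => // t _; rewrite !horner0 subrr rnorm0 mulr0.
have [B B0 PB] := horner_bounded P; exists B => // t t1.
rewrite !hornerMXaddC mulr0 add0r addrK rnormM mulrC.
by rewrite ler_wpM2l ?rnorm_ge0// PB.
Qed.

Variables (n : nat) (E : normedModType K).

(** Writing [y = x + s h] with [|h| <= 1], interpolation turns the difference into a finite sum: its
    coefficients [L l (s) - L l (0)] are of order [s], and its powers at [x + l h] are bounded by
    assumption. *)
Lemma power_continuous (psi : {linear symtensor n E -> K}) (C : R) :
  (forall x, rnorm (psi (tpower n x)) <= C * rnorm x ^+ n) ->
  forall (x : E) (e : R), 0 < e -> exists2 d, 0 < d &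
  forall y, rnorm (y - x) < d -> rnorm (psi (tpower n y) - psi (tpower n x)) < e.
Proof.
move=> psiC x e e0; pose L l : {poly K} := tnth (lagrange n.+1 (fun j => j%:R : K)) l.
have [B BP] := choice (fun l => let: ex_intro2 B B0 H := horner_lipschitz0 (L l) in
  ex_intro (fun B : R => 0 <= B /\ forall t : K, rnorm t <= 1 ->
    rnorm ((L l).[t] - (L l).[0]) <= rnorm t * B) B (conj B0 H)).
pose M := \sum_(l < n.+1) B l * (`|C| * (rnorm x + rnorm (l%:R : K)) ^+ n).
have M0 : 0 <= M.
  apply: sumr_ge0 => l _; rewrite mulr_ge0 ?(BP l).1// mulr_ge0// exprn_ge0//.
  by rewrite addr_ge0 ?rnorm_ge0.
(* The Lipschitz bound of the coefficients holds for parameters of modulus at most 1; [M + 1] keeps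
   the quotient meaningful when [M] vanishes. *)
pose d := Num.min 1 (e / (M + 1)).
have M10 : 0 < M + 1 by rewrite ltr_pwDr.
have d0 : 0 < d by rewrite lt_min ltr01 divr_gt0.
have d1 : d <= 1 by rewrite ge_min lexx.
exists d => // y yd; pose s := sofR k d; pose h := s^-1 *: (y - x).
have rs : rnorm s = d by rewrite rnorm_sofR// ltW.
have s0 : s != 0 by rewrite -rnorm_gt0 rs.
have h1 : rnorm h <= 1.
  by rewrite rnormZ rnormV rs ler_pdivrMl// mulr1 ltW.
have yE : y = x + s *: h by rewrite scalerA mulfV// scale1r addrC subrK.
have xE : x = x + 0 *: h by rewrite scale0r addr0.
have -> : psi (tpower n y) - psi (tpower n x) =
    \sum_(l < n.+1) ((L l).[s] - (L l).[0]) * psi (tpower n (x + l%:R *: h)).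
  rewrite yE {2}xE !tpower_interpolation !linear_sum -big_split; apply: eq_bigr => l _.
  by rewrite /= mulrBl; congr (_ - _); exact: linearZ.
apply: le_lt_trans (ler_rnorm_sum _ _ _) _; apply: (@le_lt_trans _ _ (d * M)).
  rewrite mulr_sumr; apply: ler_sum => l _; rewrite rnormM mulrA.
  apply: ler_pM; rewrite ?rnorm_ge0//.
    by rewrite -rs; apply: (BP l).2; rewrite rs.
  apply: le_trans (psiC _) _; apply: (@le_trans _ _ (`|C| * rnorm (x + l%:R *: h) ^+ n)).
    by rewrite ler_wpM2r ?exprn_ge0 ?rnorm_ge0// ler_norm.
  rewrite ler_wpM2l// lerXn2r ?nnegrE ?rnorm_ge0 ?addr_ge0 ?rnorm_ge0//.
  by rewrite (le_trans (ler_rnormD _ _))// lerD2l rnormZ ler_piMr ?rnorm_ge0.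
apply: (@le_lt_trans _ _ (e / (M + 1) * M)).
  by rewrite ler_wpM2r// ge_min lexx orbT.
by rewrite mulrAC ltr_pdivrMr// ltr_pM2l// ltrDl.
Qed.

End power_continuity.

(** * Finite rank projections and isometric embeddings *)

Section finite_rank.
Variables (R : realType) (k : scalar_kind) (E : normedModType (scalar_field R k)).
Local Notation K := (scalar_field R k).
Implicit Types (s : seq (dual_space E * E)) (x y : E).

Definition finrank s y : E := \sum_(c <- s) c.1 y *: c.2.

Lemma finrank_is_linear s : linear (finrank s).
Proof.
move=> a x y; rewrite /finrank scaler_sumr -big_split; apply: eq_bigr => c _ /=.
by rewrite linearP scalerDl scalerA.
Qed.

HB.instance Definition _ s := GRing.isLinear.Build K E E *:%R (finrank s)
  (finrank_is_linear s).

Lemma finrank_bounded s y :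
  rnorm (finrank s y) <= (\sum_(c <- s) rnorm c.1 * rnorm c.2) * rnorm y.
Proof.
rewrite mulr_suml (le_trans (ler_rnorm_sum _ _ _))//; apply: ler_sum => c _.
by rewrite rnormZ mulrAC ler_wpM2r ?rnorm_ge0// dual_le.
Qed.

(* Induction on [xs]: if [x] is not fixed, add the rank one operator
   [y |-> g (y - Q y) r] with [r = x - Q x] and [g r = 1]. *)
Lemma finite_rank_projection (xs : seq E) : exists s,
  (forall x, x \in xs -> finrank s x = x) /\
  (forall c, c \in s -> finrank s c.2 = c.2).
Proof.
elim: xs => [|x xs [s [sx ss]]]; first by exists [::].
have idem y : finrank s (finrank s y) = finrank s y.
  rewrite {2 3}/finrank linear_sum; apply: eq_big_seq => c cs.
  by rewrite linearZ /= ss.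
pose r := x - finrank s x.
have [r0|r0] := eqVneq r 0.
  exists s; split=> // y; rewrite inE => /predU1P[->|]; last exact: sx.
  by apply/esym/eqP; rewrite -subr_eq0; apply/eqP.
have [g0 g0r _] := dual_norming r.
pose g := (sofR k (rnorm r))^-1 *: g0.
have gr : g r = 1.
  have -> : g r = (sofR k (rnorm r))^-1 * g0 r by [].
  by rewrite g0r mulVf// rnormE normr_eq0.
move: g gr => g gr.
pose f := g - \sum_(c <- s) g c.2 *: c.1.
have fE y : f y = g (y - finrank s y).
  have sumE (t : seq (dual_space E * E)) :
      (\sum_(c <- t) g c.2 *: c.1 : dual_space E) y = \sum_(c <- t) g c.2 * c.1 y.
    elim: t => [|c t IH]; first by rewrite !big_nil.
    by rewrite !big_cons -IH.
  have -> : f y = g y - (\sum_(c <- s) g c.2 *: c.1 : dual_space E) y by [].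
  rewrite sumE linearB /= /finrank; congr (_ - _); rewrite linear_sum.
  by apply: eq_bigr => c _; rewrite linearZ /= mulrC.
have QE y : finrank ((f, r) :: s) y = g (y - finrank s y) *: r + finrank s y.
  by rewrite [LHS]big_cons fE.
have Qr : finrank s r = 0 by rewrite /r linearB /= idem subrr.
have Qx : finrank ((f, r) :: s) x = x.
  by rewrite QE -/r gr scale1r subrK.
have Qfix y : finrank s y = y -> finrank ((f, r) :: s) y = y.
  by move=> yE; rewrite QE yE subrr linear0 scale0r add0r.
exists ((f, r) :: s); split=> [y|c]; rewrite inE.
  by move=> /predU1P[->//|/sx]; exact: Qfix.
move=> /predU1P[->/=|/ss]; last exact: Qfix.
by rewrite QE Qr subr0 gr scale1r addr0.
Qed.

End finite_rank.

Section fixed_space.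
Variables (R : realType) (k : scalar_kind) (E : banachType R k).
Variable s : seq (dual_space E * E).
Local Notation K := (scalar_field R k).

(** Finite-dimensional subspaces are realized as fixed points of finite rank operators: continuity
    of the operator makes them closed, hence complete, and when the vectors listed in [s] are fixed
    they form a spanning family. *)
Definition fixed_pred : {pred E} := fun y => finrank s y == y.

Lemma fixed_submod_closed : submod_closed fixed_pred.
Proof.
split=> [|a x y]; rewrite !unfold_in ?linear0//.
by move=> /eqP xE /eqP yE; rewrite linearP /= xE yE.
Qed.

HB.instance Definition _ := GRing.isSubmodClosed.Build _ _ fixed_pred fixed_submod_closed.

Record fixed_space : Type := Fixed { fixed_val : E ; _ : fixed_val \in fixed_pred }.

HB.instance Definition _ := [isSub for fixed_val].
HB.instance Definition _ := [Choice of fixed_space by <:].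
HB.instance Definition _ := [SubChoice_isSubLmodule of fixed_space by <:].

Let norm (x : fixed_space) : K := `|fixed_val x|.

Let normD x y : norm (x + y) <= norm x + norm y.
Proof. exact: ler_normD. Qed.

Let normZ a x : norm (a *: x) = `|a| * norm x.
Proof. exact: normrZ. Qed.

Let norm0 x : norm x = 0 -> x = 0.
Proof. by move=> /normr0_eq0 x0; apply: val_inj. Qed.

HB.instance Definition _ := @Lmodule_isNormed.Build K fixed_space norm normD normZ norm0.

Lemma fixed_cauchy_cvg (F : set_system fixed_space) (FF : ProperFilter F) :
  cauchy F -> cvg F.
Proof.
move=> /cauchy_rnormP Fc.
have : cauchy (fixed_val @ F).
  apply/cauchy_rnormP => e e0; have [x Fx] := Fc e e0; exists (fixed_val x).
  exact: (@filterS _ F _ _ _ _ Fx).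
move=> /cauchy_cvg/cvg_ex[l /cvg_rnormP lF].
have {}lF e : 0 < e -> F [set x | rnorm (fixed_val x - l) < e] by exact: lF.
pose M := \sum_(c <- s) rnorm c.1 * rnorm c.2.
have M0 : 0 <= M by apply: sumr_ge0 => c _; rewrite mulr_ge0 ?rnorm_ge0.
have lfix : l \in fixed_pred.
  rewrite unfold_in -subr_eq0; apply/eqP/rnorm0_eq0/eqP.
  rewrite eq_le rnorm_ge0 andbT; apply/ler_addgt0Pr => e e0; rewrite add0r.
  have e10 : 0 < e / (M + 1) by rewrite divr_gt0// ltr_pwDr.
  have [x /= xl] := filter_ex (lF _ e10).
  have xE : finrank s (fixed_val x) = fixed_val x by apply/eqP; exact: valP x.
  have -> : finrank s l - l = (fixed_val x - l) - finrank s (fixed_val x - l).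
    by rewrite linearB /= xE opprB [RHS]addrC subrKA.
  apply: le_trans (ler_rnormD _ _) _; rewrite rnormN.
  apply: (@le_trans _ _ ((M + 1) * rnorm (fixed_val x - l))).
    by rewrite mulrDl mul1r addrC lerD2r finrank_bounded.
  by rewrite -ler_pdivlMl ?ltr_pwDr// mulrC ltW.
apply/cvg_ex; exists (Fixed lfix); apply/cvg_rnormP => e e0.
exact: lF.
Qed.

HB.instance Definition _ := Uniform_isComplete.Build fixed_space fixed_cauchy_cvg.

Lemma fixed_val_is_linear : linear fixed_val.
Proof. by []. Qed.

HB.instance Definition _ := GRing.isLinear.Build K fixed_space E *:%R fixed_val
  fixed_val_is_linear.

End fixed_space.

Lemma finite_dim_subspace (R : realType) (k : scalar_kind) (E : banachType R k)
    (xs : seq E) : exists (M : banachType R k) (I : {linear M -> E}),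
  [/\ finite_dim M, isometric (@rnorm R k M) (@rnorm R k E) I &
      forall x, x \in xs -> exists y, I y = x].
Proof.
have [s [sx ss]] := finite_rank_projection xs.
exists (fixed_space s), (@fixed_val _ _ _ s); split=> // [|x /sx/eqP xE]; last first.
  by exists (Fixed xE).
have sP (i : 'I_(size s)) : (tnth (in_tuple s) i).2 \in fixed_pred s.
  by apply/eqP/ss; exact: mem_tnth.
exists (size s), (fun i => Fixed (sP i)) => x.
exists (fun i => (tnth (in_tuple s) i).1 (fixed_val x)); apply: val_inj.
by rewrite raddf_sum -[LHS](eqP (valP x)) /finrank (big_tnth _ _ s).
Qed.

Section isometry.
Variables (R : realType) (k : scalar_kind) (n : nat).
Local Notation K := (scalar_field R k).

(** On the finitely many vectors occurring in [z] the isometry has a linear left inverse: a finite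
    rank projection fixing them, with its functionals extended along [J]. The symmetric power of
    this left inverse recovers [z]. *)
Lemma symtensor_map_inj (E F : normedModType K) (J : {linear E -> F}) (z : symtensor n E) :
  (forall x, rnorm (J x) = rnorm x) -> symtensor_map J z = 0 -> z = 0.
Proof.
move=> Jiso; have [xs ->] := symtensorP z.
have [s [sx _]] := finite_rank_projection [seq c.2 | c <- xs].
have [ext extP] := choice (fun f => let: ex_intro2 g gf _ := dual_extend f Jiso in
  ex_intro (fun g : dual_space F => forall x, g (J x) = f x) g gf).
pose P (y : F) : E := \sum_(c <- s) ext c.1 y *: c.2.
have lP : linear P.
  move=> a x y; rewrite /P scaler_sumr -big_split; apply: eq_bigr => c _ /=.
  by rewrite linearP scalerDl scalerA.
pose PL : {linear F -> E} := HB.pack P (GRing.isLinear.Build K F E *:%R P lP).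
have PJ x : x \in [seq c.2 | c <- xs] -> P (J x) = x.
  move=> /sx {2}<-; apply: eq_bigr => c _; by rewrite extP.
move=> /(congr1 (symtensor_map PL)); rewrite linear0 => H; apply: etrans H.
rewrite symtensor_map_sum.
have := symtensor_map_sum n PL [seq (c.1, J c.2) | c <- xs].
rewrite !big_map => ->; apply: eq_big_seq => c cxs /=.
by rewrite PJ//; apply/mapP; exists c.
Qed.

End isometry.

(** * Injectivity of l_infty and the canonical embedding *)

Section ell_infty.
Variables (R : realType) (k : scalar_kind).
Local Notation K := (scalar_field R k).

Lemma rnorm_ell_infty_le (G : choiceType) (x : ell R k EllInfty G) (M : R) : 0 <= M ->
  (forall g, rnorm (x g) <= M) -> rnorm x <= M.
Proof.
move=> M0 xM; apply: rnorm_ell_le => -[|g [|//]] _; rewrite /ell_sum ?big_nil//.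
by rewrite big_seq1.
Qed.

Section ell_map.
Variables (E : normedModType K) (G : choiceType) (h : G -> dual_space E) (c : R).
Hypothesis hc : forall g, rnorm (h g) <= c.

Lemma ell_map_subproof (x : E) : (fun g => h g x) \in @ell_pred R k EllInfty G.
Proof.
rewrite inE; exists (`|c| * rnorm x) => -[|g [|//]] _; rewrite /ell_sum ?big_nil.
  by rewrite mulr_ge0 ?rnorm_ge0.
rewrite big_seq1 (le_trans (dual_le _ _))// ler_wpM2r ?rnorm_ge0//.
exact: le_trans (hc g) (ler_norm c).
Qed.

Definition ell_map (x : E) : ell R k EllInfty G := Ell (ell_map_subproof x).

Lemma ell_map_is_linear : linear ell_map.
Proof. by move=> a x y; apply: ellP => g /=; rewrite linearP. Qed.

HB.instance Definition _ := GRing.isLinear.Build K E _ *:%R ell_map ell_map_is_linear.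

Lemma ell_map_le x : 0 <= c -> rnorm (ell_map x) <= c * rnorm x.
Proof.
move=> c0; apply: rnorm_ell_infty_le => [|g]; first by rewrite mulr_ge0 ?rnorm_ge0.
by rewrite (le_trans (dual_le _ _))// ler_wpM2r ?rnorm_ge0.
Qed.

End ell_map.

(** Hahn-Banach in each coordinate, with the same constant for all coordinates. *)
Lemma ell_infty_extension (E F : normedModType K) (G : choiceType) (J : {linear E -> F})
    (T : {linear E -> ell R k EllInfty G}) (c : R) : 0 <= c ->
  (forall x, rnorm (J x) = rnorm x) -> (forall x, rnorm (T x) <= c * rnorm x) ->
  exists2 S : {linear F -> ell R k EllInfty G}, forall x, S (J x) = T x &
    forall y, rnorm (S y) <= c * rnorm y.
Proof.
move=> c0 Jiso Tc.
have coord g : exists h : dual_space F, rnorm h <= c /\ forall x, h (J x) = T x g.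
  have lin : scalar (fun x => T x g) by move=> a x y; rewrite linearP.
  pose t : {linear E -> K} := HB.pack (fun x => T x g)
    (GRing.isLinear.Build K E K *:%R _ lin).
  have [x|f fE fc] := @dual_of R k E t c c0.
    exact: le_trans (ell_coord_le (T x) g) (Tc x).
  have [h hJ hf] := dual_extend f Jiso; exists h; split=> [|x].
    exact: le_trans hf fc.
  by rewrite hJ fE.
have [h hP] := choice coord.
have hc g : rnorm (h g) <= c by have [] := hP g.
exists (ell_map hc) => [x|y]; last exact: ell_map_le.
by apply: ellP => g /=; have [_ ->] := hP g.
Qed.

Variable E : normedModType K.

Definition dual_ball : choiceType := {f : dual_space E | rnorm f <= 1}.

Definition canonical_embedding := @ell_map E dual_ball _ 1 (fun f => valP f).

HB.instance Definition _ := GRing.Linear.on canonical_embedding.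

Lemma canonical_embedding_isometric x : rnorm (canonical_embedding x) = rnorm x.
Proof.
apply/eqP; rewrite eq_le; apply/andP; split.
  by rewrite -[leRHS]mul1r ell_map_le.
have [f fx f1] := dual_norming x.
have := ell_coord_le (canonical_embedding x) (exist _ f f1 : dual_ball).
by rewrite /= fx rnorm_sofR ?rnorm_ge0.
Qed.

End ell_infty.

(** * The injective hull *)

(** Norms given by infima are usually reached only up to some [d > c]; this passes to the limit,
    including the case [c = 0]. *)
Lemma ler_limit_exp (R : realType) (n : nat) (x a c : R) :
  (forall d, c < d -> x <= a * d ^+ n) -> x <= a * c ^+ n.
Proof.
move=> xd; have cv : a * d ^+ n @[d --> c^'+] --> a * c ^+ n.
  apply: cvg_at_right_filter; apply: cvgMr.
  exact: (@exprn_continuous R n c).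
have <- := cvg_lim (@Rhausdorff R) cv.
apply: limr_ge; first by apply/cvg_ex; eexists; exact: cv.
by near=> d; apply: xd; near: d; exact: nbhs_right_gt.
Unshelve. all: by end_near. Qed.

Section tensor_norm_theory.
Variables (R : realType) (k : scalar_kind) (n : nat).
Local Notation K := (scalar_field R k).
Local Notation Banach := (banachType R k).

Lemma projective_norm_le (E : normedModType K) (s : seq (K * E)) :
  projective_norm (\sum_(c <- s) c.1 *: tpower n c.2) <=
  \sum_(c <- s) rnorm c.1 * rnorm c.2 ^+ n.
Proof.
apply: (@inf_le _ _ 0); last by exists s.
move=> _ [t _ <-]; apply: sumr_ge0 => c _.
by rewrite mulr_ge0 ?exprn_ge0 ?rnorm_ge0.
Qed.

Lemma injective_norm_ge (E : normedModType K) (z : symtensor n E) (f : dual_space E) :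
  rnorm f <= 1 -> rnorm (z (dual_power n f)) <= injective_norm z.
Proof.
move=> f1; have [s ->] := symtensorP z.
apply: (@sup_ge _ _ (\sum_(c <- s) rnorm c.1 * rnorm c.2 ^+ n)); last by exists f.
move=> _ [g /= g1 <-].
have -> : symtensor_fun (\sum_(c <- s) c.1 *: tpower n c.2) (dual_power n g) =
    \sum_(c <- s) c.1 * g c.2 ^+ n.
  elim: s {z} => [|c s IH]; first by rewrite !big_nil.
  rewrite !big_cons -IH; congr (_ * _ + _).
  by rewrite /= /power_eval /= prodr_const card_ord.
apply: le_trans (ler_rnorm_sum _ _ _) _; apply: ler_sum => c _.
rewrite rnormM ler_wpM2l ?rnorm_ge0// rnormX.
rewrite lerXn2r ?nnegrE ?rnorm_ge0// (le_trans (dual_le _ _))//.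
by rewrite ler_piMl ?rnorm_ge0.
Qed.

(** Functionals extend along [J] without growth of the norm, so every value tested on [z] is also
    tested on its image. *)
Lemma injective_norm_isometry (E F : normedModType K) (J : {linear E -> F})
    (z : symtensor n E) : (forall x, rnorm (J x) = rnorm x) ->
  injective_norm z <= injective_norm (symtensor_map J z).
Proof.
move=> Jiso; apply: ge_sup => [|_ [f /= f1 <-]].
  by exists (rnorm (z (dual_power n (0 : dual_space E)))), 0; rewrite //= rnorm0.
have [g gJ gf] := dual_extend f Jiso.
have -> : symtensor_fun z (dual_power n f) = symtensor_map J z (dual_power n g).
  have [s ->] := symtensorP z; rewrite symtensor_map_sum.
  elim: s => [|c s IH]; first by rewrite !big_nil.
  rewrite !big_cons; congr (_ * _ + _); last exact: IH.
  by rewrite /= /power_eval /=; apply: eq_bigr => i _; rewrite gJ.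
by apply: injective_norm_ge; exact: le_trans f1.
Qed.

Lemma symtensor_map_scale (E F : lmodType K) (S T : {linear E -> F}) (a : K)
    (z : symtensor n E) : (forall x, S x = a *: T x) ->
  symtensor_map S z = a ^+ n *: symtensor_map T z.
Proof.
move=> SaT; have [s ->] := symtensorP z; rewrite !symtensor_map_sum scaler_sumr.
by apply: eq_bigr => c _; rewrite SaT tpowerZ !scalerA mulrC.
Qed.

Variables (beta : tensor_norm R k n) (beta_stn : s_tensor_norm beta).

Lemma stn_seminorm (E : Banach) : seminorm (beta (E := E)).
Proof. by have [? ? _] := stn_norm beta_stn E. Qed.

Lemma stn_ge0 (E : Banach) (z : symtensor n E) : 0 <= beta z.
Proof. exact: seminorm_ge0 (@stn_seminorm E) z. Qed.

Lemma stn_map_le (E F : Banach) (T : {linear E -> F}) (c : R) (z : symtensor n E) :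
  0 <= c -> (forall x, rnorm (T x) <= c * rnorm x) ->
  beta (symtensor_map T z) <= c ^+ n * beta z.
Proof.
move=> c0 Tc; have cT := rnorm_bounded Tc.
apply: le_trans (stn_map beta_stn cT z) _; rewrite ler_wpM2r ?stn_ge0//.
rewrite lerXn2r ?nnegrE ?opnorm_ge0//; apply: opnorm_le => x x1.
by rewrite (le_trans (Tc x))// ler_piMr.
Qed.

Lemma stn_sum_le (E : Banach) (s : seq (K * E)) :
  beta (\sum_(c <- s) c.1 *: tpower n c.2 : symtensor n E) <=
  \sum_(c <- s) rnorm c.1 * rnorm c.2 ^+ n.
Proof. exact: le_trans (stn_le_proj beta_stn _) (projective_norm_le s). Qed.

Lemma stn_power_le (E : Banach) (x : E) : beta (tpower n x) <= rnorm x ^+ n.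
Proof.
have := stn_sum_le [:: (1, x)].
by rewrite !big_seq1 scale1r rnorm1 mul1r.
Qed.

End tensor_norm_theory.

Section injective_hull.
Variables (R : realType) (k : scalar_kind) (n : nat).
Local Notation K := (scalar_field R k).
Local Notation Banach := (banachType R k).
Variables (beta : tensor_norm R k n) (beta_stn : s_tensor_norm beta).

Definition inj_hull : tensor_norm R k n := fun E z =>
  @beta (ell R k EllInfty (dual_ball E)) (symtensor_map (@canonical_embedding R k E) z).

(** The maps into l_infty spaces are exactly where the model is effective: [T] extends along the
    canonical embedding with the same bound, and [beta] has the mapping property for the
    extension. *)
Lemma inj_hull_map (E : Banach) (G : choiceType) (T : {linear E -> ell R k EllInfty G})
    (c : R) (z : symtensor n E) : 0 <= c -> (forall x, rnorm (T x) <= c * rnorm x) ->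
  beta (symtensor_map T z : symtensor n (ell R k EllInfty G)) <= c ^+ n * inj_hull z.
Proof.
move=> c0 Tc; have [S SJ Sc] :=
  ell_infty_extension c0 (@canonical_embedding_isometric R k E) Tc.
by rewrite -(symtensor_map_comp z SJ); exact: stn_map_le.
Qed.

Lemma inj_hull_map_le (E F : Banach) (T : {linear E -> F}) (c : R) (z : symtensor n E) :
  0 <= c -> (forall x, rnorm (T x) <= c * rnorm x) ->
  inj_hull (symtensor_map T z) <= c ^+ n * inj_hull z.
Proof.
move=> c0 Tc; rewrite {1}/inj_hull.
rewrite (@symtensor_map_comp _ _ _ _ _ _ _ (@canonical_embedding R k F \o T))//.
by apply: inj_hull_map => // x; rewrite /= canonical_embedding_isometric.
Qed.

Lemma inj_hull_le : tensor_norm_le inj_hull beta.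
Proof.
move=> E z; rewrite /inj_hull -[leRHS]mul1r -(expr1n _ n).
by apply: stn_map_le => // x; rewrite canonical_embedding_isometric mul1r.
Qed.

Lemma inj_hull_injective : injective_tensor_norm inj_hull.
Proof.
move=> E F I Iiso z; apply/eqP; rewrite eq_le; apply/andP; split.
  rewrite -[leRHS]mul1r -(expr1n _ n); apply: inj_hull_map_le => // x.
  by rewrite Iiso mul1r.
(* For the reverse inequality the canonical embedding of [E] is extended along [I] to [F]. *)
have [S SJ S1] : exists2 S : {linear F -> ell R k EllInfty (dual_ball E)},
    forall x, S (I x) = canonical_embedding x & forall y, rnorm (S y) <= 1 * rnorm y.
  by apply: ell_infty_extension => // x; rewrite canonical_embedding_isometric mul1r.
rewrite {1}/inj_hull -(symtensor_map_comp z SJ) -[leRHS]mul1r -(expr1n _ n).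
exact: inj_hull_map.
Qed.

Lemma inj_hull_stn : s_tensor_norm inj_hull.
Proof.
have inj_map := inj_hull_injective.
split.
- move=> E; split=> [u v|a u|u].
  + by rewrite /inj_hull linearD; exact: (stn_seminorm beta_stn _).1.
  + by rewrite /inj_hull linearZ; exact: (stn_seminorm beta_stn _).2.
  + have [_ _ n0] := stn_norm beta_stn (ell R k EllInfty (dual_ball E)).
    by move=> /n0; apply: symtensor_map_inj; exact: canonical_embedding_isometric.
- move=> E z; apply: le_trans (stn_ge_inj beta_stn _).
  by apply: injective_norm_isometry; exact: canonical_embedding_isometric.
- by move=> E z; exact: le_trans (inj_hull_le z) (stn_le_proj beta_stn z).
- move=> E F T cT z; apply: inj_hull_map_le; first exact: opnorm_ge0.
  by move=> x; exact: opnormP.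
(* Finite generation comes from injectivity: every finite-dimensional subspace carrying [z] yields
   the same value, so it suffices that one such subspace exists. *)
- move=> E z; rewrite (_ : [set _ | _] = [set inj_hull z]) ?inf1//.
  apply/seteqP; split=> [r [M [I [w [_ Iiso <- ->]]]] /=|_ ->].
    exact/esym/(inj_map _ _ I Iiso).
  have [s zE] := symtensorP z.
  have [M [I [fM Iiso Isurj]]] := finite_dim_subspace [seq c.2 | c <- s].
  have pre (c : K * E) : exists y, c \in s -> I y = c.2.
    have [cs|_] := boolP (c \in s); last by exists 0.
    by have [|y yE] := Isurj c.2; [exact: map_f|exists y].
  have [h hP] := choice pre.
  exists M, I, (\sum_(c <- [seq (c.1, h c) | c <- s]) c.1 *: tpower n c.2).
  have wz : symtensor_map I (\sum_(c <- [seq (c.1, h c) | c <- s]) c.1 *: tpower n c.2) = z.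
    rewrite symtensor_map_sum big_map zE; apply: eq_big_seq => c cs.
    by rewrite hP.
  by split=> //; rewrite -{1}wz; exact: (inj_map _ _ I Iiso).
Qed.

End injective_hull.

(** * The projective hull *)

Section ell_delta.
Variables (R : realType) (k : scalar_kind) (b : ell_kind) (G : choiceType).
Local Notation K := (scalar_field R k).

Lemma ell_sum_delta (g : G) (s : seq G) : ell_test b s ->
  ell_sum s (fun h => (h == g)%:R : K) <= 1.
Proof.
move=> /ell_test_uniq us.
have -> : ell_sum s (fun h => (h == g)%:R : K) = (count (pred1 g) s)%:R.
  rewrite -sum1_count natr_sum big_mkcond; apply: eq_bigr => h _ /=.
  by case: eqP; rewrite ?rnorm1 ?rnorm0.
by rewrite count_uniq_mem// lern1 leq_b1.
Qed.

Lemma ell_delta_subproof (g : G) :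
  (fun h => (h == g)%:R : K) \in @ell_pred R k b G.
Proof. by rewrite inE; exists 1 => s; exact: ell_sum_delta. Qed.

Definition ell_delta (g : G) : ell R k b G := Ell (ell_delta_subproof g).

Lemma rnorm_ell_delta (g : G) : rnorm (ell_delta g) <= 1.
Proof. by apply: rnorm_ell_le => s; exact: ell_sum_delta. Qed.

End ell_delta.

Section lincomb.
Variables (R : realType) (k : scalar_kind) (b : ell_kind) (G : finType).
Local Notation K := (scalar_field R k).

Section lincomb_def.
Variables (E : lmodType K) (y : G -> E).

Definition lincomb (x : ell R k b G) : E := \sum_g x g *: y g.

Lemma lincomb_is_linear : linear lincomb.
Proof.
move=> a u v; rewrite /lincomb scaler_sumr -big_split; apply: eq_bigr => g _ /=.
by rewrite scalerDl scalerA.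
Qed.

HB.instance Definition _ := GRing.isLinear.Build K _ E *:%R lincomb lincomb_is_linear.

End lincomb_def.

Lemma lincomb_delta (E : lmodType K) (y : G -> E) g : lincomb y (ell_delta R k b g) = y g.
Proof.
rewrite /lincomb (bigD1 g)//= eqxx scale1r big1 ?addr0// => h /negPf hg.
by rewrite hg scale0r.
Qed.

Definition ell_of (f : G -> K) : ell R k b G := \sum_g f g *: ell_delta R k b g.

Lemma ell_ofE f : ell_of f =1 f.
Proof.
move=> h; have sumE (s : seq G) :
    (\sum_(g <- s) f g *: ell_delta R k b g : ell R k b G) h =
    \sum_(g <- s) f g * (h == g)%:R.
  elim: s => [|g s IH]; first by rewrite !big_nil.
  by rewrite !big_cons -IH.
rewrite [LHS]sumE (bigD1 h)//= eqxx mulr1 big1 ?addr0// => g.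
by rewrite eq_sym => /negPf ->; rewrite mulr0.
Qed.

Lemma lincomb_id (x : ell R k b G) : lincomb (@ell_delta R k b G) x = x.
Proof. by apply: ellP; exact: (ell_ofE x). Qed.

Lemma lincomb_ext (E : lmodType K) (T : {linear ell R k b G -> E}) (x : ell R k b G) :
  T x = lincomb (fun g => T (ell_delta R k b g)) x.
Proof.
rewrite -[in LHS](lincomb_id x) linear_sum; apply: eq_bigr => g _.
by rewrite linearZ.
Qed.

End lincomb.

Lemma lincomb_le (R : realType) (k : scalar_kind) (G : finType)
    (E : normedModType (scalar_field R k)) (y : G -> E) (c : R)
    (x : ell R k EllOne G) :
  (forall g, rnorm (y g) <= c) -> rnorm (lincomb y x) <= c * rnorm x.
Proof.
move=> yc; apply: (@le_trans _ _ (c * ell_sum (enum G) x)).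
  rewrite /ell_sum big_enum /= mulr_sumr; apply: le_trans (ler_rnorm_sum _ _ _) _.
  by apply: ler_sum => g _; rewrite rnormZ mulrC ler_wpM2r ?rnorm_ge0.
have [c0|c0] := lerP 0 c.
  by rewrite ler_wpM2l// rnorm_ell_ge//= enum_uniq.
have G0 (g : G) : False by have := yc g; have := rnorm_ge0 (y g); lra.
have -> : x = 0 by apply: ellP => g; case: (G0 g).
by rewrite rnorm0 mulr0 /ell_sum big1 ?mulr0// => g; case: (G0 g).
Qed.

Section projective_hull.
Variables (R : realType) (k : scalar_kind) (n : nat) (n_gt0 : (0 < n)%N).
Local Notation K := (scalar_field R k).
Local Notation Banach := (banachType R k).
Variables (beta : tensor_norm R k n) (beta_stn : s_tensor_norm beta).
Local Notation ell1 G := (ell R k EllOne G).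

(** A contraction from [l_1^G] is the same as a family in the unit ball indexed by [G], the images
    of the unit vectors. Finite [G] suffice because a tensor involves finitely many vectors. *)
Definition proj_set (E : Banach) (z : symtensor n E) : set R :=
  [set r | exists (G : finType) (y : G -> E) (w : symtensor n (ell1 G)),
    [/\ forall g, rnorm (y g) <= 1, symtensor_map (lincomb y) w = z &
        r = @beta (ell1 G) w]].

Definition proj_hull : tensor_norm R k n := fun E z => inf (proj_set z).

Lemma proj_set_ge0 (E : Banach) (z : symtensor n E) r : proj_set z r -> 0 <= r.
Proof. by move=> [G [y [w [_ _ ->]]]]; exact: stn_ge0. Qed.

Lemma proj_set_sum (E : Banach) (s : seq (K * E)) : exists2 r,
  proj_set (\sum_(c <- s) c.1 *: tpower n c.2) r &
  r <= \sum_(c <- s) rnorm c.1 * rnorm c.2 ^+ n.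
Proof.
pose G : finType := 'I_(size s); pose c (i : G) := tnth (in_tuple s) i.
(* Each vector is normalized, and the [n]-th power of its norm moves into the coefficient. As the
   inverse of 0 is 0, a zero vector gives [y i = 0] and [a i = 0] ([n] being positive). *)
pose y (i : G) : E := (sofR k (rnorm (c i).2))^-1 *: (c i).2.
pose a (i : G) := (c i).1 * sofR k (rnorm (c i).2) ^+ n.
pose t : seq (K * ell1 G) := [seq (a i, ell_delta R k EllOne i) | i <- enum G].
exists (@beta (ell1 G) (\sum_(c <- t) c.1 *: tpower n c.2)).
  exists G, y, (\sum_(c <- t) c.1 *: tpower n c.2); split=> //.
    move=> i; rewrite /y rnormZ rnormV rnorm_sofR ?rnorm_ge0//.
    have [->|x0] := eqVneq (c i).2 0; first by rewrite rnorm0 mulr0 ler01.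
    by rewrite mulVf// gt_eqF// rnorm_gt0.
  rewrite symtensor_map_sum big_map big_enum (big_tnth _ _ s) /=.
  apply: eq_bigr => i _; rewrite lincomb_delta tpowerZ scalerA -/(c i) /a.
  have [->|x0] := eqVneq (c i).2 0; first by rewrite tpower0// !scaler0.
  rewrite -mulrA -exprMn_comm; last exact: mulrC.
  by rewrite mulfV ?expr1n ?mulr1// rnormE normr_eq0.
apply: le_trans (stn_sum_le beta_stn t) _.
rewrite big_map big_enum (big_tnth _ _ s) /=; apply: ler_sum => i _.
rewrite rnormM rnormX rnorm_sofR ?rnorm_ge0// -/(c i) -[leRHS]mulr1.
rewrite ler_wpM2l ?mulr_ge0 ?exprn_ge0 ?rnorm_ge0//.
by rewrite exprn_ile1 ?rnorm_ge0 ?rnorm_ell_delta.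
Qed.

Lemma proj_set_neq0 (E : Banach) (z : symtensor n E) : proj_set z !=set0.
Proof. by have [s ->] := symtensorP z; have [r rP _] := proj_set_sum s; exists r. Qed.

Lemma proj_hull_le (E : Banach) (z : symtensor n E) r : proj_set z r -> proj_hull z <= r.
Proof. by move=> zr; apply: (inf_le _ zr) => s; exact: proj_set_ge0. Qed.

Lemma proj_hull_ge0 (E : Banach) (z : symtensor n E) : 0 <= proj_hull z.
Proof. by apply: lb_le_inf; [exact: proj_set_neq0|exact: proj_set_ge0]. Qed.

Lemma proj_hull_map_le (E F : Banach) (T : {linear E -> F}) (c : R) (z : symtensor n E) :
  0 <= c -> (forall x, rnorm (T x) <= c * rnorm x) ->
  proj_hull (symtensor_map T z) <= c ^+ n * proj_hull z.
Proof.
move=> c0 Tc.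
have step r : proj_set z r -> proj_hull (symtensor_map T z) <= c ^+ n * r.
  move=> [G [y [w [y1 <- ->]]]]; pose y' g := (sofR k c)^-1 *: T (y g).
  have y'E g : T (y g) = sofR k c *: y' g.
    rewrite /y' scalerA; have [c00|cn0] := eqVneq c 0; last first.
      by rewrite mulfV ?scale1r// -(sofR0 R k) (inj_eq (@sofR_inj R k)).
    have -> : T (y g) = 0; last by rewrite scaler0.
    apply: rnorm0_eq0; apply/eqP; rewrite eq_le rnorm_ge0 andbT.
    by have := Tc (y g); rewrite c00 mul0r.
  (* The vectors have to stay in the unit ball, so the factor [c] moves to the tensor as [c ^ n]. *)
  apply: proj_hull_le; exists G, y', (sofR k c ^+ n *: w); split.
  - move=> g; rewrite rnormZ rnormV rnorm_sofR//.
    have [->|cn0] := eqVneq c 0; first by rewrite invr0 mul0r ler01.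
    rewrite ler_pdivrMl ?mulr1 ?lt_def ?cn0// (le_trans (Tc _))//.
    by rewrite ler_piMr.
  - rewrite linearZ /= (@symtensor_map_comp _ _ _ _ _ _ _ (T \o lincomb y))//.
    apply/esym/symtensor_map_scale => x /=.
    rewrite /lincomb linear_sum scaler_sumr; apply: eq_bigr => g _.
    by rewrite linearZ /= y'E scalerA mulrC -scalerA.
  - by rewrite (stn_seminorm beta_stn _).2 rnormX rnorm_sofR.
(* For [c = 0] one cannot divide by [c ^ n], but any representative already gives the bound 0
   because [n > 0]. *)
have [c00|cn0] := eqVneq c 0.
  have [r zr] := proj_set_neq0 z; have := step r zr.
  by rewrite c00 expr0n gtn_eqF// !mul0r.
rewrite -ler_pdivrMl ?exprn_gt0 ?lt_def ?cn0//.
apply: lb_le_inf => [|r zr]; first exact: proj_set_neq0.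
by rewrite ler_pdivrMl ?exprn_gt0 ?lt_def ?cn0// step.
Qed.

(** The identity of [l_1^G] is an admissible contraction; with [proj_hull_ge], the hull agrees with
    [beta] on these spaces. *)
Lemma proj_hull_ell (G : finType) (w : symtensor n (ell1 G)) :
  @proj_hull (ell1 G) w <= @beta (ell1 G) w.
Proof.
apply: proj_hull_le; exists G, (@ell_delta R k EllOne G), w; split=> //.
  exact: rnorm_ell_delta.
by apply: symtensor_map_id; exact: lincomb_id.
Qed.

Lemma proj_hull_ge : tensor_norm_le beta proj_hull.
Proof.
move=> E z; apply: lb_le_inf; first exact: proj_set_neq0.
move=> _ [G [y [w [y1 <- ->]]]]; rewrite -[leRHS]mul1r -(expr1n _ n).
by apply: stn_map_le => // x; exact: lincomb_le.
Qed.

(** Two representatives over [G] and [H] are moved by contractions to the space over the disjoint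
    sum [G + H], where they can be added. *)
Lemma proj_hullD (E : Banach) (u v : symtensor n E) :
  proj_hull (u + v) <= proj_hull u + proj_hull v.
Proof.
apply/ler_addgt0Pr => e e0; have e20 : 0 < e / 2 by rewrite divr_gt0.
have [_ [G [y [w [y1 <- ->]]]] wu] := inf_approx (proj_set_neq0 u) e20.
have [_ [H [x [t [x1 <- ->]]]] tv] := inf_approx (proj_set_neq0 v) e20.
rewrite -/(proj_hull _) in wu; rewrite -/(proj_hull _) in tv.
pose S : finType := (G + H)%type.
pose yx (s : S) := match s with inl g => y g | inr h => x h end.
pose i1 := lincomb (b := EllOne) (fun g : G => ell_delta R k EllOne (inl g : S)).
pose i2 := lincomb (b := EllOne) (fun h : H => ell_delta R k EllOne (inr h : S)).
have le1 (L : finType) (f : L -> ell1 S) (q : symtensor n (ell1 L)) :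
    (forall l, rnorm (f l) <= 1) ->
    @beta (ell1 S) (symtensor_map (lincomb f) q) <= @beta (ell1 L) q.
  move=> f1; rewrite -[leRHS]mul1r -(expr1n _ n).
  by apply: stn_map_le => // l; exact: lincomb_le.
have comp (L : finType) (f : L -> S) (q : symtensor n (ell1 L)) :
    symtensor_map (lincomb yx) (symtensor_map
      (lincomb (b := EllOne) (fun l => ell_delta R k EllOne (f l))) q) =
    symtensor_map (lincomb (yx \o f)) q.
  apply: symtensor_map_comp => l; rewrite [in LHS]/lincomb linear_sum.
  by apply: eq_bigr => m _; rewrite linearZ /= lincomb_delta.
apply: (@le_trans _ _ (@beta (ell1 S) (symtensor_map i1 w + symtensor_map i2 t))).
  apply: proj_hull_le; exists S, yx, (symtensor_map i1 w + symtensor_map i2 t); split=> //.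
    by case.
  by rewrite linearD; congr (_ + _); exact: comp.
have b1 : @beta (ell1 S) (symtensor_map i1 w) <= @beta (ell1 G) w.
  by apply: le1 => g; exact: rnorm_ell_delta.
have b2 : @beta (ell1 S) (symtensor_map i2 t) <= @beta (ell1 H) t.
  by apply: le1 => g; exact: rnorm_ell_delta.
apply: le_trans ((stn_seminorm beta_stn (ell1 S)).1 _ _) _.
apply: le_trans (lerD b1 b2) _.
by rewrite [e in leRHS](splitr e) addrACA ltW// ltrD.
Qed.

Lemma proj_hullZ (E : Banach) (a : K) (u : symtensor n E) :
  proj_hull (a *: u) = rnorm a * proj_hull u.
Proof.
apply: seminorm_exact => [v|{}a v]; first exact: proj_hull_ge0.
have [->|a0] := eqVneq a 0.
  rewrite scale0r rnorm0 mul0r; have [r zr r0] := proj_set_sum ([::] : seq (K * E)).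
  by rewrite !big_nil in zr r0 *; exact: le_trans (proj_hull_le zr) r0.
rewrite -ler_pdivrMl ?rnorm_gt0//; apply: lb_le_inf; first exact: proj_set_neq0.
move=> _ [G [y [w [y1 <- ->]]]]; rewrite ler_pdivrMl ?rnorm_gt0//.
apply: proj_hull_le; exists G, y, (a *: w); split=> //; first by rewrite linearZ.
by rewrite (stn_seminorm beta_stn _).2.
Qed.

(** The lifting property of [l_1^G]: for every [d > 1] each vector of the unit ball of [F] lifts
    along [Q] to norm at most [d], so a contraction from [l_1^G] to [F] lifts to [E] with norm at
    most [d]. Then [d] tends to 1. *)
Lemma proj_hull_projective : projective_tensor_norm proj_hull.
Proof.
move=> E F Q [Qsurj Qnorm].
have Q1 x : rnorm (Q x) <= 1 * rnorm x.
  rewrite mul1r Qnorm; apply: (@inf_le _ _ 0); last by exists x.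
  by move=> _ [y _ <-]; exact: rnorm_ge0.
have lift (d : R) (y : F) : 1 < d -> rnorm y <= 1 -> exists x : E, Q x = y /\ rnorm x <= d.
  move=> d1 y1; have [x0 x0y] := Qsurj y.
  have [||_ [x /= Qx <-] xd] := @inf_approx _
      [set rnorm x | x in [set x | Q x = y]] (d - 1).
  - by exists (rnorm x0), x0.
  - by rewrite subr_gt0.
  by exists x; split=> //; rewrite -Qnorm in xd; lra.
split=> [v|v].
  have [s ->] := symtensorP v.
  have [h hP] := choice Qsurj.
  exists (\sum_(c <- [seq (c.1, h c.2) | c <- s]) c.1 *: tpower n c.2).
  by rewrite symtensor_map_sum big_map; apply: eq_bigr => c _; rewrite hP.
have setP (u : symtensor n E) : symtensor_map Q u = v -> proj_hull v <= proj_hull u.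
  move=> <-; rewrite -[leRHS]mul1r -(expr1n _ n); exact: proj_hull_map_le.
apply/eqP; rewrite eq_le; apply/andP; split.
  apply: lb_le_inf; last by move=> _ [u /= /setP uv <-].
  have [s ->] := symtensorP v; have [h hP] := choice Qsurj.
  pose t := [seq (c.1, h c.2) | c <- s].
  exists (proj_hull (\sum_(c <- t) c.1 *: tpower n c.2)).
  exists (\sum_(c <- t) c.1 *: tpower n c.2) => //=.
  by rewrite symtensor_map_sum big_map; apply: eq_bigr => c _; rewrite hP.
apply: lb_le_inf => [|_ [G [y [w [y1 wv ->]]]]]; first exact: proj_set_neq0.
rewrite -[leRHS]mulr1 -(expr1n _ n); apply: ler_limit_exp => d d1.
have [x xP] := choice (fun g => lift d (y g) d1 (y1 g)).
apply: (@le_trans _ _ (proj_hull (symtensor_map (lincomb x) w))).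
  apply: (@inf_le _ _ 0); first by move=> _ [u _ <-]; exact: proj_hull_ge0.
  exists (symtensor_map (lincomb x) w) => //=; rewrite -wv.
  apply: symtensor_map_comp => a; rewrite [in LHS]/lincomb linear_sum.
  by apply: eq_bigr => g _; rewrite linearZ /= (xP g).1.
have d0 : 0 <= d by rewrite ltW// (lt_trans ltr01).
apply: (@le_trans _ _ (d ^+ n * @proj_hull (ell1 G) w)).
  apply: proj_hull_map_le => // a; apply: lincomb_le => g; exact: (xP g).2.
by rewrite mulrC ler_wpM2r ?exprn_ge0// proj_hull_ell.
Qed.

Lemma proj_hull_stn : s_tensor_norm proj_hull.
Proof.
split.
- move=> E; split=> [u v|a u|u u0]; [exact: proj_hullD|exact: proj_hullZ|].
  have [_ _ n0] := stn_norm beta_stn E; apply: n0; apply/eqP.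
  by rewrite eq_le stn_ge0// -u0 proj_hull_ge.
- by move=> E z; exact: le_trans (stn_ge_inj beta_stn z) (proj_hull_ge z).
- move=> E z; apply: lb_le_inf.
    have [s zs] := symtensorP z.
    by exists (\sum_(c <- s) rnorm c.1 * rnorm c.2 ^+ n), s.
  move=> _ [s /= -> <-]; have [r zr rle] := proj_set_sum s.
  exact: le_trans (proj_hull_le zr) rle.
- move=> E F T cT z; apply: proj_hull_map_le; first exact: opnorm_ge0.
  by move=> x; exact: opnormP.
move=> E z; apply/eqP; rewrite eq_le; apply/andP; split.
  apply: lb_le_inf => [|r [M [I [w [_ Iiso <- ->]]]]]; last first.
    rewrite -[leRHS]mul1r -(expr1n _ n); apply: proj_hull_map_le => // x.
    by rewrite Iiso mul1r.
  have [_ [G [y [w [_ wz _]]]]] := proj_set_neq0 z.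
  have [M [I [fM Iiso Isurj]]] := finite_dim_subspace [seq y g | g <- enum G].
  have pre g : exists v, I v = y g by apply: Isurj; rewrite map_f ?mem_enum.
  have [h hP] := choice pre.
  exists (proj_hull (symtensor_map (lincomb h) w)), M, I, (symtensor_map (lincomb h) w).
  split=> //; rewrite -wz; apply: symtensor_map_comp => a.
  rewrite [in LHS]/lincomb linear_sum.
  by apply: eq_bigr => g _; rewrite linearZ /= hP.
apply: lb_le_inf => [|_ [G [y [w [y1 wz ->]]]]]; first exact: proj_set_neq0.
(* The vectors [y g] lie in a finite-dimensional subspace, through which the contraction factors;
   the same [w] therefore bounds the hull over that subspace. *)
have [M [I [fM Iiso Isurj]]] := finite_dim_subspace [seq y g | g <- enum G].
have pre g : exists v, I v = y g by apply: Isurj; rewrite map_f ?mem_enum.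
have [h hP] := choice pre.
apply: (@le_trans _ _ (proj_hull (symtensor_map (lincomb h) w))).
  apply: (@inf_le _ _ 0); first by move=> _ [N [J [v [_ _ _ ->]]]]; exact: proj_hull_ge0.
  exists M, I, (symtensor_map (lincomb h) w); split=> //.
  rewrite -wz; apply: symtensor_map_comp => a; rewrite [in LHS]/lincomb linear_sum.
  by apply: eq_bigr => g _; rewrite linearZ /= hP.
apply: proj_hull_le; exists G, h, w; split=> // g.
by have := Iiso (h g); rewrite hP => <-.
Qed.

End projective_hull.

(** * Local reflexivity *)

Section local_reflexivity.
Variables (R : realType) (k : scalar_kind) (F : normedModType (scalar_field R k)).
Local Notation K := (scalar_field R k).

Lemma dual_attain (f : dual_space F) (e : R) : 0 < e ->
  exists2 x, rnorm x <= 1 & rnorm f - e < rnorm (f x).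
Proof.
move=> e0; have hs := opnorm_has_sup (@dual_continuous _ _ _ f).
have [_ [x x1 <-] xe] := sup_adherent e0 hs.
by exists x => //; rewrite rnorm_dual.
Qed.

Section weighted_max.
Variables (L : finType) (sigma : L -> R).
Hypothesis sigma_gt0 : forall l, 0 < sigma l.

(** The gauge of the product of the balls of radius [sigma l]: being at most 1 expresses all the
    constraints of [local_reflexivity] at once. *)
Definition weighted_max (u : L -> F) : R := \big[Num.max/0]_l (rnorm (u l) / sigma l).

Lemma weighted_max_ge0 u : 0 <= weighted_max u.
Proof. exact: bigmax_ge_id. Qed.

Lemma weighted_max_ge u l : rnorm (u l) <= sigma l * weighted_max u.
Proof. by rewrite -ler_pdivrMl// mulrC; exact: le_bigmax. Qed.

Lemma weighted_max_le u c : 0 <= c -> (forall l, rnorm (u l) <= sigma l * c) ->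
  weighted_max u <= c.
Proof.
by move=> c0 uc; apply: bigmax_le => // l _; rewrite ler_pdivrMr// mulrC.
Qed.

Lemma weighted_max_seminorm : seminorm (weighted_max : (L -> F) -> R).
Proof.
split=> [u v|].
  apply: weighted_max_le => [|l]; first by rewrite addr_ge0 ?weighted_max_ge0.
  by rewrite mulrDr (le_trans (ler_rnormD _ _))// lerD ?weighted_max_ge.
apply: seminorm_exact => [u|a u]; first exact: weighted_max_ge0.
apply: weighted_max_le => [|l].
  by rewrite mulr_ge0 ?rnorm_ge0 ?weighted_max_ge0.
by rewrite rnormZ mulrCA ler_wpM2l ?rnorm_ge0 ?weighted_max_ge.
Qed.

End weighted_max.

Lemma seminorm_quotient (U V : lmodType K) (A : {linear U -> V}) (N : V -> R) :
  seminorm N -> seminorm (fun v => inf [set N (v - A u) | u in setT]).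
Proof.
move=> sN; set p := (fun v => inf _).
have lb v y : [set N (v - A u) | u in setT] y -> 0 <= y.
  by move=> [u _ <-]; exact: seminorm_ge0.
have ne v : [set N (v - A u) | u in setT] !=set0 by exists (N (v - A 0)), 0.
have p_le v u : p v <= N (v - A u) by apply: (inf_le (lb v)); exists u.
split=> [v w|].
  apply/ler_addgt0Pr => e e0; have e20 : 0 < e / 2 by rewrite divr_gt0.
  have [_ [s _ <-] sv] := inf_approx (ne v) e20.
  have [_ [t _ <-] tw] := inf_approx (ne w) e20.
  apply: le_trans (p_le _ (s + t)) _; rewrite linearD opprD addrACA.
  apply: le_trans (sN.1 _ _) _; rewrite [e in leRHS](splitr e) addrACA.
  by rewrite ltW// ltrD.
apply: seminorm_exact => [v|a v]; first by apply: lb_le_inf => //; exact: lb.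
have [->|a0] := eqVneq a 0.
  rewrite scale0r rnorm0 mul0r; apply: le_trans (p_le _ 0) _.
  by rewrite linear0 subr0 seminorm0.
rewrite -ler_pdivrMl ?rnorm_gt0//; apply: lb_le_inf => // _ [u _ <-].
rewrite ler_pdivrMl ?rnorm_gt0//; apply: le_trans (p_le _ (a *: u)) _.
by rewrite linearZ -scalerBr sN.2.
Qed.

(* If no such [v] exists, a functional [(h_l)] on [F^L] with
   [\sum_l (rho l + d) |h_l| <= 1] vanishes on the range of [v |-> (\sum_j a l j v_j)_l]
   and takes a value [>= 1] at [y]; pairing it with the [s j] gives
   [1 <= \sum_l rho l |h_l|], a contradiction. *)
Lemma local_reflexivity (L M : finType) (a : L -> M -> K) (y : L -> F) (rho : L -> R)
    (s : M -> dual_space (dual_space F)) (d : R) : 0 < d ->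
  (forall l, rnorm (\sum_j a l j *: s j - bidual_map (y l)) <= rho l) ->
  exists v : M -> F, forall l, rnorm (\sum_j a l j *: v j - y l) <= rho l + d.
Proof.
move=> d0 srho; pose sigma l := rho l + d.
have sigma0 l : 0 < sigma l.
  by rewrite ltr_wpDl// (le_trans _ (srho l))// rnorm_ge0.
pose A (v : M -> F) : L -> F := fun l => \sum_j a l j *: v j.
have lA : linear A.
  move=> c u v; apply/funext => l; rewrite /A !fctE scaler_sumr -big_split.
  by apply: eq_bigr => j _; rewrite scalerDr !scalerA mulrC.
pose AL : {linear (M -> F) -> (L -> F)} :=
  HB.pack A (GRing.isLinear.Build K (M -> F) (L -> F) *:%R A lA).
have sN := weighted_max_seminorm sigma0.
have sp := seminorm_quotient AL sN.
set p := (fun v => inf _) in sp.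
have p_le u v : p u <= weighted_max sigma (u - A v).
  apply: (@inf_le _ _ 0); last by exists v.
  by move=> _ [w _ <-]; exact: weighted_max_ge0.
have [py|py] := ltrP (p y) 1.
  have [||_ [v _ <-] v1] := @inf_approx _ [set weighted_max sigma (y - AL u) | u in setT] (1 - p y).
  - by exists (weighted_max sigma (y - AL 0)), 0.
  - by rewrite subr_gt0.
  exists v => l; rewrite rnormB; apply: le_trans (weighted_max_ge sigma0 (y - A v) l) _.
  rewrite -/(sigma l) ler_piMr ?(ltW (sigma0 l))//.
  have {}v1 : weighted_max sigma (y - A v) < p y + (1 - p y) by exact: v1.
  by move: v1; rewrite [X in _ < X]addrC subrK => /ltW.
exfalso.
have [psi [psiy psip]] := norming_functional y sp.
have psiN u : rnorm (psi u) <= weighted_max sigma u.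
  apply: le_trans (psip u) _; have := p_le u 0.
  by rewrite (_ : A 0 = 0) ?subr0//; exact: linear0 AL.
have psiA v : psi (A v) = 0.
  apply: rnorm0_eq0; apply/eqP; rewrite eq_le rnorm_ge0 andbT.
  apply: le_trans (psip _) _; apply: le_trans (p_le _ v) _.
  by rewrite subrr (seminorm0 sN).
pose single l (x : F) : L -> F := fun l' => if l' == l then x else 0.
have lsingle l : linear (single l).
  move=> c u v; apply/funext => l'; rewrite /single !fctE.
  by case: eqP => // _; rewrite scaler0 addr0.
have sumsingle (u : L -> F) : \sum_l single l (u l) = u.
  apply/funext => l; rewrite fct_sumE (bigD1 l)//= /single eqxx big1 ?addr0// => l'.
  by rewrite eq_sym => /negPf ->.
have hE l : exists h : dual_space F, forall x, h x = psi (single l x).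
  have lh : scalar (fun x => psi (single l x)).
    by move=> c u v; rewrite lsingle linearP.
  pose hl : {linear F -> K} := HB.pack (fun x => psi (single l x))
    (GRing.isLinear.Build K F K *:%R _ lh).
  have [||f fE _] := @dual_of _ _ _ hl (sigma l)^-1.
  - by rewrite invr_ge0 ltW.
  - move=> x; apply: le_trans (psiN _) _; apply: weighted_max_le => //.
      by rewrite mulr_ge0 ?rnorm_ge0// invr_ge0 ltW.
    move=> l'; rewrite /single; case: eqP => [->|_].
      by rewrite mulrA mulfV ?mul1r// gt_eqF.
    by rewrite rnorm0 !mulr_ge0 ?rnorm_ge0 ?invr_ge0// ltW.
  by exists f.
have [h hP] := choice hE.
have psisum u : psi u = \sum_l h l (u l).
  by rewrite -[in LHS](sumsingle u) linear_sum; apply: eq_bigr => l _; rewrite hP.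
(* The dual norm of the weighted maximum is the weighted sum of the norms: [psi] is tested on
   vectors that nearly norm the [h l], turned by phases. A loss of [e / S] in each term adds up to
   at most [e]. *)
have hsum : \sum_l sigma l * rnorm (h l) <= 1.
  apply/ler_addgt0Pr => e e0.
  pose S := \sum_l sigma l + 1.
  have S0 : 0 < S by rewrite ltr_wpDl// sumr_ge0// => l _; exact: ltW.
  have e1 : 0 < e / S by rewrite divr_gt0.
  have xE l : exists x, rnorm x <= 1 /\ rnorm (h l) - e / S <= rnorm (h l x).
    by have [x x1 /ltW xe] := dual_attain (h l) e1; exists x.
  have [x xP] := choice xE.
  have [c cP] := choice (fun l => let: ex_intro2 c c1 cE := phase (h l (x l)) in
    ex_intro (fun c : K => rnorm c <= 1 /\ c * h l (x l) = sofR k (rnorm (h l (x l))))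
      c (conj c1 cE)).
  pose u l := (sofR k (sigma l) * c l) *: x l.
  have uE : psi u = sofR k (\sum_l sigma l * rnorm (h l (x l))).
    rewrite psisum (big_morph (@sofR R k) (@sofRD R k) (sofR0 R k)).
    by apply: eq_bigr => l _; rewrite sofRM -(cP l).2 mulrA; exact: linearZ.
  have u1 : weighted_max sigma u <= 1.
    apply: weighted_max_le => // l; rewrite mulr1 rnormZ rnormM rnorm_sofR ?(ltW (sigma0 l))//.
    rewrite -mulrA ler_piMr ?(ltW (sigma0 l))//.
    by rewrite mulr_ile1 ?rnorm_ge0 ?(cP l).1 ?(xP l).1.
  have : \sum_l sigma l * rnorm (h l (x l)) <= 1.
    have := le_trans (psiN u) u1; rewrite uE rnorm_sofR// sumr_ge0// => l _.
    by rewrite mulr_ge0 ?rnorm_ge0 ?(ltW (sigma0 l)).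
  move=> H1; rewrite -lerBlDr; apply: le_trans H1.
  have -> : \sum_l sigma l * rnorm (h l) - e =
      \sum_l sigma l * (rnorm (h l) - e / S) - e / S.
    under [in RHS]eq_bigr do rewrite mulrBr.
    rewrite sumrB -mulr_suml -addrA -opprD -{2}[e / S]mul1r -mulrDl -/S.
    by rewrite mulrCA mulfV ?gt_eqF// mulr1.
  rewrite lerBlDr ler_wpDr ?(ltW e1)//; apply: ler_sum => l _.
  by rewrite ler_wpM2l ?(ltW (sigma0 l))// (xP l).2.
have hA j : \sum_l a l j *: h l = 0.
  apply: dualP => x; have := psiA (fun i => if i == j then x else 0).
  rewrite psisum => H; apply: (etrans _ H).
  have sumE (t : seq L) : (\sum_(l <- t) a l j *: h l : dual_space F) x =
      \sum_(l <- t) a l j * h l x.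
    elim: t => [|l t IH]; first by rewrite !big_nil.
    by rewrite !big_cons -IH.
  rewrite [LHS]sumE; apply: eq_bigr => l _; rewrite /A (bigD1 j)//= eqxx big1.
    by rewrite addr0 linearZ.
  by move=> i /negPf ->; rewrite scaler0.
have bound : rnorm (psi y) <= \sum_l rho l * rnorm (h l).
  have sapp l : (\sum_j a l j *: s j : dual_space _) (h l) = \sum_j a l j * s j (h l).
    have sumE (t : seq M) : (\sum_(j <- t) a l j *: s j : dual_space _) (h l) =
        \sum_(j <- t) a l j * s j (h l).
      elim: t => [|j t IH]; first by rewrite !big_nil.
      by rewrite !big_cons -IH.
    exact: sumE.
  have -> : psi y = - \sum_l (\sum_j a l j *: s j - bidual_map (y l) : dual_space _) (h l).
    rewrite psisum -sumrN.
    transitivity (\sum_l h l (y l) - \sum_l \sum_j a l j * s j (h l)).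
      rewrite exchange_big /= (eq_bigr (fun j => s j (\sum_l a l j *: h l))).
        by rewrite [X in _ - X]big1 ?subr0// => j _; rewrite hA linear0.
      by move=> j _; rewrite linear_sum; apply: eq_bigr => l _; rewrite linearZ.
    by rewrite -sumrB; apply: eq_bigr => l _; rewrite -sapp -opprB.
  rewrite rnormN; apply: le_trans (ler_rnorm_sum _ _ _) _; apply: ler_sum => l _.
  by apply: le_trans (dual_le _ _) _; rewrite ler_wpM2r ?rnorm_ge0.
have {}bound : 1 <= \sum_l rho l * rnorm (h l).
  apply: le_trans bound; rewrite psiy rnorm_sofR//; exact: seminorm_ge0 sp y.
have : \sum_l sigma l * rnorm (h l) = \sum_l rho l * rnorm (h l) + d * \sum_l rnorm (h l).
  by rewrite mulr_sumr -big_split; apply: eq_bigr => l _; rewrite mulrDl.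
(* Since [sigma l = rho l + d], comparing [hsum] with [bound] leaves at most 0 for [d] times the sum
   of the norms; all [h l] then vanish, which [bound] forbids. *)
move=> E; have H0 : \sum_l rnorm (h l) = 0.
  apply/eqP; rewrite eq_le sumr_ge0 ?andbT; last by move=> l _; exact: rnorm_ge0.
  by rewrite -(pmulr_rle0 _ d0); rewrite E in hsum; lra.
have : \sum_l rho l * rnorm (h l) = 0.
  apply: big1 => l _; move/eqP: H0; rewrite psumr_eq0; last by move=> ? _; exact: rnorm_ge0.
  by move=> /allP/(_ l); rewrite mem_index_enum => /(_ isT)/eqP ->; rewrite mulr0.
by move=> E0; move: bound; rewrite E0 ler10.
Qed.

End local_reflexivity.

(** * Rounding of scalars, finite nets and lifting from the bidual *)

Section quantization.
Variables (R : realType) (k : scalar_kind).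
Local Notation K := (scalar_field R k).

(** Rounding toward 0 on the grid of mesh [1 / (N + 1)]. It never increases the modulus, so rounded
    vectors stay in the unit ball and rounded functions stay dominated. *)
Definition quant (N : nat) (t : R) : R :=
  Num.sg t * ((Num.truncn (`|t| * N.+1%:R))%:R / N.+1%:R).

Lemma quant0 N : quant N 0 = 0.
Proof. by rewrite /quant sgr0 mul0r. Qed.

Lemma norm_quant_le N t : `|quant N t| <= `|t|.
Proof.
have [->|t0] := eqVneq t 0; first by rewrite quant0.
rewrite /quant normrM normr_sg t0 mul1r ger0_norm ?divr_ge0//.
by rewrite ler_pdivrMr// truncn_le.
Qed.

Lemma quant_dist N t : `|t - quant N t| <= N.+1%:R^-1.
Proof.
rewrite {1}[t]numEsg /quant -mulrBr normrM normr_sg.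
apply: (@le_trans _ _ `| `|t| - (Num.truncn (`|t| * N.+1%:R))%:R / N.+1%:R|).
  by rewrite ler_piMl// lern1; case: eqP.
have a0 : 0 <= `|t| * N.+1%:R by rewrite mulr_ge0.
rewrite ger0_norm ?subr_ge0 ?ler_pdivrMr ?truncn_le//.
rewrite lerBlDr -{1}[N.+1%:R^-1]mul1r -mulrDl ler_pdivlMr//.
by rewrite nat1r ltW// truncnS_gt.
Qed.

Definition squant (N : nat) (z : K) : K := smk k (quant N (sRe z)) (quant N (sIm z)).

Lemma sRe_squant N z : sRe (squant N z) = quant N (sRe z).
Proof. exact: sRe_mk. Qed.

Lemma sIm_squant N z : sIm (squant N z) = quant N (sIm z).
Proof. by apply: sIm_mk; exact: quant0. Qed.

Lemma rnorm_squant_le N z : rnorm (squant N z) <= rnorm z.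
Proof.
rewrite /rnorm !sRe_norm sRe_squant sIm_squant ler_wsqrtr//.
by rewrite lerD// -ler_sqrt ?sqr_ge0// !sqrtr_sqr norm_quant_le.
Qed.

Lemma squant_dist N z : rnorm (z - squant N z) <= 2 / N.+1%:R.
Proof.
apply: le_trans (rnorm_leD _) _; rewrite sReD sImD sReN sImN sRe_squant sIm_squant.
rewrite mulrDl mul1r; apply: lerD; exact: quant_dist.
Qed.

Definition quant_values (N M : nat) : seq R :=
  [seq e * (i%:R / N.+1%:R) | e <- [:: 0; 1; -1], i <- iota 0 M.+1].

Lemma quant_valuesP N M t : `|t| * N.+1%:R < M.+1%:R -> quant N t \in quant_values N M.
Proof.
move=> tM; apply/allpairsPdep.
exists (Num.sg t), (Num.truncn (`|t| * N.+1%:R)); split=> //.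
  by case: (sgrP t) => _; rewrite !inE eqxx ?orbT.
rewrite mem_iota/= add0n -(@ltr_nat R); apply: le_lt_trans tM.
by rewrite truncn_le mulr_ge0.
Qed.

Definition squant_values (N M : nat) : seq K :=
  [seq smk k a b | a <- quant_values N M, b <- quant_values N M].

Lemma squant_valuesP N M (z : K) : rnorm z * N.+1%:R < M.+1%:R ->
  squant N z \in squant_values N M.
Proof.
move=> zM; apply/allpairsPdep.
exists (quant N (sRe z)), (quant N (sIm z)).
split=> //; apply: quant_valuesP; apply: le_lt_trans zM.
  by rewrite ler_wpM2r// sRe_le_rnorm.
by rewrite ler_wpM2r// sIm_le_rnorm.
Qed.

End quantization.

Section ell_net.
Variables (R : realType) (k : scalar_kind) (b : ell_kind) (G : finType).
Local Notation K := (scalar_field R k).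

Lemma ell_net (e : R) : 0 < e -> exists s : seq (ell R k b G),
  (forall x, x \in s -> rnorm x <= 1) /\
  forall x, rnorm x <= 1 -> exists2 y, y \in s & rnorm (x - y) <= e.
Proof.
move=> e0; pose N := Num.truncn (2 * #|G|%:R / e).
pose V := squant_values R k N N.+1.
pose s0 := [seq ell_of b (fun g => nth 0 V (phi g)) | phi : {ffun G -> 'I_(size V)}].
exists [seq x <- s0 | rnorm x <= 1]; split=> [x|x x1].
  by rewrite mem_filter => /andP[].
pose y := ell_of b (fun g => squant N (x g)).
have y1 : rnorm y <= 1.
  apply: le_trans x1; apply: rnorm_ell_le => t tt.
  apply: le_trans (rnorm_ell_ge x tt); apply: ler_sum => g _.
  by rewrite ell_ofE rnorm_squant_le.
exists y.
  rewrite mem_filter y1 /=.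
  have gV g : squant N (x g) \in V.
    apply: squant_valuesP; rewrite -[ltRHS]mul1r.
    apply: (@le_lt_trans _ _ (1 * N.+1%:R)); last by rewrite !mul1r ltr_nat.
    by rewrite ler_wpM2r// (le_trans (ell_coord_le _ _)).
  have iV g : (index (squant N (x g)) V < size V)%N by rewrite index_mem.
  have -> : y = ell_of b (fun g => nth 0 V ([ffun g => Ordinal (iV g)] g)).
    by apply: ellP => g; rewrite !ell_ofE ffunE /= nth_index.
  by apply/mapP; exists [ffun g => Ordinal (iV g)]; rewrite ?mem_enum.
apply: rnorm_ell_le => t tt.
have tG : (size t <= #|G|)%N.
  rewrite cardE; apply: uniq_leq_size; first exact: ell_test_uniq tt.
  by move=> g _; rewrite mem_enum.
apply: (@le_trans _ _ (\sum_(g <- t) 2 / N.+1%:R)).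
  apply: ler_sum => g _; have -> : (x - y) g = x g - y g by [].
  by rewrite ell_ofE squant_dist.
rewrite big_const_seq count_predT iter_addr_0 -[_ *+ size t]mulr_natr mulrAC ler_pdivrMr//.
apply: (@le_trans _ _ (2 * #|G|%:R)); first by rewrite ler_wpM2l// ler_nat.
by rewrite -ler_pdivrMl// mulrC ltW// truncnS_gt.
Qed.

Lemma lincomb_bounded (E : normedModType K) (y : G -> E) : exists2 M, 0 <= M &
  forall x : ell R k b G, rnorm (lincomb y x) <= M * rnorm x.
Proof.
exists (\sum_g rnorm (y g)); first by apply: sumr_ge0 => g _; exact: rnorm_ge0.
move=> x; rewrite mulr_suml; apply: le_trans (ler_rnorm_sum _ _ _) _.
apply: ler_sum => g _; rewrite rnormZ mulrC ler_wpM2l ?rnorm_ge0//.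
exact: ell_coord_le.
Qed.

(* Finite-dimensional lifting from the bidual: local reflexivity applied to a net
   of the unit ball of [ell b G] (for the norm bound) and to the pairs in [ps]. *)
Lemma ell_lift (F : normedModType K) (s : {linear ell R k b G -> dual_space (dual_space F)})
    (ps : seq (ell R k b G * F)) (c c' eta d : R) : 0 <= c -> c < c' -> 0 < d ->
  (forall x, rnorm (s x) <= c * rnorm x) ->
  (forall q, q \in ps -> rnorm (s q.1 - bidual_map q.2) <= eta) ->
  exists v : G -> F, (forall x : ell R k b G, rnorm (lincomb v x) <= c' * rnorm x) /\
    (forall q, q \in ps -> rnorm (lincomb v q.1 - q.2) <= eta + d).
Proof.
move=> c0 cc' d0 sc sps.
have c'0 : 0 < c' by exact: le_lt_trans cc'.
(* Chosen so that [th c' = (c' - c) / 2]. With [e <= (c' - c) / 2], the net estimate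
   [t <= c + e + t th] for the operator norm [t] becomes [t (1 - th) <= c' (1 - th)], hence
   [t <= c']. *)
pose th := (c' - c) / (2 * c').
have th0 : 0 < th by rewrite divr_gt0 ?subr_gt0 ?mulr_gt0.
have [net [net1 netP]] := ell_net th0.
(* Two kinds of constraints: the net points, with target 0 and radius [c], control the norm of the
   lifted map; the pairs, with radius [eta], control its values. *)
pose L : finType := ('I_(size net) + 'I_(size ps))%type.
pose pt (l : L) : ell R k b G := match l with
  | inl i => tnth (in_tuple net) i | inr i => (tnth (in_tuple ps) i).1 end.
pose y (l : L) : F := match l with inl i => 0 | inr i => (tnth (in_tuple ps) i).2 end.
pose rho (l : L) := match l with inl _ => c | inr _ => eta end.
pose e := Num.min d ((c' - c) / 2).
have e0 : 0 < e by rewrite lt_min d0 divr_gt0 ?subr_gt0.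
have [|v vP] := @local_reflexivity R k F L G (fun l g => pt l g) y rho
    (fun g => s (ell_delta R k b g)) e e0.
  move=> l; have -> : \sum_j pt l j *: s (ell_delta R k b j) = s (pt l).
    by rewrite [RHS]lincomb_ext.
  case: l => i; last by apply: sps; exact: mem_tnth.
  have -> : bidual_map (0 : F) = 0.
    by apply: dualP => f; rewrite /= linear0.
  rewrite subr0 (le_trans (sc _))// ler_piMr//; apply: net1; exact: mem_tnth.
exists v; split=> [x|q /(tnthP (in_tuple ps))[i ->]]; last first.
  apply: le_trans (vP (inr i)) _; rewrite lerD2l ge_min lexx//.
have vnet u : u \in net -> rnorm (lincomb v u) <= c + e.
  move=> /(tnthP (in_tuple net))[i ->].
  by have := vP (inl i); rewrite subr0.
have [M M0 vM] := lincomb_bounded v.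
have cv := rnorm_bounded vM.
suff op : opnorm (lincomb v (b := b)) <= c'.
  by apply: le_trans (opnormP _ cv) _; rewrite ler_wpM2r ?rnorm_ge0.
have : opnorm (lincomb v (b := b)) <= c + e + opnorm (lincomb v (b := b)) * th.
  apply: opnorm_le => u u1; have [w wnet uw] := netP u u1.
  apply: (@le_trans _ _ (rnorm (lincomb v w + lincomb v (u - w)))).
    by rewrite -linearD addrC subrK.
  apply: le_trans (ler_rnormD _ _) _; apply: lerD; first exact: vnet.
  by apply: le_trans (opnormP _ cv) _; rewrite ler_wpM2l ?opnorm_ge0.
set t := opnorm _ => tle.
have e1 : e <= (c' - c) / 2 by rewrite ge_min lexx orbT.
have th1 : th * c' = (c' - c) / 2.
  by rewrite /th invfM mulrA mulfVK ?gt_eqF.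
have th2 : th <= 1 / 2.
  by rewrite -(ler_pM2r c'0) th1; lra.
have : t * (1 - th) <= c' * (1 - th).
  rewrite !mulrBr !mulr1 [c' * th]mulrC th1; lra.
by rewrite ler_pM2r// subr_gt0; lra.
Qed.

End ell_net.

(** * Approximation in L_1 and L_infty *)

Section Lpspace_theory.
Context d (T : measurableType d) (R : realType) (k : scalar_kind).
Local Notation K := (scalar_field R k).
Variables (mu : {measure set T -> \bar R}) (p : \bar R) (p1 : (1 <= p)%E).
Local Notation Lfct := (Lfct k mu p1).
Local Notation X := (Lpspace k mu p1).

Lemma Lclass_scale (a : K) (f : Lfct) : Lclass (a *: f) = a *: Lclass f.
Proof. exact: LclassZ. Qed.

Lemma Lclass_is_linear : linear (@Lclass d T R k mu p p1).
Proof. by move=> a f g; rewrite LclassD Lclass_scale. Qed.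

HB.instance Definition _ := GRing.isLinear.Build K Lfct X *:%R (@Lclass d T R k mu p p1)
  Lclass_is_linear.

Lemma Lclass_le_ae (f g : Lfct) : {ae mu, forall x, rnorm (f x) <= rnorm (g x)} ->
  rnorm (Lclass f) <= rnorm (Lclass g).
Proof.
move=> fg; rewrite !rnorm_Lspace -lee_fin !sLnorm_fin; apply: le_Lnorm_ae => //.
- by apply: smeasurable_rnorm; have [] := LfctP f.
- by apply: smeasurable_rnorm; have [] := LfctP g.
by apply: filterS fg => x fgx; rewrite !ger0_norm ?rnorm_ge0.
Qed.

Lemma Lfct_dominated (f : T -> K) (g : Lfct) : smeasurable f ->
  (forall x, rnorm (f x) <= rnorm (g x)) -> exists F : Lfct, (F : T -> K) = f.
Proof.
move=> mf fg; have [mg ging] := LfctP g.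
have fin : f \in @Lfct_pred d T R k mu p p1.
  rewrite inE; split=> //; apply: le_lt_trans ging; apply: le_Lnorm_ae => //.
  - exact: smeasurable_rnorm.
  - exact: smeasurable_rnorm.
  by apply/nearW => x; rewrite !ger0_norm ?rnorm_ge0.
by exists (MkLfct fin).
Qed.

Section restriction.
Variables (A : set T) (mA : measurable A).

Lemma smeasurable_restrict (f : T -> K) : smeasurable f ->
  smeasurable (fun x => if x \in A then f x else 0).
Proof.
move=> [mr mi]; have m1 : measurable_fun setT (\1_A : T -> R) by exact: measurable_indic.
have s0 : sRe (0 : K) = 0 /\ sIm (0 : K) = 0.
  by rewrite -(sofR0 R k) sofRK; split=> //; case: k.
split.
  rewrite (_ : _ \o _ = (@sRe R k \o f) \* \1_A); first exact: measurable_funM.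
  apply/funext => x /=; rewrite indicE.
  by case: (x \in A); rewrite ?mulr1// mulr0 s0.1.
rewrite (_ : _ \o _ = (@sIm R k \o f) \* \1_A); first exact: measurable_funM.
apply/funext => x /=; rewrite indicE.
by case: (x \in A); rewrite ?mulr1// mulr0 s0.2.
Qed.

Lemma Lfct_restrict_subproof (f : Lfct) :
  (fun x => if x \in A then f x else 0) \in @Lfct_pred d T R k mu p p1.
Proof.
have [mf _] := LfctP f.
have [|F <-] := @Lfct_dominated _ f (smeasurable_restrict mf); last exact: valP.
by move=> x; case: ifP => // _; rewrite rnorm0 rnorm_ge0.
Qed.

Definition Lfct_restrict (f : Lfct) : Lfct := MkLfct (Lfct_restrict_subproof f).

Definition Lclass_restrict (u : X) : X := Lclass (Lfct_restrict (Lrepr u)).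

Lemma Lclass_restrictE (f : Lfct) : Lclass_restrict (Lclass f) = Lclass (Lfct_restrict f).
Proof.
by apply/LclassP; apply: filterS (Lrepr_ae f) => x fx; rewrite /= fx.
Qed.

Lemma Lclass_restrict_is_linear : linear Lclass_restrict.
Proof.
move=> a u v; rewrite -[u]LreprK -[v]LreprK -linearP !Lclass_restrictE -linearP.
congr Lclass; apply: val_inj; apply/funext => x /=; rewrite !fctE /=.
by case: ifP => // _; rewrite scaler0 addr0.
Qed.

HB.instance Definition _ := GRing.isLinear.Build K X X *:%R Lclass_restrict
  Lclass_restrict_is_linear.

Lemma Lclass_restrict_le u : rnorm (Lclass_restrict u) <= rnorm u.
Proof.
rewrite -[u]LreprK Lclass_restrictE; apply: Lclass_le_ae; apply/nearW => x /=.
by case: ifP => // _; rewrite rnorm0 rnorm_ge0.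
Qed.

End restriction.
End Lpspace_theory.

Definition ell_exp (R : realType) (b : ell_kind) : \bar R :=
  match b with EllOne => 1%E | EllInfty => +oo%E end.

(** The proofs are those inside [factorable_one] and [factorable_infty], so that both are instances
    of [factorable k (ell_exp_ge1 R b)] by conversion and one argument serves both. *)
Definition ell_exp_ge1 (R : realType) (b : ell_kind) : (1 <= ell_exp R b)%E :=
  match b with EllOne => lexx 1%E | EllInfty => leey 1 end.

Section L1_Linfty.
Context d (T : measurableType d) (R : realType) (k : scalar_kind).
Local Notation K := (scalar_field R k).
Variables (mu : {measure set T -> \bar R}).

Lemma L1_norm (f : Lfct k mu (ell_exp_ge1 R EllOne)) :
  ((rnorm (Lclass f))%:E = \int[mu]_x (rnorm (f x))%:E)%E.
Proof.
rewrite rnorm_Lspace sLnorm_fin /sLnorm Lnorm1; apply: eq_integral => x _ /=.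
by rewrite ger0_norm ?rnorm_ge0.
Qed.

Lemma Linfty_ae (f : Lfct k mu (ell_exp_ge1 R EllInfty)) :
  {ae mu, forall x, rnorm (f x) <= rnorm (Lclass f)}.
Proof.
(* When the whole space is null the [L_infty] norm is 0 by convention and not an essential supremum,
   but then every property holds almost everywhere. *)
have [mu0|] := ltP 0%E (mu setT); last first.
  move=> mu0; exists setT; split=> //; apply/eqP.
  by rewrite eq_le mu0 measure_ge0.
have := ess_sup_ge mu (abse \o (EFin \o (fun x => rnorm (f x)))).
apply: filterS => x /=; rewrite ger0_norm ?rnorm_ge0//.
suff <- : (rnorm (Lclass f))%:E = ess_sup mu (abse \o (EFin \o (fun x => rnorm (f x)))).
  by rewrite lee_fin.
by rewrite rnorm_Lspace sLnorm_fin /sLnorm unlock /= mu0.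
Qed.

Lemma Linfty_le (f : Lfct k mu (ell_exp_ge1 R EllInfty)) (M : R) : 0 <= M ->
  {ae mu, forall x, rnorm (f x) <= M} -> rnorm (Lclass f) <= M.
Proof.
move=> M0 fM; rewrite rnorm_Lspace -lee_fin sLnorm_fin /sLnorm unlock /=.
case: ifP => _; last by rewrite lee_fin.
by apply/ess_supP; apply: filterS fM => x fx /=; rewrite lee_fin ger0_norm ?rnorm_ge0.
Qed.

End L1_Linfty.

(** * Projection onto functions constant on the cells of a finite partition *)

Section cells.
Context d (T : measurableType d) (R : realType) (k : scalar_kind) (b : ell_kind).
Local Notation K := (scalar_field R k).
Variables (mu : {measure set T -> \bar R}).
Local Notation Lfct := (Lfct k mu (ell_exp_ge1 R b)).
Local Notation X := (Lpspace k mu (ell_exp_ge1 R b)).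
Variables (G : finType) (g : T -> G).
Hypothesis mg : forall h, measurable [set x | g x = h].

Definition cell_restrict h : X -> X := Lclass_restrict (mg h).

HB.instance Definition _ h := GRing.Linear.on (cell_restrict h).

(** For [l_1] this is additivity of the integral over disjoint cells; for [l_infty] a test family
    has at most one cell, and restriction is a contraction. *)
Lemma cell_restrict_sum (s : seq G) (u : X) : ell_test b s ->
  \sum_(h <- s) rnorm (cell_restrict h u) <= rnorm u.
Proof.
move: u; rewrite /cell_restrict; move: mg => mgg.
case: b s => [] s u st; last first.
  by case: s st => [|h [|//]] _; rewrite ?big_nil ?rnorm_ge0// big_seq1 Lclass_restrict_le.
rewrite -[u]LreprK; move: (Lrepr u) => f {u}.
under eq_bigr do rewrite Lclass_restrictE.
rewrite -lee_fin -sumEFin; under eq_bigr do rewrite L1_norm.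
rewrite L1_norm.
have mE (F : Defs.Lfct k mu (ell_exp_ge1 R EllOne)) :
    measurable_fun setT (fun x => (rnorm (F x))%:E).
  by apply/measurable_EFinP; apply: smeasurable_rnorm; have [] := LfctP F.
rewrite -ge0_integral_sum//; last first.
  by move=> h x _; rewrite lee_fin rnorm_ge0.
apply: ge0_le_integral => //.
- by move=> x _; apply: sume_ge0 => h _; rewrite lee_fin rnorm_ge0.
- by apply: emeasurable_sum => h; exact: mE.
move=> x _; rewrite sumEFin lee_fin big_uniq//= big_mkcond /=.
apply: (@le_trans _ _ (\sum_h if h == g x then rnorm (f x) else 0)); last first.
  by rewrite -big_mkcond big_pred1_eq.
apply: ler_sum => h _; case: ifP => _; last by case: eqP; rewrite ?rnorm_ge0.
case: ifP; rewrite ?rnorm0; last by case: eqP; rewrite ?rnorm_ge0.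
by rewrite inE /= => <-; rewrite eqxx.
Qed.

Definition cell_constant h (u : X) : Prop := exists (f : Lfct) (c : K),
  Lclass f = u /\ forall x, f x = if g x == h then c else 0.

(** The classes constant on a cell and null off it form a space of dimension at most 1: a nonzero
    one has a nonzero constant, and every other is a multiple of it. *)
Lemma cell_generator h : exists e : X, [/\ cell_constant h e, e = 0 \/ rnorm e = 1 &
  forall u, cell_constant h u -> exists c : K, u = c *: e].
Proof.
have [[u [uc u0]]|no] := pselect (exists u, cell_constant h u /\ u <> 0).
  have ru : rnorm u != 0 by apply/eqP => /rnorm0_eq0.
  pose a := sofR k (rnorm u)^-1.
  have [f [c [fu fE]]] := uc.
  have c0 : c != 0.
    apply/eqP => c0; apply: u0; rewrite -fu.
    rewrite -[0]/(0 : X) -(linear0 (@Lclass d T R k mu _ (ell_exp_ge1 R b))).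
    by congr Lclass; apply: val_inj; apply/funext => x /=; rewrite fE c0 if_same.
  have a0 : a != 0
    by rewrite -rnorm_gt0 rnorm_sofR ?invr_ge0 ?rnorm_ge0// invr_gt0 lt_def ru rnorm_ge0.
  exists (a *: u); split.
  - exists (a *: f), (a * c); split; first by rewrite Lclass_scale fu.
    move=> x; have -> : (a *: f : Lfct) x = a * f x by [].
    by rewrite fE; case: eqP => // _; rewrite mulr0.
  - by right; rewrite rnormZ rnorm_sofR ?invr_ge0 ?rnorm_ge0// mulVf.
  move=> v [f' [c' [<- fE']]]; exists (c' / (c * a)); rewrite scalerA -fu -Lclass_scale.
  congr Lclass; apply: val_inj; apply/funext => x.
  have -> : \val ((c' / (c * a) * a) *: f : Lfct) x = c' / (c * a) * a * f x by [].
  rewrite [LHS]fE' fE; case: eqP => // _; last by rewrite mulr0.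
  by rewrite invfM mulrA mulfVK// mulfVK.
exists 0; split; [|by left|].
  exists 0, 0; split; first exact: linear0.
  by move=> x; rewrite if_same.
move=> u uc; exists 0; rewrite scale0r; apply: contrapT => u0.
by apply: no; exists u.
Qed.

End cells.

Section cell_projection.
Context d (T : measurableType d) (R : realType) (k : scalar_kind) (b : ell_kind).
Local Notation K := (scalar_field R k).
Variables (mu : {measure set T -> \bar R}).
Local Notation Lfct := (Lfct k mu (ell_exp_ge1 R b)).
Local Notation X := (Lpspace k mu (ell_exp_ge1 R b)).

Lemma Lfct_sumE (I : Type) (s : seq I) (a : I -> K) (f : I -> Lfct) x :
  (\sum_(i <- s) a i *: f i : Lfct) x = \sum_(i <- s) a i * f i x.
Proof.
elim: s => [|i s IH]; first by rewrite !big_nil.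
by rewrite !big_cons -IH.
Qed.

Variables (G : finType) (g : T -> G).
Hypothesis mg : forall h, measurable [set x | g x = h].

(* Each cell carries a normalized generator [e h] (or [0] when the cell is null or of
   infinite norm), and [W u] tests the restriction of [u] to each cell against a
   norming functional of the generator. *)
Lemma cell_projection : exists (W : {linear X -> ell R k b G}) (e : G -> X),
  [/\ forall u, rnorm (W u) <= rnorm u,
      forall a : ell R k b G, rnorm (lincomb e a) <= rnorm a &
      forall (F : Lfct) (c : G -> K), (forall x, F x = c (g x)) ->
        lincomb e (W (Lclass F)) = Lclass F].
Proof.
have [e eP] := choice (cell_generator k b mu g).
have [f fP] := choice (fun h => let: ex_intro2 f fe f1 := dual_norming (e h) in
  ex_intro (fun f : dual_space X => f (e h) = sofR k (rnorm (e h)) /\ rnorm f <= 1)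
    f (conj fe f1)).
have e1 h : rnorm (e h) <= 1.
  by have [_ [->|->] _] := eP h; rewrite ?rnorm0 ?ler01.
have W0 u s : ell_test b s -> ell_sum s (fun h => f h (cell_restrict mg h u)) <= rnorm u.
  move=> st; apply: le_trans (cell_restrict_sum mg u st); apply: ler_sum => h _.
  by apply: le_trans (dual_le _ _) _; rewrite ler_piMl ?rnorm_ge0// (fP h).2.
have WP u : (fun h => f h (cell_restrict mg h u)) \in @ell_pred R k b G.
  by rewrite inE; exists (rnorm u) => s; exact: W0.
have lW : linear (fun u => Ell (WP u)).
  by move=> a u v; apply: ellP => h /=; rewrite !linearP.
pose W : {linear X -> ell R k b G} := HB.pack (fun u => Ell (WP u))
  (GRing.isLinear.Build K X (ell R k b G) *:%R _ lW).
exists W, e; split.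
- by move=> u; apply: rnorm_ell_le => s; exact: W0.
- move=> a; clear W lW WP W0 fP f; case: b e a eP e1 => e a eP e1.
    by rewrite -[leRHS]mul1r; exact: lincomb_le.
  (* For [l_infty] the generators have disjoint supports, so at each point only the term of its own
     cell remains. *)
  have pre h : exists f : Defs.Lfct k mu (ell_exp_ge1 R EllInfty), Lclass f = e h /\
      exists c, forall x, f x = if g x == h then c else 0.
    by have [[f [c [fe fE]]] _ _] := eP h; exists f; split=> //; exists c.
  have [fc fcP] := choice pre.
  have -> : lincomb e a = Lclass (\sum_h a h *: fc h).
    by rewrite linear_sum; apply: eq_bigr => h _; rewrite linearZ /= (fcP h).1.
  apply: Linfty_le; first exact: rnorm_ge0.
  have ae1 h : {ae mu, forall x, rnorm (fc h x) <= 1}.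
    apply: filterS (Linfty_ae (fc h)) => x /le_trans; apply.
    by rewrite (fcP h).1.
  apply: filterS (filter_forall _ ae1) => x fx.
  have -> : (\sum_h a h *: fc h : Defs.Lfct _ _ _) x = a (g x) * fc (g x) x.
    have sumE (s : seq G) : (\sum_(h <- s) a h *: fc h : Defs.Lfct _ _ _) x =
        \sum_(h <- s) a h * fc h x.
      by elim: s => [|h s IH]; rewrite ?big_nil// !big_cons -IH.
    rewrite sumE (bigD1 (g x))//= big1 ?addr0// => h hg.
    have [c ->] := (fcP h).2; by rewrite eq_sym (negPf hg) mulr0.
  rewrite rnormM; apply: le_trans (ell_coord_le a (g x)).
  by rewrite ler_piMr ?rnorm_ge0.
move=> F c FE; rewrite /lincomb /=.
have RF h : cell_restrict mg h (Lclass F) = Lclass (Lfct_restrict (mg h) F).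
  exact: Lclass_restrictE.
(* The restriction of [F] to a cell is a multiple of the generator, and the norming functional reads
   off the factor since the generator has norm 1 or is 0. *)
have eR h : f h (cell_restrict mg h (Lclass F)) *: e h = cell_restrict mg h (Lclass F).
  have [_ e01 /(_ (cell_restrict mg h (Lclass F)))[]] := eP h.
    exists (Lfct_restrict (mg h) F), (c h); split; first by rewrite RF.
    move=> x /=; rewrite FE; case: ifPn => [|/negP xh].
      by rewrite inE /= => ->; rewrite eqxx.
    by case: eqP => // gx; case: xh; rewrite inE.
  move=> a ->; rewrite linearZ /= (fP h).1.
  have [->|->] := e01; first by rewrite !scaler0.
  by rewrite sofR1 [_ *: 1]mulr1.
under eq_bigr do rewrite eR RF.
rewrite -linear_sum /=; congr Lclass; apply: val_inj; apply/funext => x.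
have E : (\sum_h Lfct_restrict (mg h) F : Lfct) x = \sum_h 1 * Lfct_restrict (mg h) F x.
  rewrite -(Lfct_sumE _ (fun=> 1) (fun h => Lfct_restrict (mg h) F)).
  by under [in RHS]eq_bigr do rewrite scale1r.
apply: (etrans E); rewrite (bigD1 (g x))//= big1.
  by rewrite mul1r addr0 mem_set.
move=> h hg; rewrite memNset ?mulr0//= => gh.
by rewrite gh eqxx in hg.
Qed.

End cell_projection.

Section clip.
Variables (R : realType) (k : scalar_kind).
Local Notation K := (scalar_field R k).

(** Large values are sent to 0 and the others rounded: finitely many values result, all dominated by
    the original modulus. In [L_infty] nothing is cut off, up to a null set, once [N] exceeds the
    norm. *)
Definition clip (N : nat) (z : K) : K := if rnorm z <= N%:R then squant N z else 0.

Lemma rnorm_clip_le N z : rnorm (clip N z) <= rnorm z.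
Proof. by rewrite /clip; case: ifP; rewrite ?rnorm_squant_le// rnorm0 rnorm_ge0. Qed.

Lemma clip_dist N z : rnorm z <= N%:R -> rnorm (z - clip N z) <= 2 / N.+1%:R.
Proof. by rewrite /clip => ->; exact: squant_dist. Qed.

Lemma clip_values N : exists V : seq K, uniq V /\ forall z, clip N z \in V.
Proof.
exists (undup (0 :: squant_values R k N (N * N.+1))); split=> [|z].
  exact: undup_uniq.
rewrite mem_undup inE /clip; case: ifP => [zN|_]; last by rewrite eqxx.
rewrite squant_valuesP ?orbT// (@le_lt_trans _ _ (N * N.+1)%:R) ?ltr_nat//.
by rewrite natrM ler_wpM2r.
Qed.

Lemma measurable_quant N : measurable_fun setT (@quant R N).
Proof.
apply: nondecreasing_measurable => // s t st.
have pos (x y : R) : 0 <= x -> x <= y -> quant N x <= quant N y.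
  move=> x0 xy; have [x00|xn0] := eqVneq x 0.
    rewrite x00 quant0 /quant; apply: mulr_ge0; rewrite ?divr_ge0// sgr_ge0.
    exact: le_trans xy.
  have xp : 0 < x by rewrite lt_def xn0.
  have yp : 0 < y by exact: lt_le_trans xy.
  rewrite /quant !gtr0_sg// !mul1r !gtr0_norm// ler_pM2r ?invr_gt0//.
  by rewrite ler_nat le_truncn// ler_wpM2r.
have qN (x : R) : quant N (- x) = - quant N x.
  by rewrite /quant sgrN normrN mulNr.
have q0 (x : R) : 0 <= x -> 0 <= quant N x by move=> x0; rewrite -(quant0 R N) pos.
have [s0|s0] := lerP 0 s; first exact: pos.
have [t0|t0] := lerP 0 t.
  by rewrite (@le_trans _ _ 0) ?q0// -[s]opprK qN oppr_le0 q0// oppr_ge0 ltW.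
rewrite -[s]opprK -[t]opprK !(qN (- _)) lerN2; apply: pos.
  by rewrite oppr_ge0 ltW.
by rewrite lerN2.
Qed.

Context d (T : measurableType d).

Lemma smeasurable_clip N (f : T -> K) : smeasurable f -> smeasurable (clip N \o f).
Proof.
move=> mf; have mn := smeasurable_rnorm mf.
have mq : smeasurable (squant N \o f).
  have [mr mi] := mf; split.
    rewrite (_ : _ \o _ = quant N \o (@sRe R k \o f)).
      exact: measurableT_comp (@measurable_quant N) mr.
    by apply/funext => x; exact: sRe_squant.
  rewrite (_ : _ \o _ = quant N \o (@sIm R k \o f)).
    exact: measurableT_comp (@measurable_quant N) mi.
  by apply/funext => x; exact: sIm_squant.
have mA : measurable [set x | rnorm (f x) <= N%:R].
  have := mn measurableT _ (measurable_itv `]-oo, (N%:R : R)]).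
  by rewrite setTI; congr measurable; apply/seteqP; split=> x /=; rewrite in_itv.
have := smeasurable_restrict mA mq; congr smeasurable; apply/funext => x.
rewrite /clip /=; case: ifPn => xA; case: ifPn => // xN.
  by rewrite inE /= (negPf xN) in xA.
by rewrite notin_setE /= xN in xA.
Qed.

Lemma smeasurable_fiber (f : T -> K) (c : K) : smeasurable f ->
  measurable [set x | f x = c].
Proof.
move=> [mr mi]; have := measurableI _ _ (mr measurableT _ (measurable_set1 (sRe c)))
  (mi measurableT _ (measurable_set1 (sIm c))).
rewrite !setTI; congr measurable; apply/seteqP; split=> x /=; last by move=> ->.
by move=> [re im]; rewrite -(smkK (f x)) re im smkK.
Qed.

End clip.

Section simple_approximation.
Context d (T : measurableType d) (R : realType) (k : scalar_kind) (b : ell_kind).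
Local Notation K := (scalar_field R k).
Variables (mu : {measure set T -> \bar R}).
Local Notation Lfct := (Lfct k mu (ell_exp_ge1 R b)).
Local Notation X := (Lpspace k mu (ell_exp_ge1 R b)).

Lemma near_inv_le (c e : R) : 0 < e -> \forall N \near \oo, c / N.+1%:R <= e.
Proof.
move=> e0; exists (Num.truncn (`|c| / e)) => // N /= cN.
rewrite ler_pdivrMr// (le_trans (ler_norm c))// -ler_pdivrMl// mulrC.
by apply/ltW; apply: lt_le_trans (truncnS_gt _) _; rewrite ler_nat.
Qed.

Lemma near_nat_ge (c : R) : \forall N \near \oo, c <= N%:R.
Proof.
exists (Num.truncn c).+1 => // N /= cN.
by apply/ltW; apply: lt_le_trans (truncnS_gt _) _; rewrite ler_nat.
Qed.

(** In [L_infty] the error is uniformly at most [2 / (N + 1)] for large [N]; in [L_1] dominated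
    convergence applies with majorant [2 |f|]. *)
Lemma clip_converges (f : Lfct) (e : R) : 0 < e -> \forall N \near \oo,
  forall F : Lfct, (F : T -> K) = clip N \o f -> rnorm (Lclass f - Lclass F) <= e.
Proof.
move=> e0; case: b f => f; last first.
  apply: filterS2 (near_nat_ge (rnorm (Lclass f))) (near_inv_le 2 e0) => N fN Ne F FE.
  have -> : Lclass f - Lclass F = Lclass (f - F) by rewrite linearB.
  apply: Linfty_le; first exact: ltW.
  apply: filterS (Linfty_ae f) => x fx; have -> : (f - F) x = f x - F x by [].
  by rewrite FE; apply: le_trans (clip_dist _) Ne; exact: le_trans fx fN.
pose h N x := (rnorm (f x - clip N (f x)))%:E.
have [mf ffin] := LfctP f.
have mh N : measurable_fun setT (h N).
  apply/measurable_EFinP.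
  have := smeasurable_rnorm (smeasurableD mf (smeasurableZ (-1) (smeasurable_clip N mf))).
  by congr measurable_fun; apply/funext => x; rewrite !fctE /= scaleN1r.
have h0 x : h ^~ x @ \oo --> 0%E.
  apply/fine_cvgP; split; first exact: nearW.
  apply/cvgrPdist_le => r r0.
  apply: filterS2 (near_nat_ge (rnorm (f x))) (near_inv_le 2 r0) => N fN Nr.
  rewrite sub0r normrN /= ger0_norm ?rnorm_ge0//.
  exact: le_trans (clip_dist fN) Nr.
have ig : mu.-integrable setT (fun x => (2%:E * (rnorm (f x))%:E)%E).
  apply: integrableZl => //; apply/integrableP; split.
    by apply/measurable_EFinP; exact: smeasurable_rnorm.
  rewrite (_ : (\int[mu]_x _)%E = (rnorm (Lclass f))%:E) ?ltry// L1_norm.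
  by apply: eq_integral => x _; rewrite gee0_abs// lee_fin rnorm_ge0.
have hg n x : (`|h n x| <= 2%:E * (rnorm (f x))%:E)%E.
  rewrite gee0_abs ?lee_fin ?rnorm_ge0// (le_trans (ler_rnormD _ _))//.
  by rewrite rnormN mulr_natl mulr2n lerD2l rnorm_clip_le.
have [_ + _] := dominated_convergence measurableT mh (measurable_cst 0%E)
  (nearW _ (fun x _ => h0 x)) ig (nearW _ (fun x n _ => hg n x)).
move=> /fine_cvgP[finI /cvgrPdist_le/(_ e e0)].
apply: filterS2 finI => N finI le_e F FE.
have -> : Lclass f - Lclass F = Lclass (f - F) by rewrite linearB.
rewrite -lee_fin L1_norm.
rewrite (_ : (\int[mu]_x _)%E = (\int[mu]_x `|h N x - cst 0 x|)%E).
  move: le_e; rewrite /= sub0r normrN => /(le_trans (ler_norm _)).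
  by rewrite -lee_fin fineK.
apply: eq_integral => x _; rewrite sube0 gee0_abs ?lee_fin ?rnorm_ge0// /h.
by have -> : (f - F) x = f x - F x by []; rewrite FE.
Qed.

Lemma simple_approximation (us : seq X) (e : R) : 0 < e ->
  exists (G : finType) (g : T -> G), (forall h, measurable [set x | g x = h]) /\
  forall u, u \in us -> exists (F : Lfct) (c : G -> K),
    (forall x, F x = c (g x)) /\ rnorm (u - Lclass F) <= e.
Proof.
move=> e0.
have [N NP] : exists N, forall u, u \in us -> forall F : Lfct,
    (F : T -> K) = clip N \o Lrepr u -> rnorm (u - Lclass F) <= e.
  have /filter_ex[N NP] : \forall N \near \oo, forall i : 'I_(size us), forall F : Lfct,
      (F : T -> K) = clip N \o Lrepr (tnth (in_tuple us) i) ->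
      rnorm (tnth (in_tuple us) i - Lclass F) <= e.
    apply: filter_forall => i; have := clip_converges (Lrepr (tnth (in_tuple us) i)) e0.
    by rewrite LreprK.
  exists N => u /(tnthP (in_tuple us))[i ->]; exact: NP.
have [V [uV VP]] := clip_values R k N.
pose f (i : 'I_(size us)) x := clip N (Lrepr (tnth (in_tuple us) i) x).
have fV i x : (index (f i x) V < size V)%N by rewrite index_mem VP.
(* A common partition for all of [us]: the cell of a point records the values there of all the
   clipped functions. *)
pose G : finType := {ffun 'I_(size us) -> 'I_(size V)}.
pose g x : G := [ffun i => Ordinal (fV i x)].
have gE i x : f i x = nth 0 V (g x i) by rewrite ffunE /= nth_index ?VP.
have mf i : smeasurable (f i).
  by apply: (@smeasurable_clip R k d T N); have [] := LfctP (Lrepr (tnth (in_tuple us) i)).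
exists G, g; split=> [h|u].
  have -> : [set x | g x = h] = \bigcap_(i in [set: 'I_(size us)]) [set x | f i x = nth 0 V (h i)].
    apply/seteqP; split=> [x <- i _|x xh] /=; first exact: gE.
    apply/ffunP => i; rewrite ffunE; apply: val_inj => /=.
    by rewrite (xh i)// index_uniq.
  by apply: fin_bigcap_measurable => // i _; exact: smeasurable_fiber.
move=> /(tnthP (in_tuple us))[i ->].
have [|F FE] := @Lfct_dominated _ _ _ _ _ _ _ _ (Lrepr (tnth (in_tuple us) i)) (mf i).
  by move=> x; exact: rnorm_clip_le.
exists F, (fun h : G => nth 0 V (h i)); split=> [x|].
  by rewrite FE gE.
by apply: NP => //; exact: mem_tnth.
Qed.

Lemma Lp_approximation (us : seq X) (e : R) : 0 < e -> exists (G : finType)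
  (W : {linear X -> ell R k b G}) (y : G -> X),
  [/\ forall u, rnorm (W u) <= rnorm u,
      forall a : ell R k b G, rnorm (lincomb y a) <= rnorm a &
      forall u, u \in us -> rnorm (lincomb y (W u) - u) <= e].
Proof.
move=> e0; have e20 : 0 < e / 2 by rewrite divr_gt0.
have [G [g [mg gP]]] := simple_approximation us e20.
have [W [y [W1 y1 Wy]]] := cell_projection k b mu mg.
exists G, W, y; split=> // u uus; have [F [c [Fc Fu]]] := gP u uus.
(* The projection fixes the simple class near [u], so the error is the projection of the remainder
   minus the remainder, each of norm at most [e / 2]. *)
have -> : lincomb y (W u) - u = lincomb y (W (u - Lclass F)) - (u - Lclass F).
  by rewrite (linearB W) linearB /= (Wy F c Fc) opprB addrA subrK.
apply: le_trans (ler_rnormD _ _) _; rewrite rnormN [leRHS]splitr; apply: lerD => //.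
by apply: le_trans (y1 _) _; apply: le_trans (W1 _) _.
Qed.

End simple_approximation.

(** * Factorable operators on finitely many vectors *)

Section factorization.
Variables (R : realType) (k : scalar_kind) (b : ell_kind).
Local Notation K := (scalar_field R k).

Lemma factorization_approximation (E F : banachType R k) (T : {linear E -> F})
    (xs : seq E) (c e : R) : 0 < e ->
  oc_mem (factorable k (ell_exp_ge1 R b)) T ->
  oc_norm (factorable k (ell_exp_ge1 R b)) T < c ->
  exists (G : finType) (W : {linear E -> ell R k b G}) (v : G -> F) (w1 v1 : R),
    [/\ 0 <= w1, 0 <= v1, w1 * v1 <= c, forall x, rnorm (W x) <= w1 * rnorm x &
        (forall a : ell R k b G, rnorm (lincomb v a) <= v1 * rnorm a) /\
        forall x, x \in xs -> rnorm (lincomb v (W x) - T x) <= e].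
Proof.
move=> e0 [cT [d [X [mu [U0 [S0 US0]]]]]] Tc.
have [||_ [d1 [X1 [mu1 [U [S [[cU cS TUS] ->]]]]]] USc] :=
  @inf_approx _ [set c | exists (d : measure_display) (X : measurableType d)
           (mu : {measure set X -> \bar R})
           (U : {linear E -> Lpspace k mu (ell_exp_ge1 R b)})
           (S : {linear Lpspace k mu (ell_exp_ge1 R b) -> dual_space (dual_space F)}),
      factors_through T U S /\ c = opnorm U * opnorm S]
  (c - oc_norm (factorable k (ell_exp_ge1 R b)) T).
- by exists (opnorm U0 * opnorm S0), d, X, mu, U0, S0.
- by rewrite subr_gt0.
have {}USc : opnorm U * opnorm S < c by move: USc; rewrite addrC subrK.
pose u1 := opnorm U; pose s1 := opnorm S.
have u0 : 0 <= u1 by exact: opnorm_ge0.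
have s0 : 0 <= s1 by exact: opnorm_ge0.
(* The slack in [u1 * s1 < c] is spent on the lifted factor: [u1 * (s1 + r) <= c]. The summand 1
   covers [u1 = 0]. *)
pose r := (c - u1 * s1) / (u1 + 1).
have r0 : 0 < r by rewrite divr_gt0 ?subr_gt0 ?ltr_wpDl.
have e20 : 0 < e / 2 by rewrite divr_gt0.
(* The error made in the Lebesgue space is magnified by [S], at most by the factor [s1]. *)
have e' : 0 < e / 2 / (s1 + 1) by rewrite divr_gt0// ltr_wpDl.
have [G [W [y [W1 y1 Wy]]]] := Lp_approximation [seq U x | x <- xs] e'.
pose WU : {linear E -> ell R k b G} := W \o U.
pose Sy : {linear ell R k b G -> dual_space (dual_space F)} := S \o lincomb y.
pose ps := [seq (WU x, T x) | x <- xs].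
have [||q|v [v1 vps]] := @ell_lift R k b G F Sy ps s1 (s1 + r) (e / 2) (e / 2) s0 _ e20.
- by rewrite ltrDl.
- move=> x; apply: le_trans (opnormP _ cS) _.
  by rewrite ler_wpM2l// y1.
- move=> /mapP[x xxs ->] /=; rewrite TUS -linearB.
  apply: le_trans (opnormP _ cS) _.
  apply: (@le_trans _ _ (s1 * (e / 2 / (s1 + 1)))).
    by rewrite ler_wpM2l// Wy// map_f.
  rewrite mulrCA; apply: ler_piMr; first exact: ltW.
  by rewrite ler_pdivrMr ?ltr_wpDl// mul1r lerDl.
exists G, WU, v, u1, (s1 + r); split=> //.
- exact: addr_ge0 s0 (ltW r0).
- rewrite mulrDr -lerBrDl /r mulrA ler_pdivrMr ?ltr_wpDl// mulrC ler_wpM2l//.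
    by rewrite subr_ge0 ltW.
  by rewrite lerDl.
- by move=> x; apply: le_trans (W1 _) _; exact: opnormP.
split=> // x xxs; rewrite [e]splitr; apply: (vps (WU x, T x)).
by apply/mapP; exists x.
Qed.

End factorization.

(** * Functionals on symmetric tensors as multilinear forms *)

Section linear_extension.
Variables (K : numFieldType) (U V : lmodType K) (L : {linear U -> V}).
Hypothesis Linj : injective L.

(* A maximal subspace meeting the range of [L] trivially is a complement of it. *)
Lemma range_complement : exists C : set V,
  [/\ C 0, forall a x y, C x -> C y -> C (a *: x + y),
      forall u, C (L u) -> u = 0 &
      forall v, exists u, C (v - L u)].
Proof.
pose P (C : set V) := (forall a x y, C x -> C y -> C (a *: x + y)) /\
  forall u, C (L u) -> u = 0.
have [|A [[Alin AL] Amax]] := @Zorn_bigcup V P.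
  move=> F FP tF; split=> [a x y [X FX Xx] [Y FY Yy]|u [X FX Xu]]; last exact: (FP X FX).2 Xu.
  have [XY|YX] := tF X Y FX FY.
    by exists Y => //; apply: (FP Y FY).1 => //; exact: XY.
  by exists X => //; apply: (FP X FX).1 => //; exact: YX.
(* [P] holds of the empty set too, so that 0 belongs to the maximal set has to be deduced from
   maximality. *)
pose B : set V := [set x | A x \/ x = 0].
have PB : P B.
  split=> [a x y|u]; last first.
    by move=> [/AL//|]; rewrite -(linear0 L) => /Linj.
  move=> [Ax|->] [Ay|->]; rewrite ?scaler0 ?addr0 ?add0r /B /=; [left|left|by left|by right].
    exact: Alin.
  have A0 : A 0 by have := Alin (-1) x x Ax Ax; rewrite scaleN1r addNr.
  by have := Alin a x 0 Ax A0; rewrite addr0.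
have AB : A = B.
  apply: contrapT => nAB; apply: (Amax B) => //; split; first by move=> x; left.
  by move=> BA; apply: nAB; apply/seteqP; split=> // x; left.
have A0 : A 0 by rewrite AB; right.
exists A; split=> // v; apply: contrapT => nv.
pose D : set V := [set x | exists a c, A c /\ x = c + a *: v].
have PD : P D.
  split=> [a x y [b [c [Ac ->]]] [b' [c' [Ac' ->]]]|u [a [c [Ac Lu]]]].
    exists (a * b + b'), (a *: c + c'); split; first exact: Alin.
    by rewrite scalerDr addrACA scalerA scalerDl.
  have [a0|a0] := eqVneq a 0.
    by apply: AL; rewrite Lu a0 scale0r addr0.
  exfalso; apply: nv; exists (a^-1 *: u).
  have -> : v - L (a^-1 *: u) = (- a^-1) *: c + 0.
    by rewrite linearZ /= Lu scalerDr scalerA mulVf// scale1r addr0 scaleNr opprD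
      addrCA subrr addr0.
  exact: Alin.
apply: (Amax D) => //; split.
  by move=> x Ax; exists 0, x; rewrite scale0r addr0.
move=> DA; apply: nv; exists 0; rewrite linear0 subr0; apply: DA.
by exists 1, 0; rewrite scale1r add0r.
Qed.

Lemma linear_extension (phi : {linear U -> K}) :
  exists Phi : {linear V -> K}, forall u, Phi (L u) = phi u.
Proof.
have [C [C0 Clin CL Cv]] := range_complement.
have [h hP] := choice Cv.
have CN x y : C x -> C y -> C (x - y).
  by move=> Cx Cy; have := Clin (-1) y x Cy Cx; rewrite scaleN1r addrC.
have hE v u : C (v - L u) -> h v = u.
  move=> Cu; apply/eqP; rewrite -subr_eq0; apply/eqP; apply: CL.
  by have := CN _ _ Cu (hP v); rewrite opprB addrC subrKA linearB.
have lin : scalar (phi \o h).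
  move=> a x y; have := Clin a _ _ (hP x) (hP y).
  by rewrite scalerBr addrACA -opprD -linearP /= => /hE ->; rewrite linearP.
exists (HB.pack (phi \o h) (GRing.isLinear.Build K V K *:%R _ lin) : {linear V -> K}).
by move=> u; rewrite /= (hE _ u) ?subrr.
Qed.

End linear_extension.

(** Tensors are functions on [n]-linear forms. Extending [phi] algebraically to all such functions
    and evaluating it at [B |-> B x] gives a multilinear form in [x], which is what
    [continuous_polynomial] asks for. *)
Lemma mform_of_linear (K : numFieldType) (n : nat) (E : lmodType K)
    (phi : {linear symtensor n E -> K}) :
  exists A : mform n E, forall x, A (fun=> x) = phi (tpower n x).
Proof.
have lval : linear (@symtensor_fun K n E) by [].
pose L : {linear symtensor n E -> (mform n E -> K)} := HB.pack (@symtensor_fun K n E)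
  (GRing.isLinear.Build K (symtensor n E) (mform n E -> K) *:%R _ lval).
have Linj : injective L by exact: val_inj.
have [Phi PhiE] := linear_extension Linj phi.
have mA : multilinear (fun x : 'I_n -> E => Phi (fun B : mform n E => B x)).
  move=> i x a u v; rewrite -[RHS](linearP Phi); congr (Phi _); apply/funext => B.
  exact: mform_multilinear.
by exists (MForm mA) => x; rewrite -PhiE.
Qed.

(** * The counting measure *)

(* [g0] is recorded in the type because measurable spaces are pointed. *)
Definition discrete_space (G : choiceType) (g0 : G) : Type := G.

Section discrete_space.
Variables (G : choiceType) (g0 : G).

HB.instance Definition _ := Choice.on (discrete_space g0).
HB.instance Definition _ := isPointed.Build (discrete_space g0) g0.
HB.instance Definition _ := @isMeasurable.Build default_measure_display (discrete_space g0)
  (@discrete_measurable _) (@discrete_measurable0 _) (@discrete_measurableC _)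
  (@discrete_measurableU _).

End discrete_space.

Section counting.
Variables (R : realType) (k : scalar_kind) (b : ell_kind) (G : choiceType) (g0 : G).
Local Notation K := (scalar_field R k).
Local Notation D := (discrete_space g0).
Let mu : {measure set D -> \bar R} := counting.
Local Notation X := (Lpspace k mu (ell_exp_ge1 R b)).

Lemma discrete_measurable_fun (d : measure_display) (Y : measurableType d) (f : D -> Y) :
  measurable_fun setT f.
Proof. by move=> _ A _. Qed.

Lemma counting_set1 (x : D) : mu [set x] = 1%E.
Proof.
by rewrite /mu /= /counting asboolT ?fset_set1 ?finmap.cardfs1//; exact: finite_set1.
Qed.

Lemma counting_ae (P : D -> Prop) : {ae mu, forall x, P x} -> forall x, P x.
Proof.
move=> [N [mN N0 PN]] x; apply: contrapT => Px.
have : (mu [set x] <= mu N)%E by apply: le_measure; rewrite ?inE// => _ ->; exact: PN.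
by rewrite N0 counting_set1 lee_fin ler10.
Qed.

Lemma integral_point_masses (s : seq G) (c : G -> R) : (forall h, 0 <= c h) ->
  (\int[mu]_t \sum_(h <- s) (c h)%:E * (\1_[set (h : D)] t)%:E =
   (\sum_(h <- s) c h)%:E)%E.
Proof.
move=> c0; rewrite (ge0_integral_sum mu measurableT); last 2 first.
- by move=> h; exact: discrete_measurable_fun.
- by move=> h t _; rewrite mule_ge0 ?lee_fin.
rewrite -sumEFin; apply: eq_bigr => h _.
rewrite ge0_integralZl//; last by rewrite lee_fin.
by rewrite integral_indic// setIT counting_set1 mule1.
Qed.

Lemma point_masses_eval (s : seq G) (c : G -> R) (t : G) : uniq s ->
  (\sum_(h <- s) (c h)%:E * (\1_[set (h : D)] t)%:E = (if t \in s then c t else 0)%:E)%E.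
Proof.
move=> us; rewrite (eq_bigr (fun h => (if h == t then c h else 0)%:E)); last first.
  move=> h _; rewrite indicE; case: eqVneq => [->|ht].
    by rewrite mem_set// mule1.
  by rewrite memNset ?mule0// => th; rewrite th eqxx in ht.
rewrite sumEFin; congr EFin; have [ts|ts] := boolP (t \in s).
  rewrite (bigD1_seq t)//= eqxx big1 ?addr0// => h; by case: eqP.
rewrite big_seq big1// => h hs; case: eqP => // ht.
by rewrite -ht hs in ts.
Qed.

End counting.

Section counting_norm.
Variables (R : realType) (k : scalar_kind) (G : choiceType) (g0 : G).
Local Notation K := (scalar_field R k).
Local Notation D := (discrete_space g0).
Let mu : {measure set D -> \bar R} := counting.

Lemma smeasurable_discrete (f : D -> K) : smeasurable f.
Proof. by split; exact: discrete_measurable_fun. Qed.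

Lemma ell_level_finite (x : ell R k EllOne G) (n : nat) : exists s : seq G,
  uniq s /\ forall g, (g \in s) = (n.+1%:R^-1 <= rnorm (x g)).
Proof.
pose A : set G := [set g | n.+1%:R^-1 <= rnorm (x g)].
have [/finite_fsetP[X AX]|/infinite_set_fset] := pselect (finite_set A).
  exists (finmap.enum_fset X); split=> [|g]; first exact: finmap.fset_uniq.
  apply/idP/idP => [gX|gA].
    by have : A g by rewrite AX.
  by have : A g by []; rewrite AX.
(* More than [|x| (n + 1)] coordinates of modulus at least [1 / (n + 1)] would sum to more than the
   norm. *)
move=> /(_ (Num.truncn (rnorm x * n.+1%:R)).+1)[B BA sB]; exfalso.
have := rnorm_ell_ge x (finmap.fset_uniq B : ell_test EllOne (finmap.enum_fset B)).
apply/negP; rewrite -ltNge.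
apply: (@lt_le_trans _ _ (\sum_(g <- finmap.enum_fset B) n.+1%:R^-1)); last first.
  by rewrite /ell_sum big_seq [leRHS]big_seq; apply: ler_sum => g gB; exact: BA.
rewrite big_const_seq count_predT iter_addr_0 -[_ *+ size _]mulr_natl ltr_pdivlMr//.
apply: lt_le_trans (truncnS_gt _) _; by rewrite ler_nat.
Qed.

(** [G] may be uncountable. The integrand is the increasing limit of its restrictions to the finite
    level sets, whose integrals are finite sums bounded by the norm. *)
Lemma ell_integral_le (x : ell R k EllOne G) :
  (\int[mu]_t (rnorm (x t))%:E <= (rnorm x)%:E)%E.
Proof.
have [s sP] := choice (ell_level_finite x).
pose u n (t : D) := (\sum_(h <- s n) (rnorm (x h))%:E * (\1_[set (h : D)] t)%:E)%E.
have uE n t : u n t = (if t \in s n then rnorm (x t) else 0)%:E.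
  by rewrite /u point_masses_eval ?(sP n).1.
have lim_u t : (rnorm (x t))%:E = limn (u^~ t).
  apply/esym/cvg_lim => //.
  have [x0|x0] := eqVneq (x t) 0.
    rewrite (_ : u^~ t = cst 0%E) ?x0 ?rnorm0; first exact: cvg_cst.
    by apply/funext => n; rewrite uE x0 rnorm0 if_same.
  have xt0 : 0 < rnorm (x t) by rewrite rnorm_gt0.
  apply: cvg_near_cst; apply: filterS (near_inv_le 1 xt0) => n.
  by rewrite div1r uE (sP n).2 => ->.
have -> : (\int[mu]_t (rnorm (x t))%:E = \int[mu]_t limn (u^~ t))%E.
  by apply: eq_integral => t _; rewrite lim_u.
have mono_if m n (r : R) : (m <= n)%N -> 0 <= r ->
    (if m.+1%:R^-1 <= r then r else 0) <= (if n.+1%:R^-1 <= r then r else 0).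
  move=> mn r0; case: ifPn => [mr|_]; last by case: ifP.
  rewrite ifT//; apply: le_trans mr.
  by rewrite lef_pV2 ?posrE// ler_nat.
have u0 n t : (0 <= u n t)%E by rewrite uE lee_fin; case: ifP => // _; exact: rnorm_ge0.
have mono := @cvg_monotone_convergence _ D R mu setT measurableT u
  (fun n => discrete_measurable_fun (u n)) (fun n t _ => u0 n t).
have {}mono := cvg_lim (@ereal_hausdorff R) (mono _).
rewrite -mono; last first.
  move=> t _ m n mn; rewrite !uE lee_fin !(sP _).2.
  by apply: mono_if => //; exact: rnorm_ge0.
apply: lime_le.
  apply: ereal_nondecreasing_is_cvgn => m n mn; apply: ge0_le_integral => //.
  move=> t _; rewrite !uE lee_fin !(sP _).2.
  by apply: mono_if => //; exact: rnorm_ge0.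
apply: nearW => n; rewrite integral_point_masses ?lee_fin.
  by apply: rnorm_ell_ge; exact: (sP n).1.
by move=> h; exact: rnorm_ge0.
Qed.

End counting_norm.

Section counting_isometry.
Variables (R : realType) (k : scalar_kind) (b : ell_kind) (G : choiceType) (g0 : G).
Local Notation K := (scalar_field R k).
Local Notation D := (discrete_space g0).
Let mu : {measure set D -> \bar R} := counting.
Local Notation X := (Lpspace k mu (ell_exp_ge1 R b)).

Lemma sLnorm_ell_le (x : ell R k b G) :
  (sLnorm mu (ell_exp R b) (x : D -> K) <= (rnorm x)%:E)%E.
Proof.
case: b x => x.
  rewrite /sLnorm Lnorm1; apply: le_trans (ell_integral_le g0 x).
  rewrite le_eqVlt; apply/orP; left; apply/eqP; apply: eq_integral => t _ /=.
  by rewrite ger0_norm ?rnorm_ge0.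
rewrite /sLnorm unlock /=; case: ifP => _; last by rewrite lee_fin rnorm_ge0.
apply/ess_supP; apply/nearW => t /=; rewrite lee_fin ger0_norm ?rnorm_ge0//.
exact: ell_coord_le.
Qed.

Lemma ell_sum_Lclass (f : Lfct k mu (ell_exp_ge1 R b)) (s : seq G) : ell_test b s ->
  ell_sum s (f : G -> K) <= rnorm (Lclass f).
Proof.
case: b f => f st; last first.
  move: s st => [|g [|//]] _; rewrite /ell_sum ?big_nil ?rnorm_ge0// big_seq1.
  by have := counting_ae (Linfty_ae f); exact.
rewrite -lee_fin L1_norm /ell_sum -(integral_point_masses g0); last by move=> h; exact: rnorm_ge0.
apply: ge0_le_integral => //.
- by move=> t _; rewrite point_masses_eval// lee_fin; case: ifP => // _; exact: rnorm_ge0.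
move=> t _; rewrite point_masses_eval// lee_fin; case: ifP => // _; exact: rnorm_ge0.
Qed.

Lemma ell_in_Lfct (x : ell R k b G) :
  (x : D -> K) \in @Lfct_pred _ D R k mu _ (ell_exp_ge1 R b).
Proof.
rewrite inE; split; first exact: smeasurable_discrete.
exact: le_lt_trans (sLnorm_ell_le x) (ltry _).
Qed.

Lemma Lfct_in_ell (f : Lfct k mu (ell_exp_ge1 R b)) : (f : G -> K) \in @ell_pred R k b G.
Proof. by rewrite inE; exists (rnorm (Lclass f)) => s; exact: ell_sum_Lclass. Qed.

Lemma counting_isometry : exists (U : {linear ell R k b G -> X})
    (V : {linear X -> ell R k b G}),
  [/\ forall x, rnorm (U x) <= rnorm x, forall w, rnorm (V w) <= rnorm w &
      forall x, V (U x) = x].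
Proof.
pose U (x : ell R k b G) : X := Lclass (MkLfct (ell_in_Lfct x)).
pose V (w : X) : ell R k b G := Ell (Lfct_in_ell (Lrepr w)).
have VE f : (V (Lclass f) : G -> K) = f.
  by apply/funext => t; exact: (counting_ae (Lrepr_ae f)).
have lU : linear U.
  move=> a x y; rewrite /U -Lclass_scale -LclassD; congr Lclass.
  exact: val_inj.
have lV : linear V.
  move=> a u v; apply: ellP => t.
  rewrite -[u]LreprK -[v]LreprK -Lclass_scale -LclassD VE.
  have -> : (a *: V (Lclass (Lrepr u)) + V (Lclass (Lrepr v)) : ell R k b G) t =
    a * V (Lclass (Lrepr u)) t + V (Lclass (Lrepr v)) t by [].
  by rewrite !VE.
exists (HB.pack U (GRing.isLinear.Build K _ X *:%R _ lU) : {linear ell R k b G -> X}).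
exists (HB.pack V (GRing.isLinear.Build K X _ *:%R _ lV) : {linear X -> ell R k b G}).
split=> [x|w|x] /=.
- by rewrite /U rnorm_Lspace -lee_fin sLnorm_fin; exact: sLnorm_ell_le.
- rewrite -[in leRHS](LreprK w); apply: rnorm_ell_le => s st; exact: ell_sum_Lclass.
- by apply: ellP => t; rewrite VE.
Qed.

End counting_isometry.

(** * Sums in l_1 and factorable maps *)

Section absolutely_convergent_sums.
Variables (R : realType) (k : scalar_kind) (G : choiceType) (E : banachType R k).
Local Notation K := (scalar_field R k).
Variables (y : G -> E) (y1 : forall g, rnorm (y g) <= 1).
Implicit Types (x : ell R k EllOne G) (s t : seq G).

Let psum x s : E := \sum_(g <- s) x g *: y g.

(** Convergence along the finite subsets of [G] directed by inclusion, since [G] carries no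
    enumeration and may be uncountable. *)
Definition has_sum x (l : E) : Prop := forall e : R, 0 < e ->
  exists2 s, uniq s & forall t, uniq t -> {subset s <= t} -> rnorm (psum x t - l) <= e.

Lemma psum_le x s : rnorm (psum x s) <= ell_sum s x.
Proof.
apply: le_trans (ler_rnorm_sum _ _ _) _; apply: ler_sum => g _.
by rewrite rnormZ ler_piMr ?rnorm_ge0.
Qed.

Lemma uniq_undup_cat s t : [/\ uniq (undup (s ++ t)), {subset s <= undup (s ++ t)} &
  {subset t <= undup (s ++ t)}].
Proof.
by split=> [|g|g]; rewrite ?undup_uniq// mem_undup mem_cat => ->; rewrite ?orbT.
Qed.

Lemma has_sum_unique x l l' : has_sum x l -> has_sum x l' -> l = l'.
Proof.
move=> xl xl'; apply/eqP; rewrite -subr_eq0; apply/eqP/rnorm0_eq0/eqP.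
rewrite eq_le rnorm_ge0 andbT; apply/ler_addgt0Pr => e e0; rewrite add0r.
have e20 : 0 < e / 2 by rewrite divr_gt0.
have [s us sl] := xl _ e20; have [s' us' sl'] := xl' _ e20.
have [u su s'u] := uniq_undup_cat s s'.
rewrite -(subrKA (psum x (undup (s ++ s')))) [e]splitr.
apply: le_trans (ler_rnormD _ _) _; apply: lerD; last exact: sl'.
by rewrite rnormB; exact: sl.
Qed.

(** A finite family that nearly attains the norm leaves mass less than [e] outside. *)
Lemma ell_sum_tail x (e : R) : 0 < e -> exists2 s, uniq s &
  forall t, uniq t -> {subset s <= t} -> rnorm (psum x t - psum x s) <= e.
Proof.
move=> e0; have [s us sx] : exists2 s, uniq s & rnorm x - e < ell_sum s x.
  apply: contrapT => nex; have : rnorm x <= rnorm x - e.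
    apply: rnorm_ell_le => s us; rewrite leNgt; apply/negP => xs.
    by apply: nex; exists s.
  by rewrite lerBrDr gerDl leNgt e0.
exists s => // t ut st.
have tE : perm_eq t (s ++ [seq g <- t | g \notin s]).
  apply: uniq_perm => //.
    rewrite cat_uniq us filter_uniq// andbT; apply/hasPn => g.
    by rewrite mem_filter => /andP[].
  move=> g; rewrite mem_cat mem_filter; have [gs|gs] := boolP (g \in s).
    by rewrite st.
  by [].
have -> : psum x t - psum x s = psum x [seq g <- t | g \notin s].
  by rewrite /psum (perm_big _ tE) big_cat /= [LHS]addrC addKr.
apply: le_trans (psum_le _ _) _.
have := rnorm_ell_ge x (ut : ell_test EllOne t).
rewrite /ell_sum (perm_big _ tE) big_cat /= -/(ell_sum s x); lra.
Qed.

Lemma has_sum_exists x : exists l, has_sum x l.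
Proof.
pose F : set_system E := [set A | exists2 s, uniq s &
  forall t, uniq t -> {subset s <= t} -> A (psum x t)].
have FF : ProperFilter F.
  split.
    by move=> [s us /(_ s us (fun _ => id))].
  split.
  - by exists [::].
  - move=> A B [s us sA] [t ut tB]; have [u su tu] := uniq_undup_cat s t.
    exists (undup (s ++ t)) => // w uw sub; split.
      by apply: sA => // g /su/sub.
    by apply: tB => // g /tu/sub.
  - by move=> A B AB [s us sA]; exists s => // t ut st; apply/AB/sA.
have : cauchy F.
  apply/cauchy_rnormP => e e0; have e20 : 0 < e / 2 by rewrite divr_gt0.
  have [s us sP] := ell_sum_tail x e20; exists (psum x s), s => // t ut st.
  apply: le_lt_trans (sP t ut st) _; rewrite ltr_pdivrMr//; lra.
move=> /cauchy_cvg/cvg_ex[l /cvg_rnormP lF]; exists l => e e0.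
by have [s us sP] := lF e e0; exists s => // t ut st; exact/ltW/sP.
Qed.

Lemma has_sum_linear a x x' l l' : has_sum x l -> has_sum x' l' ->
  has_sum (a *: x + x') (a *: l + l').
Proof.
move=> xl xl' e e0.
have a0 : 0 < rnorm a + 1 by rewrite ltr_wpDl ?rnorm_ge0.
have e1 : 0 < e / 2 / (rnorm a + 1) by rewrite !divr_gt0.
have e20 : 0 < e / 2 by rewrite divr_gt0.
have [s us sl] := xl _ e1; have [s' us' sl'] := xl' _ e20.
have [u su s'u] := uniq_undup_cat s s'; exists (undup (s ++ s')) => // t ut st.
have -> : psum (a *: x + x') t = a *: psum x t + psum x' t.
  rewrite /psum scaler_sumr -big_split; apply: eq_bigr => g _ /=.
  by rewrite scalerDl scalerA.
rewrite opprD addrACA -scalerBr [e]splitr; apply: le_trans (ler_rnormD _ _) _.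
apply: lerD; last by apply: sl' => // g /s'u/st.
rewrite rnormZ; apply: (@le_trans _ _ (rnorm a * (e / 2 / (rnorm a + 1)))).
  by rewrite ler_wpM2l ?rnorm_ge0// sl// => g /su/st.
rewrite mulrCA; apply: ler_piMr; first exact: ltW.
by rewrite ler_pdivrMr// mul1r lerDl.
Qed.

Lemma has_sum_le x l : has_sum x l -> rnorm l <= rnorm x.
Proof.
move=> xl; apply/ler_addgt0Pr => e e0; have [s us sl] := xl _ e0.
rewrite -[l](subrK (psum x s)) addrC; apply: le_trans (ler_rnormD _ _) _.
apply: lerD; last by rewrite rnormB sl.
exact: le_trans (psum_le _ _) (rnorm_ell_ge _ _).
Qed.

Lemma has_sum_delta g : has_sum (ell_delta R k EllOne g) (y g).
Proof.
move=> e e0; exists [:: g] => // t ut gt; rewrite /psum.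
rewrite (bigD1_seq g) ?gt ?mem_seq1//= eqxx scale1r big1 => [|h /negPf hg].
  by rewrite addr0 subrr rnorm0 ltW.
by rewrite hg scale0r.
Qed.

Lemma ell_sum_map : exists Q : {linear ell R k EllOne G -> E},
  (forall x, rnorm (Q x) <= rnorm x) /\ forall g, Q (ell_delta R k EllOne g) = y g.
Proof.
have [q qP] := choice has_sum_exists.
have lq : linear q.
  by move=> a x x'; apply: has_sum_unique (qP _) _; exact: has_sum_linear.
exists (HB.pack q (GRing.isLinear.Build K _ E *:%R q lq) : {linear ell R k EllOne G -> E}).
split=> [x|g]; first exact: has_sum_le.
exact: has_sum_unique (qP _) (has_sum_delta g).
Qed.

End absolutely_convergent_sums.

Section unit_ball_quotient.
Variables (R : realType) (k : scalar_kind) (E : banachType R k).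
Local Notation K := (scalar_field R k).

Definition unit_ball : choiceType := {x : E | rnorm x <= 1}.

Lemma unit_ball_quotient : exists Q : {linear ell R k EllOne unit_ball -> E},
  (forall x, rnorm (Q x) <= rnorm x) /\
  quotient_map (@rnorm R k (ell R k EllOne unit_ball)) (@rnorm R k E) Q.
Proof.
have [Q [Q1 QE]] := @ell_sum_map R k unit_ball E (fun x => val x) (fun x => valP x).
(* The infimum in the quotient norm is attained: [v] is [|v|] times a vector of the unit ball, hence
   the image of [|v|] times a unit vector of [l_1]. *)
have lift (v : E) : exists u, Q u = v /\ rnorm u <= rnorm v.
  pose w := (sofR k (rnorm v))^-1 *: v.
  have w1 : rnorm w <= 1.
    rewrite rnormZ rnormV rnorm_sofR ?rnorm_ge0//.
    have [->|v0] := eqVneq v 0; first by rewrite rnorm0 mulr0 ler01.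
    by rewrite mulVf// gt_eqF// rnorm_gt0.
  exists (sofR k (rnorm v) *: ell_delta R k EllOne (exist _ w w1 : unit_ball)); split.
    rewrite linearZ /= QE /=; have [->|v0] := eqVneq v 0.
      by rewrite rnorm0 sofR0 scale0r.
    by rewrite scalerA mulfV ?scale1r// rnormE normr_eq0.
  rewrite rnormZ rnorm_sofR ?rnorm_ge0// ler_piMr ?rnorm_ge0//.
  exact: rnorm_ell_delta.
exists Q; split=> //; split=> [v|v]; first by have [u [uv _]] := lift v; exists u.
have [u [uv u1]] := lift v.
apply/eqP; rewrite eq_le; apply/andP; split.
  by apply: lb_le_inf; [exists (rnorm u), u|move=> _ [w /= <- <-]].
apply: le_trans u1; apply: (@inf_le _ _ 0); last by exists u.
by move=> _ [w _ <-]; exact: rnorm_ge0.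
Qed.

End unit_ball_quotient.

Section factorable_examples.
Variables (R : realType) (k : scalar_kind).
Local Notation K := (scalar_field R k).

Lemma oc_norm_ge0 (b : ell_kind) (E F : banachType R k) (T : {linear E -> F}) :
  oc_mem (factorable k (ell_exp_ge1 R b)) T ->
  0 <= oc_norm (factorable k (ell_exp_ge1 R b)) T.
Proof.
move=> [_ [d [X [mu [U [S US]]]]]]; apply: lb_le_inf.
  by exists (opnorm U * opnorm S), d, X, mu, U, S.
by move=> _ [d' [X' [mu' [U' [S' [_ ->]]]]]]; rewrite mulr_ge0 ?opnorm_ge0.
Qed.

Lemma bidual_map_is_linear (F : normedModType K) : linear (@bidual_map R k F).
Proof. by move=> a x y; apply: dualP => f /=; rewrite linearP. Qed.

Lemma rnorm_bidual_map_le (F : normedModType K) (x : F) : rnorm (bidual_map x) <= rnorm x.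
Proof.
rewrite rnorm_dual; apply: opnorm_le => f f1 /=.
by apply: le_trans (dual_le _ _) _; rewrite ler_piMl ?rnorm_ge0.
Qed.

(* [ell b G] is isometric to the [L_p] space of the counting measure on [G]. *)
Lemma factorable_through_ell (b : ell_kind) (G : choiceType) (g0 : G)
    (E F : banachType R k) (T : {linear E -> F}) (B : {linear E -> ell R k b G})
    (A : {linear ell R k b G -> F}) :
  (forall x, rnorm (B x) <= rnorm x) -> (forall x, rnorm (A x) <= rnorm x) ->
  (forall x, T x = A (B x)) ->
  oc_mem (factorable k (ell_exp_ge1 R b)) T /\
  oc_norm (factorable k (ell_exp_ge1 R b)) T <= 1.
Proof.
move=> B1 A1 TAB; have [U [V [U1 V1 VU]]] := counting_isometry R k b g0.
pose J : {linear F -> dual_space (dual_space F)} := HB.pack (@bidual_map R k F)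
  (GRing.isLinear.Build K F (dual_space (dual_space F)) *:%R _ (@bidual_map_is_linear F)).
pose UB : {linear E -> _} := U \o B.
pose JAV : {linear _ -> dual_space (dual_space F)} := J \o (A \o V).
have le1 (M N : normedModType K) (L : {linear M -> N}) :
    (forall x, rnorm (L x) <= rnorm x) -> continuous L /\ opnorm L <= 1.
  move=> L1; split; first by apply: (@rnorm_bounded _ _ _ _ L 1) => x; rewrite mul1r.
  by apply: opnorm_le => x x1; exact: le_trans (L1 x) x1.
have [|cUB nUB] := le1 _ _ UB.
  by move=> x; apply: le_trans (U1 _) _; exact: B1.
have [|cJAV nJAV] := le1 _ _ JAV.
  move=> x; apply: le_trans (rnorm_bidual_map_le _) _.
  by apply: le_trans (A1 _) _; exact: V1.
have fT : factors_through T UB JAV.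
  by split=> // x; rewrite /= VU TAB.
have memT : oc_mem (factorable k (ell_exp_ge1 R b)) T.
  split; first by have [|//] := le1 _ _ T => x; rewrite TAB (le_trans (A1 _)).
  by exists default_measure_display, (discrete_space g0), counting, UB, JAV.
split=> //; apply: (@le_trans _ _ (opnorm UB * opnorm JAV)).
  apply: (@inf_le _ _ 0).
    by move=> _ [d' [X' [mu' [U' [S' [_ ->]]]]]]; rewrite mulr_ge0 ?opnorm_ge0.
  by exists default_measure_display, (discrete_space g0), counting, UB, JAV.
by rewrite mulr_ile1 ?opnorm_ge0.
Qed.

End factorable_examples.

(** * Representation of the hulls by polynomial ideals *)

Section Qideal_theory.
Variables (R : realType) (k : scalar_kind) (n : nat).
Local Notation K := (scalar_field R k).
Variables (beta : tensor_norm R k n) (beta_stn : s_tensor_norm beta).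
Variables (E : banachType R k) (p : E -> K) (phi : {linear symtensor n E -> K}).
Hypothesis phip : linearizes phi p.

Let lin_unique (psi : {linear symtensor n E -> K}) : linearizes psi p -> psi =1 phi.
Proof. by move=> psip; apply: eq_symtensor_linear => x; rewrite -psip -phip. Qed.

Lemma Qideal_norm_le (C : R) : 0 <= C -> (forall z, rnorm (phi z) <= C * beta z) ->
  pc_norm (Qideal beta) p <= C.
Proof.
move=> C0 phiC; apply: ge_sup.
  exists (rnorm (phi 0)), phi, 0; split=> //.
  by rewrite (seminorm0 (stn_seminorm beta_stn E)).
move=> _ [psi [z [psip z1 ->]]]; rewrite lin_unique//.
by apply: le_trans (phiC z) _; rewrite ler_piMr.
Qed.

(** Membership in the ideal supplies only some constant [C]; it makes the supremum finite, after
    which the norm itself is an admissible constant. *)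
Lemma Qideal_norm_bound (C : R) : (forall z, rnorm (phi z) <= C * beta z) ->
  0 <= pc_norm (Qideal beta) p /\
  forall z, rnorm (phi z) <= pc_norm (Qideal beta) p * beta z.
Proof.
move=> phiC; have sb := stn_seminorm beta_stn E.
have ge z : beta z <= 1 -> rnorm (phi z) <= pc_norm (Qideal beta) p.
  move=> z1; apply: (@sup_ge _ _ `|C|); last by exists phi, z.
  move=> _ [psi [w [psip w1 ->]]]; rewrite lin_unique//.
  apply: le_trans (phiC w) _; apply: (@le_trans _ _ (`|C| * beta w)).
    by rewrite ler_wpM2r ?stn_ge0// ler_norm.
  by rewrite ler_piMr.
have S0 : 0 <= pc_norm (Qideal beta) p.
  by apply: le_trans (ge 0 _); rewrite ?rnorm_ge0// (seminorm0 sb).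
split=> // z; have [z0|z0] := eqVneq (beta z) 0.
  by have := phiC z; rewrite z0 !mulr0.
have zp : 0 < beta z by rewrite lt_def z0 stn_ge0.
have := ge (sofR k (beta z)^-1 *: z).
rewrite linearZ sb.2 [rnorm (_ *: _)]rnormM rnorm_sofR ?invr_ge0 ?(ltW zp)// mulVf//.
by move=> /(_ (lexx _)); rewrite mulrC ler_pdivrMr.
Qed.

End Qideal_theory.

(** * Functionals composed with factorable operators *)

Section factorable_bound.
Variables (R : realType) (k : scalar_kind) (n : nat) (b : ell_kind).
Local Notation K := (scalar_field R k).

Lemma seq_min_gt0 (I : eqType) (s : seq I) (f : I -> R) : (forall i, 0 < f i) ->
  exists m, 0 < m /\ forall i, i \in s -> m <= f i.
Proof.
move=> f0; elim: s => [|j s [m [m0 ms]]]; first by exists 1.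
exists (Num.min (f j) m); split=> [|i]; first by rewrite lt_min f0.
rewrite inE => /predU1P[->|/ms]; first by rewrite ge_min lexx.
by move=> mi; rewrite ge_min mi orbT.
Qed.

Lemma symtensor_approximation (E F : banachType R k) (T : {linear E -> F})
    (psi : {linear symtensor n F -> K}) (C : R) (z : symtensor n E) (e : R) :
  (forall x, rnorm (psi (tpower n x)) <= C * rnorm x ^+ n) -> 0 < e ->
  exists (xs : seq E) (d : R), 0 < d /\ forall S : {linear E -> F},
    (forall x, x \in xs -> rnorm (S x - T x) <= d) ->
    rnorm (psi (symtensor_map T z)) <= rnorm (psi (symtensor_map S z)) + e.
Proof.
move=> psiC e0; have [s ->] := symtensorP z.
pose M := \sum_(c <- s) rnorm c.1.
have M0 : 0 < M + 1 by rewrite ltr_wpDl ?sumr_ge0// => c _; exact: rnorm_ge0.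
have eM : 0 < e / (M + 1) by rewrite divr_gt0.
have cont (x : E) := let: ex_intro2 d d0 H := power_continuous psiC (T x) eM in
  ex_intro (fun d => 0 < d /\ forall y, rnorm (y - T x) < d ->
    rnorm (psi (tpower n y) - psi (tpower n (T x))) < e / (M + 1)) d (conj d0 H).
have [d dP] := choice cont.
have [m [m0 ms]] := seq_min_gt0 [seq c.2 | c <- s] (fun x => (dP x).1).
exists [seq c.2 | c <- s], (m / 2); split=> [|S Sx]; first by rewrite divr_gt0.
rewrite -lerBlDl !symtensor_map_sum.
set a := psi _; set a' := psi _.
apply: (@le_trans _ _ (rnorm (a - a'))).
  by rewrite lerBlDr -[in leLHS](subrK a' a) ler_rnormD.
have -> : a - a' = \sum_(c <- s) c.1 * (psi (tpower n (T c.2)) - psi (tpower n (S c.2))).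
  rewrite /a /a' !linear_sum -big_split; apply: eq_bigr => c _ /=.
  by rewrite mulrBr; congr (_ - _); exact: linearZ.
apply: le_trans (ler_rnorm_sum _ _ _) _.
apply: (@le_trans _ _ (\sum_(c <- s) rnorm c.1 * (e / (M + 1)))).
  rewrite big_seq [leRHS]big_seq; apply: ler_sum => c cs.
  rewrite rnormM ler_wpM2l ?rnorm_ge0// rnormB ltW//; apply: (dP c.2).2.
  have cm : c.2 \in [seq c.2 | c <- s] by exact: map_f.
  apply: le_lt_trans (Sx _ cm) _; apply: lt_le_trans (ms _ cm).
  by rewrite ltr_pdivrMr// ltr_pMr// ltr1n.
rewrite -mulr_suml mulrCA; apply: ler_piMr; first exact: ltW.
by rewrite ler_pdivrMr// mul1r lerDl.
Qed.

(** Both identities reduce to the hypothesis [bound], an estimate for products through [ell b G]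
    with [G] finite. The constant [a] also carries the tensor norm of [z], so the limits in the
    error and in the factorization norm are taken here once. *)
Lemma factorable_bound (E F : banachType R k) (T : {linear E -> F})
    (psi : {linear symtensor n F -> K}) (C a : R) (z : symtensor n E) :
  oc_mem (factorable k (ell_exp_ge1 R b)) T ->
  (forall x, rnorm (psi (tpower n x)) <= C * rnorm x ^+ n) -> 0 <= a ->
  (forall (G : finType) (W : {linear E -> ell R k b G}) (v : G -> F) (w1 v1 : R),
    0 <= w1 -> 0 <= v1 -> (forall x, rnorm (W x) <= w1 * rnorm x) ->
    (forall x : ell R k b G, rnorm (lincomb v x) <= v1 * rnorm x) ->
    rnorm (psi (symtensor_map (lincomb v) (symtensor_map W z))) <=
      a * (v1 ^+ n * w1 ^+ n)) ->
  rnorm (psi (symtensor_map T z)) <=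
    a * oc_norm (factorable k (ell_exp_ge1 R b)) T ^+ n.
Proof.
move=> memT psiC a0 bound; apply: ler_limit_exp => c Tc.
apply/ler_addgt0Pr => e e0.
have [xs [d [d0 dS]]] := symtensor_approximation T z psiC e0.
have [G [W [v [w1 [v1 [w0 v0 wv Wx [vx vWx]]]]]]] :=
  factorization_approximation xs d0 memT Tc.
pose S : {linear E -> F} := lincomb v \o W.
apply: le_trans (dS S vWx) _; rewrite lerD2r.
have <- : symtensor_map (lincomb v) (symtensor_map W z) = symtensor_map S z.
  exact: symtensor_map_comp.
apply: le_trans (bound G W v w1 v1 w0 v0 Wx vx) _.
rewrite ler_wpM2l// -exprMn mulrC lerXn2r// nnegrE ?mulr_ge0//.
by apply: le_trans wv; rewrite mulr_ge0.
Qed.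

End factorable_bound.

(** * The identity for the injective hull *)

Section injective_part.
Variables (R : realType) (k : scalar_kind) (n : nat).
Local Notation K := (scalar_field R k).
Variables (beta : tensor_norm R k n) (beta_stn : s_tensor_norm beta).

Lemma stn_functional_power (gamma : tensor_norm R k n) (E : banachType R k)
    (psi : {linear symtensor n E -> K}) (C : R) : s_tensor_norm gamma -> 0 <= C ->
  (forall z, rnorm (psi z) <= C * gamma E z) ->
  forall x, rnorm (psi (tpower n x)) <= C * rnorm x ^+ n.
Proof.
move=> gstn C0 psiC x; apply: le_trans (psiC _) _.
by rewrite ler_wpM2l// stn_power_le.
Qed.

Lemma linear_comp_map (E F : banachType R k) (T : {linear E -> F})
    (psi : {linear symtensor n F -> K}) (q : F -> K) : linearizes psi q ->
  exists2 phi : {linear symtensor n E -> K}, linearizes phi (q \o T) &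
    forall z, phi z = psi (symtensor_map T z).
Proof.
move=> psiq; have lphi : scalar (fun z : symtensor n E => psi (symtensor_map T z)).
  by move=> a u v; rewrite !linearP.
exists (HB.pack (fun z : symtensor n E => psi (symtensor_map T z))
  (GRing.isLinear.Build K (symtensor n E) K *:%R _ lphi) : {linear symtensor n E -> K}) => //.
by move=> x /=; rewrite psiq symtensor_map_power.
Qed.

Lemma factorable_infty_bound (E F : banachType R k) (T : {linear E -> F})
    (psi : {linear symtensor n F -> K}) (C : R) (z : symtensor n E) :
  oc_mem (factorable_infty R k) T -> 0 <= C ->
  (forall w, rnorm (psi w) <= C * beta w) ->
  rnorm (psi (symtensor_map T z)) <=
    C * oc_norm (factorable_infty R k) T ^+ n * inj_hull beta z.
Proof.
move=> memT C0 psiC; rewrite mulrAC.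
have hstn := inj_hull_stn beta_stn.
apply: (@factorable_bound R k n EllInfty E F T psi C) => //.
- exact: stn_functional_power beta_stn C0 psiC.
- by rewrite mulr_ge0// stn_ge0.
(* [v] is paid for by the mapping property of [beta]; [W], having values in [l_infty^G], is absorbed
   by the hull. *)
move=> G W v w1 v1 w0 v0 Wx vx; apply: le_trans (psiC _) _; rewrite -mulrA ler_wpM2l//.
apply: (@le_trans _ _ (v1 ^+ n * @beta (ell R k EllInfty G) (symtensor_map W z))).
  exact: stn_map_le.
rewrite mulrCA ler_wpM2l ?exprn_ge0// mulrC.
exact: inj_hull_map.
Qed.

Lemma injective_hull_ideal (beta_inj : tensor_norm R k n) :
  is_injective_hull beta beta_inj ->
  poly_class_eq (Qideal beta_inj) (pc_comp n (Qideal beta) (factorable_infty R k)).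
Proof.
move=> [istn inj_inj inj_le inj_max] E p.
have hull_le : tensor_norm_le (inj_hull beta) beta_inj.
  apply: inj_max; [exact: inj_hull_stn|exact: inj_hull_injective|exact: inj_hull_le].
have upper (F : banachType R k) (T : {linear E -> F}) (q : F -> K) :
    oc_mem (factorable_infty R k) T -> pc_mem (Qideal beta) q ->
    exists phi : {linear symtensor n E -> K}, linearizes phi (q \o T) /\
      forall z, rnorm (phi z) <=
        (pc_norm (Qideal beta) q * oc_norm (factorable_infty R k) T ^+ n) * beta_inj E z.
  move=> memT [psi [psiq [C psiC]]].
  have [S0 psiS] := Qideal_norm_bound beta_stn psiq psiC.
  have [phi phip phiE] := linear_comp_map T psiq; exists phi; split=> // z.
  rewrite phiE; apply: le_trans (factorable_infty_bound z memT S0 psiS) _.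
  rewrite ler_wpM2l ?hull_le// mulr_ge0// exprn_ge0//.
  exact: (@oc_norm_ge0 R k EllInfty).
(* Injectivity of [beta_inj] and [beta_inj <= beta] bound [phi] by [C * beta] on the image of the
   canonical embedding. The extension gives one factorization that reaches [C], without any error
   term. *)
have lower (phi : {linear symtensor n E -> K}) (C : R) : linearizes phi p -> 0 <= C ->
    (forall z, rnorm (phi z) <= C * beta_inj E z) ->
    exists (F : banachType R k) (T : {linear E -> F}) (q : F -> K),
      [/\ oc_mem (factorable_infty R k) T, pc_mem (Qideal beta) q, p = q \o T &
        pc_norm (Qideal beta) q * oc_norm (factorable_infty R k) T ^+ n <= C].
  move=> phip C0 phiC; pose F : banachType R k := ell R k EllInfty (dual_ball E).
  pose T : {linear E -> F} := @canonical_embedding R k E.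
  pose N (w : symtensor n F) := C * beta w.
  have sN : seminorm N.
    have sb := stn_seminorm beta_stn F.
    split=> [u v|a u]; first by rewrite /N -mulrDr ler_wpM2l// sb.1.
    by rewrite /N sb.2 mulrCA.
  have [z|psi [psiT psiN]] := @hahn_banach R k _ _
      (symtensor_map T : {linear symtensor n E -> symtensor n F}) phi N sN.
    apply: le_trans (phiC z) _; rewrite /N ler_wpM2l//.
    rewrite -(inj_inj E F T (@canonical_embedding_isometric R k E)); exact: inj_le.
  have psiq : linearizes psi (fun y => psi (tpower n y)) by [].
  (* The zero functional is the base point of the index set, which has to be a pointed measurable
     space. *)
  have z0 : rnorm (0 : dual_space E) <= 1 by rewrite rnorm0 ler01.
  have [||//|memT nT] := @factorable_through_ell R k EllInfty (dual_ball E)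
      (exist _ 0 z0) E F T T idfun.
  - by move=> x; rewrite canonical_embedding_isometric.
  - by [].
  exists F, T, (fun y => psi (tpower n y)); split=> //.
  - by exists psi; split=> //; exists C.
  - by apply/funext => x; rewrite /= -symtensor_map_power psiT -phip.
  rewrite -[leRHS]mulr1 ler_pM//.
  - by have [] := Qideal_norm_bound beta_stn psiq psiN.
  - by rewrite exprn_ge0// (@oc_norm_ge0 R k EllInfty).
  - exact: Qideal_norm_le.
  by rewrite exprn_ile1// (@oc_norm_ge0 R k EllInfty).
have memP : pc_mem (Qideal beta_inj) p <->
    pc_mem (pc_comp n (Qideal beta) (factorable_infty R k)) p.
  split=> [[phi [phip [C phiC]]]|[F [T [q [memT memq ->]]]]].
    have [S0 phiS] := Qideal_norm_bound istn phip phiC.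
    have [F [T [q [memT memq pE _]]]] := lower phi _ phip S0 phiS.
    by exists F, T, q.
  have [phi [phip phiC]] := upper F T q memT memq.
  by exists phi; split=> //; eexists; exact: phiC.
split=> // pmem; apply/eqP; rewrite eq_le; apply/andP; split.
  move/memP : (pmem) => [F0 [T0 [q0 [memT0 memq0 pE0]]]].
  apply: lb_le_inf.
    by exists (pc_norm (Qideal beta) q0 * oc_norm (factorable_infty R k) T0 ^+ n), F0, T0, q0.
  move=> _ [F [T [q [memT memq pE ->]]]].
  have [phi [phip phiC]] := upper F T q memT memq; rewrite pE.
  apply: (Qideal_norm_le istn phip) => //.
  case: memq => psi [psiq [C psiC]]; have [S0 _] := Qideal_norm_bound beta_stn psiq psiC.
  by rewrite mulr_ge0// exprn_ge0// (@oc_norm_ge0 R k EllInfty).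
case: pmem => phi [phip [C phiC]]; have [S0 phiS] := Qideal_norm_bound istn phip phiC.
have [F [T [q [memT memq pE le]]]] := lower phi _ phip S0 phiS.
apply: le_trans le; apply: (@inf_le _ _ 0); last by exists F, T, q.
move=> _ [F' [T' [q' [memT' [psi [psiq [C' psiC]]] _ ->]]]].
have [S0' _] := Qideal_norm_bound beta_stn psiq psiC.
by rewrite mulr_ge0// exprn_ge0// (@oc_norm_ge0 R k EllInfty).
Qed.

End injective_part.

(** * The identity for the projective hull *)

Section projective_part.
Variables (R : realType) (k : scalar_kind) (n : nat) (n_gt0 : (0 < n)%N).
Local Notation K := (scalar_field R k).
Variables (beta : tensor_norm R k n) (beta_stn : s_tensor_norm beta).

Lemma projective_hull_ideal (beta_proj : tensor_norm R k n) :
  is_projective_hull beta beta_proj ->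
  poly_class_eq (Qideal beta_proj) (pc_quot n (Qideal beta) (factorable_one R k)).
Proof.
move=> [pstn proj_proj proj_ge proj_min] E p.
have hull_ge : tensor_norm_le beta_proj (proj_hull beta).
  apply: proj_min; [exact: proj_hull_stn|exact: proj_hull_projective|].
  exact: proj_hull_ge.
(* [v] is paid for by the mapping property of the hull and [W] by that of [beta]; they meet on
   [l_1^H], where the hull is at most [beta]. *)
have restrict (phi : {linear symtensor n E -> K}) (C : R) (G : banachType R k)
    (T : {linear G -> E}) (w : symtensor n G) : 0 <= C ->
    (forall z, rnorm (phi z) <= C * beta_proj E z) -> oc_mem (factorable_one R k) T ->
    rnorm (phi (symtensor_map T w)) <=
      C * oc_norm (factorable_one R k) T ^+ n * beta w.
  move=> C0 phiC memT; rewrite mulrAC.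
  apply: (@factorable_bound R k n EllOne G E T phi C) => //.
  - exact: stn_functional_power pstn C0 phiC.
  - by rewrite mulr_ge0// stn_ge0.
  move=> H W v w1 v1 w0 v0 Wx vx; apply: le_trans (phiC _) _; rewrite -mulrA ler_wpM2l//.
  apply: le_trans (hull_ge _ _) _.
  apply: (@le_trans _ _ (v1 ^+ n * @proj_hull R k n beta (ell R k EllOne H) (symtensor_map W w))).
    exact: proj_hull_map_le.
  rewrite mulrCA ler_wpM2l ?exprn_ge0// mulrC; apply: le_trans (proj_hull_ell _ _) _ => //.
  exact: stn_map_le.
have [Q [Q1 Qquot]] := unit_ball_quotient E.
have z0 : rnorm (0 : E) <= 1 by rewrite rnorm0 ler01.
have [||//|memQ nQ] := @factorable_through_ell R k EllOne (unit_ball E)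
    (exist _ 0 z0) _ E Q idfun Q.
- by [].
- exact: Q1.
have quot_norm (phi : {linear symtensor n E -> K}) (C : R) (G : banachType R k)
    (T : {linear G -> E}) : 0 <= C -> linearizes phi p ->
    (forall z, rnorm (phi z) <= C * beta_proj E z) -> oc_mem (factorable_one R k) T ->
    pc_mem (Qideal beta) (p \o T) /\
    (oc_norm (factorable_one R k) T <= 1 -> pc_norm (Qideal beta) (p \o T) <= C).
  move=> C0 phip phiC memT; have [psi psip psiE] := linear_comp_map T phip.
  have T0 := @oc_norm_ge0 R k EllOne _ _ _ memT.
  have psiC z : rnorm (psi z) <= C * oc_norm (factorable_one R k) T ^+ n * beta z.
    by rewrite psiE; exact: restrict.
  split; first by exists psi; split=> //; eexists; exact: psiC.
  move=> T1; apply: le_trans (Qideal_norm_le beta_stn psip _ psiC) _.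
    by rewrite mulr_ge0// exprn_ge0.
  by rewrite ler_piMr// exprn_ile1.
(* The quotient map [Q] alone determines the norm: a bound of [phi] after [Q] by [beta <= beta_proj]
   on the space over the unit ball descends to [E], because [beta_proj] is projective. *)
have lower (phi : {linear symtensor n E -> K}) (S : R) : linearizes phi p ->
    pc_mem (Qideal beta) (p \o Q) -> pc_norm (Qideal beta) (p \o Q) <= S ->
    0 <= S /\ forall z, rnorm (phi z) <= S * beta_proj E z.
  move=> phip [psi [psip [C psiC]]] QS.
  have [S0' psiS] := Qideal_norm_bound beta_stn psip psiC.
  have S0 : 0 <= S by exact: le_trans QS.
  split=> // z; have [psi' psip' psiE'] := linear_comp_map Q phip.
  have phiQ w : rnorm (phi (symtensor_map Q w)) <= S * beta_proj _ w.
    rewrite -psiE' (@eq_symtensor_linear _ _ _ psi' psi); last first.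
      by move=> x; rewrite -psip' -psip.
    apply: le_trans (psiS w) _; apply: ler_pM => //; exact: stn_ge0.
  have [Qsurj Qinf] := proj_proj _ _ Q Qquot.
  have [w0 w0z] := Qsurj z.
  have [S_eq0|S_neq0] := eqVneq S 0.
    by have := phiQ w0; rewrite w0z S_eq0 !mul0r.
  have Sp : 0 < S by rewrite lt_def S_neq0.
  rewrite Qinf -ler_pdivrMl//; apply: lb_le_inf; first by exists (beta_proj _ w0), w0.
  by move=> _ [w /= wz <-]; rewrite ler_pdivrMl// -wz.
have memP : pc_mem (Qideal beta_proj) p <->
    pc_mem (pc_quot n (Qideal beta) (factorable_one R k)) p.
  split=> [[phi [phip [C phiC]]]|[[_ [A pA]] memT [S Sub]]].
    have [S0 phiS] := Qideal_norm_bound pstn phip phiC.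
    split.
    - split.
        apply: continuous_rnormP => x e e0.
        have [d d0 xd] := power_continuous (stn_functional_power pstn S0 phiS) x e0.
        by exists d => // y yx; rewrite !phip; exact: xd.
      by have [A AE] := mform_of_linear phi; exists A => x; rewrite AE phip.
    - by move=> G T memT; have [] := quot_norm phi _ G T S0 phip phiS memT.
    exists (pc_norm (Qideal beta_proj) p) => _ [G [T [memT T1 ->]]].
    by have [_] := quot_norm phi _ G T S0 phip phiS memT; exact.
  (* Since tensors are functions on forms, evaluation at [A] is the functional that linearizes
     [p]. *)
  have lphi : scalar (fun z : symtensor n E => z A) by [].
  pose phi : {linear symtensor n E -> K} := HB.pack (fun z : symtensor n E => z A)
    (GRing.isLinear.Build K (symtensor n E) K *:%R _ lphi).
  have phip : linearizes phi p by move=> x; rewrite pA.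
  have [|S0 phiS] := lower phi S phip (memT _ Q memQ).
    by apply: Sub; exists (ell R k EllOne (unit_ball E)), Q.
  by exists phi; split=> //; exists S.
split=> // pmem; have [[_ [A pA]] memT [S Sub]] := memP.1 pmem.
case: pmem => phi [phip [C phiC]].
have [S0 phiS] := Qideal_norm_bound pstn phip phiC.
have Qle : pc_norm (Qideal beta) (p \o Q) <=
    pc_norm (pc_quot n (Qideal beta) (factorable_one R k)) p.
  by apply: (sup_ge Sub); exists (ell R k EllOne (unit_ball E)), Q.
apply/eqP; rewrite eq_le; apply/andP; split.
  have [S1 phiS1] := lower phi _ phip (memT _ Q memQ) Qle.
  exact: Qideal_norm_le.
apply: ge_sup.
  by exists (pc_norm (Qideal beta) (p \o Q)), (ell R k EllOne (unit_ball E)), Q.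
move=> _ [G [T [memT' T1 ->]]].
by have [_] := quot_norm phi _ G T S0 phip phiS memT'; exact.
Qed.

End projective_part.

Theorem theorem2p1 (R : realType) (k : scalar_kind) (n : nat) (n_gt0 : (0 < n)%N)
  (beta : tensor_norm R k n) (beta_stn : s_tensor_norm beta) :
  (forall beta_inj : tensor_norm R k n, is_injective_hull beta beta_inj ->
     poly_class_eq (Qideal beta_inj)
                   (pc_comp n (Qideal beta) (factorable_infty R k))) /\
  (forall beta_proj : tensor_norm R k n, is_projective_hull beta beta_proj ->
     poly_class_eq (Qideal beta_proj)
                   (pc_quot n (Qideal beta) (factorable_one R k))).
Proof.
split=> gamma; [exact: injective_hull_ideal|exact: projective_hull_ideal].
Qed.
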